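(* For all real $\alpha,\beta,\lambda>0$ there exists a constant $\eta_0>0$ such that the following holds. Let $A,B\colon\mathbb{R}^d\to\mathbb{R}^d$ be Lipschitz maps with constants $C_A,C_B\ge 0$, i.e. $|A(q_1)-A(q_2)|\le C_A|q_1-q_2|$ and $|B(q_1)-B(q_2)|\le C_B|q_1-q_2|$ for all $q_1,q_2\in\mathbb{R}^d$, with $B$ odd, and suppose $0\le C_A+C_B<\eta_0$. Let $\rho_0\in\mathcal{P}_2(\mathbb{R}^{3d})$. Then there exists a constant $C>0$, independent of $N$, such that for every integer $N\ge1$ the following holds. Let $(Q^i_0,P^i_0,Z^i_0)$, $i=1,\dots,N$, be independent $\mathbb{R}^{3d}$-valued random variables with law $\rho_0$, independent of the independent standard Brownian motions $W^1,\dots,W^N$ on $\mathbb{R}^d$. Let $(Q^{i,N}_t,P^{i,N}_t,Z^{i,N}_t)_{t\ge0,\,1\le i\le N}$ be the solution of the interacting particle system $$\begin{cases}dQ^{i,N}_t=P^{i,N}_t\,dt,\\ dP^{i,N}_t=-\beta Q^{i,N}_t\,dt-A(Q^{i,N}_t)\,dt-\frac1N\sum_{j=1}^N B(Q^{i,N}_t-Q^{j,N}_t)\,dt+\lambda Z^{i,N}_t\,dt,\\ dZ^{i,N}_t=-\lambda P^{i,N}_t\,dt-\alpha Z^{i,N}_t\,dt+\sqrt2\,dW^i_t,\\ (Q^{i,N}_0,P^{i,N}_0,Z^{i,N}_0)=(Q^i_0,P^i_0,Z^i_0),\end{cases}$$ and let $(\tilde Q^i_t,\tilde P^i_t,\tilde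 Z^i_t)_{t\ge0}$, $1\le i\le N$, be the solutions of $$\begin{cases}d\tilde Q^i_t=\tilde P^i_t\,dt,\\ d\tilde P^i_t=-\beta\tilde Q^i_t\,dt-A(\tilde Q^i_t)\,dt-B\ast\mu_t(\tilde Q^i_t)\,dt+\lambda\tilde Z^i_t\,dt,\\ d\tilde Z^i_t=-\lambda\tilde P^i_t\,dt-\alpha\tilde Z^i_t\,dt+\sqrt2\,dW^i_t,\\ (\tilde Q^i_0,\tilde P^i_0,\tilde Z^i_0)=(Q^i_0,P^i_0,Z^i_0),\end{cases}$$ where $\mu_t$ is the law of $(\tilde Q^i_t,\tilde P^i_t,\tilde Z^i_t)$ (which does not depend on $i$). Then for all $i=1,\dots,N$, $$\sup_{t\ge0}\mathbb{E}\left(|Q^{i,N}_t-\tilde Q^i_t|^2+|P^{i,N}_t-\tilde P^i_t|^2+|Z^{i,N}_t-\tilde Z^i_t|^2\right)\le\frac CN.$$ As a consequence, the interacting particle system satisfies the property of propagation of chaos with respect to $\mu_t$. In addition, the law $\rho^{(1,N)}_t$ of any $(Q^{i,N}_t,P^{i,N}_t,Z^{i,N}_t)$ converges to $\mu_t$ uniformly in $t$ in the Wasserstein metric, with $$\sup_{t\ge0}W_2(\rho^{(1,N)}_t,\mu_t)^2\le\frac CN.$$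
   Context: $d\ge1$ is an integer; points of $\mathbb{R}^{3d}$ are written $(q,p,z)$ with $q,p,z\in\mathbb{R}^d$. $\mathcal{P}_2(\mathbb{R}^{3d})$ is the set of Borel probability measures on $\mathbb{R}^{3d}$ with finite second moment. For a probability measure $\rho$ on $\mathbb{R}^{3d}$, $B\ast\rho(q)=\int_{\mathbb{R}^{3d}}B(q-q')\,\rho(dq'dp'dz')$. Under the stated Lipschitz conditions both systems of stochastic differential equations are well posed for square-integrable initial data. The law $\mu_t$ is the unique measure solution in $\mathcal{P}_2(\mathbb{R}^{3d})$, with initial datum $\rho_0$, of $$\partial_t\mu_t=-p\cdot\nabla_q\mu_t+\left[\beta q+A(q)+B\ast\mu_t(q)-\lambda z\right]\cdot\nabla_p\mu_t+\mathrm{div}_z[(\lambda p+\alpha z)\mu_t]+\Delta_z\mu_t .$$ $W_2$ is the Wasserstein distance: $W_2(\mu,\nu)^2=\inf\mathbb{E}\left(|Q-\tilde Q|^2+|P-\tilde P|^2+|Z-\tilde Z|^2\right)$, the infimum being over all pairs of $\mathbb{R}^{3d}$-valued random variables $(Q,P,Z)$ and $(\tilde Q,\tilde P,\tilde Z)$ (on a common probability space) with laws $\mu$ and $\nu$ respectively. Propagation of chaos: write $X^{i,N}_t=(Q^{i,N}_t,P^{i,N}_t,Z^{i,N}_t)$. The interacting particle system satisfies the property of propagation of chaos with respect to $\mu_t$ if, for every $t\ge0$, every fixed integer $k\ge1$ and all $k$-tuples $(i_1,\dots,i_k)$ of pairwise distinct indices in $\{1,\dots,N\}$, the joint law of $(X^{i_1,N}_t,\dots,X^{i_k,N}_t)$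 converges narrowly (i.e. tested against bounded continuous functions) to the product measure $(\mu_t)^{\otimes k}$ as $N\to\infty$. *)

(* Defs.v *)
From HB Require Import structures.
From mathcomp Require Import all_boot all_order all_algebra.
From mathcomp Require Import all_classical all_reals all_analysis.

Set Implicit Arguments.
Unset Strict Implicit.
Unset Printing Implicit Defensive.

Import Order.TTheory GRing.Theory Num.Theory.
Import numFieldNormedType.Exports.

Local Open Scope classical_set_scope.
Local Open Scope ring_scope.

(* ['rV[R]_d] carries its Borel sigma-algebra.  The library topology comes from
   the sup norm, which is equivalent to the Euclidean one. *)
Definition mx_borel_display : measure_display.
Proof. exact: default_measure_display. Qed.

Section mx_borel.
Context (R : realType) (m n : nat).
Let mx_borel : set (set 'M[R]_(m, n)) := <<s [set U | open U] >>.
Let mx_borel0 : mx_borel set0. Proof. exact: sigma_algebra0. Qed.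
Let mx_borelC (U : set 'M[R]_(m, n)) : mx_borel U -> mx_borel (~` U).
Proof. exact: sigma_algebraC. Qed.
Let mx_borelU (F : (set 'M[R]_(m, n))^nat) :
  (forall i, mx_borel (F i)) -> mx_borel (\bigcup_i F i).
Proof. exact: sigma_algebra_bigcup. Qed.

HB.instance Definition _ := @isMeasurable.Build mx_borel_display
  'M[R]_(m, n) mx_borel mx_borel0 mx_borelC mx_borelU.
End mx_borel.

(* The point (q, p, z) of R^(3d) is the nested pair ((q, p), z).  The product
   sigma-algebra is the Borel one, since R^d is second countable. *)
Notation phase R d := ('rV[R]_d * 'rV[R]_d * 'rV[R]_d)%type.

Definition qof {R : realType} {d : nat} (x : phase R d) : 'rV[R]_d := x.1.1.
Definition pof {R : realType} {d : nat} (x : phase R d) : 'rV[R]_d := x.1.2.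
Definition zof {R : realType} {d : nat} (x : phase R d) : 'rV[R]_d := x.2.

(* Euclidean norms: the library norm on ['rV[R]_d] is the sup norm. *)
Definition sqnorm (R : realType) (d : nat) (v : 'rV[R]_d) : R :=
  \sum_(c < d) v 0 c ^+ 2.

Definition enorm (R : realType) (d : nat) (v : 'rV[R]_d) : R :=
  Num.sqrt (sqnorm v).

Definition phase_sqnorm (R : realType) (d : nat) (x : phase R d) : R :=
  sqnorm (qof x) + sqnorm (pof x) + sqnorm (zof x).

Definition lipschitz_map (R : realType) (d : nat) (C : R)
    (A : 'rV[R]_d -> 'rV[R]_d) : Prop :=
  forall q1 q2, enorm (A q1 - A q2) <= C * enorm (q1 - q2).

Definition odd_map (R : realType) (d : nat) (B : 'rV[R]_d -> 'rV[R]_d) : Prop :=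
  forall q, B (- q) = - B q.

Definition finite_second_moment (R : realType) (d : nat)
    (rho : probability (phase R d) R) : Prop :=
  (\int[rho]_x (phase_sqnorm x)%:E < +oo)%E.

Definition convol (R : realType) (d : nat) (B : 'rV[R]_d -> 'rV[R]_d)
    (rho : probability (phase R d) R) (q : 'rV[R]_d) : 'rV[R]_d :=
  \row_(c < d) \int[rho]_x (B (q - qof x) 0 c).

Definition has_law (R : realType) (dO dT : measure_display)
    (Omega : measurableType dO) (T : measurableType dT)
    (P : probability Omega R) (X : {RV P >-> T})
    (m : set T -> \bar R) : Prop :=
  forall U, measurable U -> distribution P X U = m U.

(* Mutual independence of a family of sets of events: product rule over every
   finite subfamily. *)
Definition independent (R : realType) (dO : measure_display)
    (Omega : measurableType dO) (P : probability Omega R)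
    (I : eqType) (F : I -> set (set Omega)) : Prop :=
  forall (s : seq I) (E : I -> set Omega), uniq s ->
    (forall i, i \in s -> F i (E i)) ->
    P (\bigcap_(i in [set` s]) E i) = (\prod_(i <- s) P (E i))%E.

Definition sigma_var (dO dT : measure_display) (Omega : measurableType dO)
    (T : measurableType dT) (X : Omega -> T) : set (set Omega) :=
  preimage_set_system setT X measurable.

Definition sigma_process (R : realType) (dO dT : measure_display)
    (Omega : measurableType dO) (T : measurableType dT) (X : R -> Omega -> T) :
    set (set Omega) :=
  <<s \bigcup_(t in [set t : R | 0 <= t]) sigma_var (X t) >>.

(* Standard Brownian motion on R^d.  The second parameter of [normal_prob] is
   the standard deviation. *)
Definition brownian_motion (R : realType) (d : nat) (dO : measure_display)
    (Omega : measurableType dO) (P : probability Omega R)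
    (W : R -> Omega -> 'rV[R]_d) : Prop :=
  [/\ {ae P, forall w, W 0 w = 0},
      {ae P, forall w,
        {within [set t : R | 0 <= t], continuous (fun t => W t w)}},
      (forall s t : R, 0 <= s -> s < t ->
        independent P (fun c : 'I_d => sigma_var (fun w => (W t w - W s w) 0 c)) /\
        forall (c : 'I_d) (U : set R), measurable U ->
          P ((fun w => (W t w - W s w) 0 c) @^-1` U) =
          normal_prob 0 (Num.sqrt (t - s)) U)
    & (forall tau : nat -> R, 0 <= tau 0%N ->
        (forall k, tau k <= tau k.+1) ->
        independent P
          (fun k : nat => sigma_var (fun w => W (tau k.+1) w - W (tau k) w)))].

Definition time_integrable (R : realType) (d : nat) (t : R)
    (f : R -> 'rV[R]_d) : Prop :=
  forall c : 'I_d,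
    (@lebesgue_measure R).-integrable `[0, t] (fun s => (f s 0 c)%:E).

Definition time_integral (R : realType) (d : nat) (t : R)
    (f : R -> 'rV[R]_d) : 'rV[R]_d :=
  \row_(c < d) \int[@lebesgue_measure R]_(s in `[0, t]) (f s 0 c).

(* Integrated form of
     dQ = P dt,
     dP = - beta Q dt - A(Q) dt - F dt + lambda Z dt,
     dZ = - lambda P dt - alpha Z dt + sqrt 2 dW,
   started from [X0]: the noise is additive, so the stochastic integral of the
   constant [sqrt 2] against [W] is [sqrt 2 *: W t].  [F s w] is the interaction
   force at time [s].  Adaptedness is not imposed: with additive noise the
   equation makes sense pathwise. *)
Definition langevin_solution (R : realType) (d : nat) (alpha beta lambda : R)
    (A : 'rV[R]_d -> 'rV[R]_d) (dO : measure_display)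
    (Omega : measurableType dO) (Pr : probability Omega R)
    (F : R -> Omega -> 'rV[R]_d) (W : R -> Omega -> 'rV[R]_d)
    (X0 : Omega -> phase R d) (X : R -> Omega -> phase R d) : Prop :=
  {ae Pr, forall w,
    let Q t := qof (X t w) in
    let P t := pof (X t w) in
    let Z t := zof (X t w) in
    let drift s :=
      - (beta *: Q s) - A (Q s) - F s w + lambda *: Z s in
    {within [set t : R | 0 <= t], continuous (fun t => X t w)} /\
    forall t : R, 0 <= t ->
      [/\ time_integrable t drift,
          Q t = qof (X0 w) + time_integral t P,
          P t = pof (X0 w) + time_integral t drift
        & Z t = zof (X0 w)
                + time_integral t (fun s => - (lambda *: P s) - alpha *: Z s)
                + Num.sqrt 2 *: W t w]}.

(* [N] interacting particles [X i] and the synchronously coupled nonlinear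
   processes [Xt i], on one probability space, with the same initial data [X0]
   and the same Brownian motions [W]; [mu t] is the common law of the
   [Xt i t]. *)
Record coupled_systems (R : realType) (d : nat) (alpha beta lambda : R)
    (A B : 'rV[R]_d -> 'rV[R]_d) (rho0 : probability (phase R d) R)
    (mu : R -> probability (phase R d) R) (N : nat) := CoupledSystems {
  disp : measure_display;
  space : measurableType disp;
  prob : probability space R;
  X0 : 'I_N -> {RV prob >-> phase R d};
  W : 'I_N -> R -> {RV prob >-> 'rV[R]_d};
  X : 'I_N -> R -> {RV prob >-> phase R d};
  Xt : 'I_N -> R -> {RV prob >-> phase R d};
  X0_law : forall i, has_law (X0 i) rho0;
  W_brownian : forall i, brownian_motion prob (W i);
  X0_W_independent :
    independent prob (fun k : 'I_N + 'I_N =>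
      match k with
      | inl i => sigma_var (X0 i)
      | inr i => sigma_process (W i)
      end);
  X_solution : forall i,
    langevin_solution alpha beta lambda A prob
      (fun s w => N%:R^-1 *: \sum_(j < N) B (qof (X i s w) - qof (X j s w)))
      (W i) (X0 i) (X i);
  Xt_solution : forall i,
    langevin_solution alpha beta lambda A prob
      (fun s w => convol B (mu s) (qof (Xt i s w)))
      (W i) (X0 i) (Xt i);
  Xt_law : forall i (t : R), 0 <= t -> has_law (Xt i t) (mu t)
}.

Section joint_variable.
Context (R : realType) (dO dT : measure_display) (Omega : measurableType dO)
  (T : measurableType dT) (P : probability Omega R) (k : nat).
Variable Y : 'I_k -> {RV P >-> T}.

Definition joint_variable (w : Omega) : k.-tuple T := [tuple Y j w | j < k].

Let measurable_joint_variable : measurable_fun setT joint_variable.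
Proof.
apply/measurable_fun_tnthP => j.
rewrite (_ : _ \o _ = Y j); first exact: measurable_funPT.
by apply/funext => w /=; rewrite tnth_mktuple.
Qed.

HB.instance Definition _ := isMeasurableFun.Build _ _ _ _ joint_variable
  measurable_joint_variable.
End joint_variable.

Definition joint_law (R : realType) (dO dT : measure_display)
    (Omega : measurableType dO) (T : measurableType dT)
    (P : probability Omega R) (k : nat) (Y : 'I_k -> {RV P >-> T}) :
    probability (k.-tuple T) R :=
  distribution P (joint_variable Y).

Section cons_pair.
Context (dT : measure_display) (T : measurableType dT) (k : nat).

Definition cons_pair (x : T * k.-tuple T) : k.+1.-tuple T :=
  [tuple of x.1 :: x.2].

Let measurable_cons_pair : measurable_fun setT cons_pair.
Proof. exact: measurable_cons. Qed.

HB.instance Definition _ := isMeasurableFun.Build _ _ _ _ cons_pair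
  measurable_cons_pair.
End cons_pair.

(* The k-fold product measure; the library only has binary products. *)
Fixpoint power_measure (R : realType) (dT : measure_display)
    (T : measurableType dT) (m : probability T R) (k : nat) :
    probability (k.-tuple T) R :=
  match k with
  | 0%N => dirac [tuple]
  | k'.+1 => distribution (m \x power_measure m k')%E (@cons_pair _ T k')
  end.

(* The conclusion is required uniformly over the [k]-tuples of distinct indices
   below [N], i.e. along every sequence (in [N]) of such tuples. *)
Definition propagation_of_chaos (R : realType) (d : nat)
    (dO : nat -> measure_display) (Omega : forall N, measurableType (dO N))
    (P : forall N, probability (Omega N) R)
    (X : forall N, 'I_N -> R -> {RV (P N) >-> phase R d})
    (mu : R -> probability (phase R d) R) : Prop :=
  forall (t : R) (k : nat), 0 <= t -> (0 < k)%N ->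
  forall f : {ptws 'I_k -> phase R d} -> R,
    continuous f -> (exists M : R, forall x, `|f x| <= M) ->
  forall e : R, 0 < e ->
    \forall N \near \oo, forall i : 'I_k -> 'I_N, injective i ->
      `| \int[joint_law (fun j => X N (i j) t)]_x f (tnth x)
         - \int[power_measure (mu t) k]_x f (tnth x) | < e.

(* The infimum ranges over pairs of random variables on arbitrary probability
   spaces. *)
Definition W2 (R : realType) (d : nat) (m n : probability (phase R d) R) :
    \bar R :=
  (ereal_inf [set r : \bar R |
    exists (dO : measure_display) (Omega : measurableType dO)
           (P : probability Omega R) (X Y : {RV P >-> phase R d}),
      [/\ has_law X m, has_law Y n
        & r = 'E_P[fun w => phase_sqnorm (X w - Y w)%R]]] `^ (2^-1))%E.

(* Main.v *)
(* The synchronous coupling cancels the noise: the gap x_i = X_i - Xt_i follows the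
   linear dissipative flow, perturbed by a force of size at most
   (C_A + C_B)(|x_i| + average |x_j|) plus the fluctuation
   N^-1 sum_j B(Qt_i - Qt_j) - B * mu_t(Qt_i).  For a quadratic Lyapunov function with
   cross terms, small Lipschitz constants are absorbed by the dissipation, while the
   fluctuation has mean square O(1/N): its terms are pairwise orthogonal because the
   Xt_i are independent, and second moments of mu_t are bounded uniformly in time.
   No stochastic calculus is needed.  Every estimate is a one-step inequality along a
   time grid, iterated by a discrete Gronwall lemma and passed to the limit in the
   mesh by Fatou's lemma.  The moment bound compares X with the Gaussian scheme
   driven by the same Brownian increments, so that the noise again cancels.
   Propagation of chaos follows since the law of (Xt_{i_1}, ..., Xt_{i_k}) is the power
   of mu_t, on which a continuous function oscillates little at small scales outside
   a set of small measure. *)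
Require Import Defs.
From HB Require Import structures.
From mathcomp Require Import all_boot all_order all_algebra.
From mathcomp Require Import all_classical all_reals all_analysis.
From mathcomp Require Import measurable_realfun ring lra.

Set Implicit Arguments.
Unset Strict Implicit.
Unset Printing Implicit Defensive.

Import Order.TTheory GRing.Theory Num.Theory.
Import numFieldNormedType.Exports.

Local Open Scope classical_set_scope.
Local Open Scope ring_scope.

(** * A quadratic Lyapunov function for the linear flow *)

(** Three obstacles shape the proof. Symmetry between particles is never invoked: the gap averaged
    over all particles satisfies a closed recursion and is bounded first, after which it acts as a
    known source in the recursion of a single gap. Independence of the nonlinear processes is not
    given, since solutions are not assumed adapted; Euler schemes converge to them along almost
    every path, so each is almost surely a function of its own initial datum and noise. Finally, the
    moments of mu_t are known to be finite at each time, but with no bound in t. Subtracting a fixed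
    sample path gives a first, local bound, because convolution with mu_t is Lipschitz with constant
    [CB] whatever mu_t is; smallness of the constants then makes the bound uniform. *)

Lemma young_ineq (R : realType) (e x y : R) : 0 < e ->
  x * y <= e * x ^+ 2 + y ^+ 2 / (4 * e).
Proof.
move=> e0; rewrite -subr_ge0.
have -> : e * x ^+ 2 + y ^+ 2 / (4 * e) - x * y =
    (2 * e * x - y) ^+ 2 / (4 * e) by field; rewrite gt_eqF.
by rewrite divr_ge0 ?sqr_ge0 // mulr_ge0 // ltW.
Qed.

Lemma eqW (disp : Order.disp_t) (T : porderType disp) (x y : T) : x = y -> (x <= y)%O.
Proof. by move->. Qed.

Lemma sqrD_le (R : realType) (a b : R) : (a + b) ^+ 2 <= 2 * a ^+ 2 + 2 * b ^+ 2.
Proof.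
rewrite -subr_ge0; have -> : 2 * a ^+ 2 + 2 * b ^+ 2 - (a + b) ^+ 2 = (a - b) ^+ 2 by ring.
exact: sqr_ge0.
Qed.

(** Oscillation radii and mesh sizes are chosen through this, so that errors quadratic in them fall
    below a tolerance. *)
Lemma sqr_small (R : realType) (K e : R) : 0 <= K -> 0 < e -> exists2 r : R, 0 < r &
  forall x, 0 <= x -> x <= r -> K * x ^+ 2 <= e.
Proof.
move=> K0 e0; have K1 : 0 < K + 1 by lra.
exists (Num.min 1 (e / (K + 1))); first by rewrite lt_min ltr01 divr_gt0.
move=> x x0; rewrite le_min => /andP[x1 xe].
apply: (@le_trans _ _ ((K + 1) * x)); last by rewrite mulrC -ler_pdivlMr.
apply: (@le_trans _ _ ((K + 1) * x ^+ 2)).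
  by apply: ler_wpM2r; [exact: sqr_ge0|lra].
by apply: ler_wpM2l; [exact: ltW|rewrite expr2 ler_piMl].
Qed.

Lemma mesh_lt (R : realType) (T h : R) (n : nat) : 0 < h ->
  (Num.truncn (T / h) < n)%N -> 0 < n%:R :> R /\ T / n%:R < h.
Proof.
move=> h0 hn; have n0 : 0 < n%:R :> R by rewrite ltr0n (leq_ltn_trans _ hn).
split=> //; rewrite ltr_pdivrMr// mulrC -ltr_pdivrMr//.
by apply: lt_le_trans (truncnS_gt _) _; rewrite ler_nat.
Qed.

(* The cross terms transport the friction, which only acts on [z], to [p] and [q]. *)
Definition lyap (R : realType) (be la b q p z : R) : R :=
  be * q ^+ 2 + p ^+ 2 + z ^+ 2 + 2 * b * p * z + b * la * q * p.

(* Minus half the derivative of [lyap] along the linear flow. *)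
Definition lyap_rate (R : realType) (al be la b q p z : R) : R :=
  (al - b * la) * z ^+ 2 + b * la / 2 * p ^+ 2 + b * la * be / 2 * q ^+ 2
  + b * (be - la ^+ 2 / 2) * q * z + b * al * p * z.

Section lyapunov.
Context (R : realType).
Implicit Types al be la b q p z : R.

(** For small b the cross terms barely perturb the squares of [lyap], while in [lyap_rate] they
    create what friction alone lacks: the term in p z dissipates p and the term in q p dissipates q.
    The remaining products q z and p z are paid by Young's inequality out of part of each square. *)
Lemma lyap_coercive al be la : 0 < al -> 0 < be -> 0 < la ->
  exists b m M c : R, [/\ 0 < b, 0 < m, 0 < M, 0 < c &
    forall q p z,
      [/\ m * (q ^+ 2 + p ^+ 2 + z ^+ 2) <= lyap be la b q p z,
          lyap be la b q p z <= M * (q ^+ 2 + p ^+ 2 + z ^+ 2) &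
          c * (q ^+ 2 + p ^+ 2 + z ^+ 2) <= lyap_rate al be la b q p z]].
Proof.
move=> a0 b0 l0.
pose k := be - la ^+ 2 / 2.
(* Each summand is one smallness demand on b = 1 / D: the first for the term in p z, the second for
   the term in q p, the last for keeping half of the damping [al] of z. *)
pose D := 4 + 2 * la ^+ 2 / be
          + (2 / al) * (la + k ^+ 2 / (la * be) + al ^+ 2 / la).
have h1 : 0 < la ^+ 2 / be by rewrite divr_gt0 // exprn_gt0.
have h2 : 0 <= k ^+ 2 / (la * be) by rewrite divr_ge0 ?sqr_ge0 // mulr_ge0 // ltW.
have h3 : 0 < al ^+ 2 / la by rewrite divr_gt0 // exprn_gt0.
have h4 : 0 <= (2 / al) * (la + k ^+ 2 / (la * be) + al ^+ 2 / la).
  by rewrite mulr_ge0 ?divr_ge0 ?addr_ge0 // ltW.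
have D4 : 4 <= D by rewrite /D; lra.
have D0 : 0 < D by lra.
pose b := D^-1.
have B0 : 0 < b by rewrite invr_gt0.
have bD : b * D = 1 by rewrite mulVf // gt_eqF.
have b4 : b <= 4^-1 by rewrite lef_pV2 // posrE.
have B1 : b * (la ^+ 2 / be) <= 2^-1.
  have : b * D >= b * (2 * (la ^+ 2 / be)) by apply: ler_wpM2l; rewrite /D; lra.
  by rewrite bD; lra.
have B2 : b * (la + k ^+ 2 / (la * be) + al ^+ 2 / la) <= al / 2.
  have : b * D >= b * ((2 / al) * (la + k ^+ 2 / (la * be) + al ^+ 2 / la)).
    by apply: ler_wpM2l; rewrite /D; lra.
  rewrite bD => H.
  have -> : b * (la + k ^+ 2 / (la * be) + al ^+ 2 / la) =
     (al / 2) * (b * ((2 / al) * (la + k ^+ 2 / (la * be) + al ^+ 2 / la))).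
    by field; rewrite !gt_eqF.
  by rewrite -[leRHS]mulr1 ler_wpM2l // divr_ge0 // ltW.
pose m := Num.min (be / 2) (2^-1).
pose M := 2 * be + 3.
pose c := Num.min (b * la * be / 4) (Num.min (b * la / 4) (al / 2)).
have blb : 0 < b * la * be by rewrite !mulr_gt0.
have bl : 0 < b * la by rewrite mulr_gt0.
exists b, m, M, c; split => //.
- by rewrite lt_min; apply/andP; split; lra.
- by rewrite /M; lra.
- by rewrite !lt_min; apply/and3P; split; lra.
move=> q p z; have := sqr_ge0 q; have := sqr_ge0 p; have := sqr_ge0 z.
move=> z0 p0 q0.
have mul2 (x y u : R) : 0 <= x -> y <= u -> y * x <= u * x.
  by move=> *; exact: ler_wpM2r.
have pz : `|2 * b * p * z| <= b * (p ^+ 2 + z ^+ 2).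
  rewrite ler_norml; apply/andP; split; rewrite -subr_ge0.
    have -> : 2 * b * p * z - - (b * (p ^+ 2 + z ^+ 2)) = b * (p + z) ^+ 2 by ring.
    by rewrite mulr_ge0 ?sqr_ge0 // ltW.
  have -> : (b * (p ^+ 2 + z ^+ 2)) - 2 * b * p * z = b * (p - z) ^+ 2 by ring.
  by rewrite mulr_ge0 ?sqr_ge0 // ltW.
have bz : b * (p ^+ 2 + z ^+ 2) <= 4^-1 * (p ^+ 2 + z ^+ 2).
  by apply: mul2 => //; rewrite addr_ge0.
have qp : `|b * la * q * p| <= be / 2 * q ^+ 2 + 4^-1 * p ^+ 2.
  apply: (@le_trans _ _ (be / 2 * q ^+ 2 + (b * la * p) ^+ 2 / (4 * (be / 2)))).
    have e0 : 0 < be / 2 by lra.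
    have := young_ineq (- q) (b * la * p) e0; have := young_ineq q (b * la * p) e0.
    rewrite sqrrN ler_norml => H1 H2; apply/andP; split.
      by rewrite lerNl; apply: le_trans H2; apply: eqW; ring.
    by apply: le_trans H1; apply: eqW; ring.
  rewrite lerD2l.
  have -> : (b * la * p) ^+ 2 / (4 * (be / 2)) =
     (b * (b * (la ^+ 2 / be)) / 2) * p ^+ 2 by field; rewrite gt_eqF.
  apply: mul2 => //.
  have : b * (b * (la ^+ 2 / be)) <= b * 2^-1 by apply: ler_wpM2l => //; exact: ltW.
  by lra.
have [qz pz2] : - (b * (be - la ^+ 2 / 2) * q * z) <=
       b * la * be / 4 * q ^+ 2 + b * (k ^+ 2 / (la * be)) * z ^+ 2 /\
     - (b * al * p * z) <=
       b * la / 4 * p ^+ 2 + b * (al ^+ 2 / la) * z ^+ 2.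
  split.
    have e0 : 0 < b * la * be / 4 by lra.
    have := young_ineq (- q) (b * k * z) e0.
    rewrite sqrrN /k => H; apply: (le_trans _ (le_trans H _)).
      by apply: eqW; ring.
    apply: eqW; field.
    by rewrite !gt_eqF.
  have e0 : 0 < b * la / 4 by lra.
  have := young_ineq (- p) (b * al * z) e0.
  rewrite sqrrN => H; apply: (le_trans _ (le_trans H _)).
    by apply: eqW; ring.
  apply: eqW; field.
  by rewrite !gt_eqF.
move: pz qp; rewrite !ler_norml => /andP[pz1 pz2'] /andP[qp1 qp2].
have m1 : m <= be / 2 by rewrite ge_min lexx.
have m2 : m <= 2^-1 by rewrite ge_min lexx orbT.
split.
- have := mul2 _ _ _ q0 m1; have := mul2 _ _ _ p0 m2; have := mul2 _ _ _ z0 m2.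
  by rewrite /lyap; lra.
- have : 0 <= be * p ^+ 2 by rewrite mulr_ge0 // ltW.
  have : 0 <= be * q ^+ 2 by rewrite mulr_ge0 // ltW.
  have : 0 <= be * z ^+ 2 by rewrite mulr_ge0 // ltW.
  by rewrite /lyap /M; lra.
have c1 : c <= b * la * be / 4 by rewrite ge_min lexx.
have c2 : c <= b * la / 4 by rewrite !ge_min lexx orbT.
have c3 : c <= al / 2 by rewrite !ge_min lexx !orbT.
have := mul2 _ _ _ q0 c1; have := mul2 _ _ _ p0 c2; have := mul2 _ _ _ z0 c3.
have := mul2 _ _ _ z0 B2.
rewrite /lyap_rate; lra.
Qed.

(** A quadratic form expands exactly along a perturbed Euler step: h times the derivative and the
    error terms, plus h^2 times the form at the slope. Of the dissipation 2 c u, with u the squared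
    norm, the error takes c u and the second-order term c u / 2; the remaining c u / 2 gives the
    rate c / (2 M). *)
Lemma lyapunov_step al be la : 0 < al -> 0 < be -> 0 < la ->
  exists b m M k C h0 : R,
    [/\ [/\ 0 < m, 0 < M & 0 < k], 0 <= C, 0 < h0, k * h0 <= 1 &
    (forall q p z, m * (q ^+ 2 + p ^+ 2 + z ^+ 2) <= lyap be la b q p z
       /\ lyap be la b q p z <= M * (q ^+ 2 + p ^+ 2 + z ^+ 2)) /\
    forall h rho q p z q' p' z', 0 < h -> h <= h0 -> 0 <= rho ->
      `|q' - q - h * p| <= h * rho ->
      `|p' - p - h * (- (be * q) + la * z)| <= h * rho ->
      `|z' - z - h * (- (la * p) - al * z)| <= h * rho ->
      lyap be la b q' p' z' <=
        (1 - k * h) * lyap be la b q p z + C * h * rho ^+ 2].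
Proof.
move=> a0 b0 l0; have [b [m [M [c [B0 m0 M0 c0 H]]]]] := lyap_coercive a0 b0 l0.
(* [3 * K] dominates the sum of the coefficients of the error terms; [2 * l * u] bounds the
   contribution of the linear field to the squared slope. *)
pose K := 2 * be + 2 + b * la + 2 * b.
pose l := 2 * (1 + be ^+ 2 + 2 * la ^+ 2 + al ^+ 2).
have bl0 : 0 < b * la by rewrite mulr_gt0.
have K0 : 0 < K by rewrite /K; lra.
have l1 : 0 < l.
  by have := sqr_ge0 be; have := sqr_ge0 la; have := sqr_ge0 al; rewrite /l; lra.
have Ml : 0 < M * l by exact: mulr_gt0.
(* M / c ensures [k * h0 <= 1], and c / (4 M l) keeps the second-order term below c u / 2. *)
pose h0 := Num.min 1 (Num.min (M / c) (c / (4 * M * l))).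
have h00 : 0 < h0.
  have ml0 : 0 < 4 * M * l by apply: mulr_gt0 => //; apply: mulr_gt0 => //; lra.
  by rewrite !lt_min ltr01 /= (divr_gt0 M0 c0) (divr_gt0 c0 ml0).
pose C := 3 * (K ^+ 2 / c) * 3 + 6 * M.
have C0 : 0 <= C.
  have : 0 <= K ^+ 2 / c by rewrite divr_ge0 ?sqr_ge0 // ltW.
  by rewrite /C; lra.
have M20 : 0 < 2 * M by lra.
exists b, m, M, (c / (2 * M)), C, h0; split => //.
- by split=> //; rewrite divr_gt0.
- apply: (@le_trans _ _ (c / (2 * M) * (M / c))).
    apply: ler_wpM2l; first by rewrite divr_ge0 // ltW.
    by rewrite !ge_min lexx !orbT.
  have -> : c / (2 * M) * (M / c) = 2^-1 by field; rewrite !gt_eqF.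
  by lra.
split=> [q p z|]; first by have [] := H q p z.
move=> h rho q p z q' p' z' h_gt0 hh0 rho0 Hq Hp Hz.
have h_neq0 : h != 0 by rewrite gt_eqF.
pose rq := (q' - q) / h - p.
pose rp := (p' - p) / h - (- (be * q) + la * z).
pose rz := (z' - z) / h - (- (la * p) - al * z).
have [Eq Ep Ez] : [/\ q' = q + h * (p + rq), p' = p + h * (- (be * q) + la * z + rp)
   & z' = z + h * (- (la * p) - al * z + rz)].
  by split; rewrite /rq /rp /rz; field.
have bnd y : `|h * y| <= h * rho -> y ^+ 2 <= rho ^+ 2.
  rewrite normrM gtr0_norm // ler_pM2l // => yr.
  by rewrite -(real_normK (num_real y)) ler_sqr ?nnegrE.
have q2 : rq ^+ 2 <= rho ^+ 2.
  by apply: bnd; move: Hq; rewrite Eq; congr (`|_| <= _); ring.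
have p2 : rp ^+ 2 <= rho ^+ 2.
  by apply: bnd; move: Hp; rewrite Ep; congr (`|_| <= _); ring.
have z2 : rz ^+ 2 <= rho ^+ 2.
  by apply: bnd; move: Hz; rewrite Ez; congr (`|_| <= _); ring.
have [_ v1 v2] := H q p z.
pose u := q ^+ 2 + p ^+ 2 + z ^+ 2; rewrite -/u in v1 v2.
have u0 : 0 <= u by rewrite !addr_ge0 ?sqr_ge0.
pose gq := p + rq; pose gp := - (be * q) + la * z + rp.
pose gz := - (la * p) - al * z + rz.
pose D := 2 * be * q * rq + 2 * p * rp + 2 * z * rz + 2 * b * (p * rz + z * rp)
          + b * la * (q * rp + p * rq).
have E : lyap be la b q' p' z' = lyap be la b q p z
    + h * (- 2 * lyap_rate al be la b q p z + D) + h ^+ 2 * lyap be la b gq gp gz.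
  rewrite Eq Ep Ez /lyap /lyap_rate /D /gq /gp /gz.
  by field.
(* With the Young weight c / (3 K), all error terms together cost at most c u plus a multiple of
   rho^2. *)
have yng x y : x ^+ 2 <= u -> y ^+ 2 <= rho ^+ 2 ->
    `|x * y| <= c / (3 * K) * u + 3 * K / (4 * c) * rho ^+ 2.
  move=> xu yr; have e0 : 0 < c / (3 * K) by apply: divr_gt0 => //; lra.
  have F x1 : x1 ^+ 2 <= u -> x1 * y <= c / (3 * K) * u + 3 * K / (4 * c) * rho ^+ 2.
    move=> xu1; apply: le_trans (young_ineq x1 y e0) _; apply: lerD.
      by apply: ler_wpM2l => //; exact: ltW.
    rewrite mulrC.
    have -> : (4 * (c / (3 * K)))^-1 = 3 * K / (4 * c) by field; rewrite !gt_eqF.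
    by apply: ler_wpM2l => //; rewrite divr_ge0 // mulr_ge0 // ltW.
  rewrite ler_norml; apply/andP; split; last exact: F.
  by rewrite lerNl -mulNr; apply: F; rewrite sqrrN.
have qu : q ^+ 2 <= u by rewrite /u; have := sqr_ge0 p; have := sqr_ge0 z; lra.
have pu : p ^+ 2 <= u by rewrite /u; have := sqr_ge0 q; have := sqr_ge0 z; lra.
have zu : z ^+ 2 <= u by rewrite /u; have := sqr_ge0 p; have := sqr_ge0 q; lra.
set Y := c / (3 * K) * u + 3 * K / (4 * c) * rho ^+ 2 in yng.
have Y0 : 0 <= Y by apply: le_trans (yng _ _ qu q2); rewrite normr_ge0.
have DY : D <= 3 * K * Y.
  have [k1 k2 k3 k4] : [/\ 0 <= 2 * be, (0:R) <= 2, 0 <= 2 * b & 0 <= b * la].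
    by split; clear -b0 B0 bl0; lra.
  have T k x y : 0 <= k -> x ^+ 2 <= u -> y ^+ 2 <= rho ^+ 2 -> k * (x * y) <= k * Y.
    move=> k0 xu yr; apply: ler_wpM2l => //.
    by apply: le_trans (yng _ _ xu yr); exact: ler_norm.
  have t1 := T _ _ _ k1 qu q2; have t2 := T _ _ _ k2 pu p2.
  have t3 := T _ _ _ k2 zu z2; have t4 := T _ _ _ k3 pu z2.
  have t5 := T _ _ _ k3 zu p2; have t6 := T _ _ _ k4 qu p2.
  have t7 := T _ _ _ k4 pu q2.
  apply: (@le_trans _ _ ((2 * be + 4 + 4 * b + 2 * (b * la)) * Y)).
    have -> : D = 2 * be * (q * rq) + 2 * (p * rp) + 2 * (z * rz) + 2 * b * (p * rz)
       + 2 * b * (z * rp) + b * la * (q * rp) + b * la * (p * rq) by rewrite /D; ring.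
    have -> : (2 * be + 4 + 4 * b + 2 * (b * la)) * Y = 2 * be * Y + 2 * Y + 2 * Y
       + 2 * b * Y + 2 * b * Y + b * la * Y + b * la * Y by ring.
    by do !apply: lerD.
  by apply: ler_wpM2r => //; clear -bl0 b0 B0; rewrite /K; lra.
have Yv : 3 * K * Y = c * u + 3 * (K ^+ 2 / c) * 3 / 4 * rho ^+ 2.
  by rewrite /Y; field; rewrite !gt_eqF.
have G : lyap be la b gq gp gz <= M * (2 * l * u + 6 * rho ^+ 2).
  have [_ + _] := H gq gp gz; move/le_trans; apply.
  apply: ler_wpM2l; first exact: ltW.
  have s1 := sqrD_le p rq; have s2 := sqrD_le (- (be * q) + la * z) rp.
  have s3 := sqrD_le (- (la * p) - al * z) rz.
  have s4 := sqrD_le (- (be * q)) (la * z); have s5 := sqrD_le (- (la * p)) (- (al * z)).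
  have T k x : x ^+ 2 <= u -> (k * x) ^+ 2 <= k ^+ 2 * u.
    by move=> xu; rewrite exprMn; apply: ler_wpM2l => //; exact: sqr_ge0.
  have w1 := T be _ qu; have w2 := T la _ zu; have w3 := T la _ pu; have w4 := T al _ zu.
  move: s4 s5; rewrite !sqrrN => s4 s5.
  have -> : 2 * l * u = 4 * u + 4 * (be ^+ 2 * u) + 8 * (la ^+ 2 * u) + 4 * (al ^+ 2 * u).
    by rewrite /l; ring.
  have := mulr_ge0 (sqr_ge0 be) u0; have := mulr_ge0 (sqr_ge0 al) u0.
  move: s1 s2 s3 s4 s5 w1 w2 w3 w4 q2 p2 z2 pu u0; rewrite -/gq -/gp -/gz.
  clear; move=> *; lra.
have hc : h * (2 * M * l) <= c / 2.
  apply: (@le_trans _ _ (c / (4 * M * l) * (2 * M * l))).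
    apply: ler_wpM2r; first by rewrite -mulrA mulr_ge0 ?ler0n // ltW.
    by apply: le_trans hh0 _; rewrite !ge_min lexx !orbT.
  by apply: eqW; field; rewrite !gt_eqF.
have h1 : h <= 1 by apply: le_trans hh0 _; rewrite !ge_min lexx.
have hG : h * lyap be la b gq gp gz <= c / 2 * u + 6 * M * rho ^+ 2.
  apply: (@le_trans _ _ (h * (M * (2 * l * u + 6 * rho ^+ 2)))).
    by apply: ler_wpM2l => //; exact: ltW.
  have H1 := ler_wpM2r u0 hc.
  have H2 : h * (6 * M * rho ^+ 2) <= 1 * (6 * M * rho ^+ 2).
    by apply: ler_wpM2r => //; rewrite !mulr_ge0 ?ler0n ?sqr_ge0 // ltW.
  have -> : h * (M * (2 * l * u + 6 * rho ^+ 2)) =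
    h * (2 * M * l) * u + h * (6 * M * rho ^+ 2) by ring.
  by apply: (le_trans (lerD H1 H2)); rewrite mul1r.
have cv : c / (2 * M) * lyap be la b q p z <= c / 2 * u.
  apply: (@le_trans _ _ (c / (2 * M) * (M * u))).
    by apply: ler_wpM2l => //; rewrite divr_ge0 // ltW.
  by apply: eqW; field; rewrite !gt_eqF.
rewrite E -subr_ge0.
have -> : (1 - c / (2 * M) * h) * lyap be la b q p z + C * h * rho ^+ 2 -
  (lyap be la b q p z + h * (- 2 * lyap_rate al be la b q p z + D) +
   h ^+ 2 * lyap be la b gq gp gz) =
  h * (- (c / (2 * M) * lyap be la b q p z) + C * rho ^+ 2
      + 2 * lyap_rate al be la b q p z - D - h * lyap be la b gq gp gz) by ring.
apply: mulr_ge0; first exact: ltW.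
have : 0 <= 3 * (K ^+ 2 / c) * 3 * rho ^+ 2.
  by rewrite !mulr_ge0 ?ler0n ?invr_ge0 ?sqr_ge0 // ltW.
rewrite Yv in DY.
rewrite (_ : C * rho ^+ 2 = 3 * (K ^+ 2 / c) * 3 * rho ^+ 2 + 6 * M * rho ^+ 2); last by rewrite /C; ring.
rewrite (_ : 3 * (K ^+ 2 / c) * 3 / 4 * rho ^+ 2 = 3 * (K ^+ 2 / c) * 3 * rho ^+ 2 / 4) in DY; last by ring.
move: cv hG DY v2.
move: (3 * (K ^+ 2 / c) * 3 * rho ^+ 2) (6 * M * rho ^+ 2) (lyap_rate _ _ _ _ _ _ _) (h * lyap _ _ _ _ _ _).
move: (c / (2 * M) * _) (D) => D1 D2 X1 X2 X3 X4.
have -> : c / 2 * u = c * u / 2 by ring.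
move: (c * u) => X5; clear; move=> *; lra.
Qed.

End lyapunov.

(** * Pathwise dynamics *)

(** Compactness of [[0, T]] in its near-covering form, the radius being the parameter that tends to
    0. Continuity is taken within the half-line because nothing is known of the paths at negative
    times. *)
Lemma heine (R : realType) (U : pseudoMetricType R) (x : R -> U) (T e : R) :
  {within [set t : R | 0 <= t], continuous x} -> 0 < e ->
  exists2 r : R, 0 < r & forall s t, 0 <= s <= T -> 0 <= t <= T ->
    `|s - t| < r -> ball (x s) e (x t).
Proof.
move=> /subspace_continuousP cx e0.
have : \forall r \near (0:R)^'+, `[0, T] `<=` (fun s => forall t,
    0 <= s -> 0 <= t <= T -> `|s - t| < r -> ball (x s) e (x t)).
  have /compact_near_coveringP := @segment_compact R 0 T.
  apply => s /=; rewrite in_itv/= => /andP[s0 sT].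
  have := cx s s0 _ (nbhsx_ballx (x s) _ (divr_gt0 e0 (ltr0n _ 2))).
  move=> /nbhs_ballP[r /= r0 rs].
  exists (ball s (r / 2), [set u : R | u < r / 2]) => /=.
    split; first exact: nbhsx_ballx (divr_gt0 _ (ltr0n _ 2)).
    by apply: nbhs_right_lt; exact: divr_gt0.
  move=> [s' u] /= [ss' ur] t s'0 /andP[t0 tT] s't.
  apply: (@ball_splitr _ _ (x s)).
    apply: rs => //; apply: le_ball ss'; lra.
  apply: rs => //; rewrite /ball/= in ss' *.
  rewrite (_ : s - t = (s - s') + (s' - t)); last by ring.
  apply: le_lt_trans (ler_normD _ _) _; lra.
move=> H0; have [r [H r0]] := filter_ex (filterI H0 (nbhs_right_gt 0)).
by exists r => // s t /andP[s0 sT] t0T; apply: H => //=; rewrite in_itv/= s0.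
Qed.

Section phase_algebra.
Context (R : realType) (d : nat).
Implicit Types (x y : phase R d) (v : 'rV[R]_d).

Lemma qofD x y : qof (x + y) = qof x + qof y. Proof. by []. Qed.
Lemma pofD x y : pof (x + y) = pof x + pof y. Proof. by []. Qed.
Lemma zofD x y : zof (x + y) = zof x + zof y. Proof. by []. Qed.
Lemma qofN x : qof (- x) = - qof x. Proof. by []. Qed.
Lemma pofN x : pof (- x) = - pof x. Proof. by []. Qed.
Lemma zofN x : zof (- x) = - zof x. Proof. by []. Qed.

Definition phaseDE := (qofD, pofD, zofD, qofN, pofN, zofN).

Lemma phase_ball_coord x y (e : R) : ball x e y -> forall c : 'I_d,
  [/\ `|qof x 0 c - qof y 0 c| < e, `|pof x 0 c - pof y 0 c| < e
    & `|zof x 0 c - zof y 0 c| < e].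
Proof.
move=> [[[_ /= qb] [_ /= pb]] [_ /= zb]] c.
by split; [exact: qb | exact: pb | exact: zb].
Qed.

Lemma continuous_qof : continuous (@qof R d).
Proof. by move=> x; apply: continuous_comp; [exact: cvg_fst|exact: cvg_fst]. Qed.

Lemma continuous_pof : continuous (@pof R d).
Proof. by move=> x; apply: continuous_comp; [exact: cvg_fst|exact: cvg_snd]. Qed.

Lemma continuous_zof : continuous (@zof R d).
Proof. by move=> x; exact: cvg_snd. Qed.

End phase_algebra.

Section paths.
Context (R : realType) (d : nat) (al be la : R).
Implicit Types (x y : phase R d).
Local Notation mu := (@lebesgue_measure R).

(** An explicit Euler step with force [F] and noise increment [n], up to an error [h * rho] in every
    coordinate. Increments of true paths and of schemes both fit, which makes them comparable. *)
Definition step (h rho : R) (F : 'rV[R]_d) x y (n : 'rV[R]_d) : Prop := forall c : 'I_d,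
  [/\ `|qof y 0 c - qof x 0 c - h * pof x 0 c| <= h * rho,
      `|pof y 0 c - pof x 0 c
        - h * (- (be * qof x 0 c) + F 0 c + la * zof x 0 c)| <= h * rho
    & `|zof y 0 c - zof x 0 c - h * (- (la * pof x 0 c) - al * zof x 0 c)
         - Num.sqrt 2 * n 0 c| <= h * rho].

(** The linear drift is common to both steps, so they can be subtracted; with equal increments the
    noise disappears. This is how the synchronous coupling acts on the grid. *)
Lemma stepB h r r' F F' x x' y y' n n' : step h r F x y n ->
  step h r' F' x' y' n' ->
  step h (r + r') (F - F') (x - x') (y - y') (n - n').
Proof.
move=> s s' c; have [sq sp sz] := s c; have [sq' sp' sz'] := s' c.
have nB (u v : R) : `|u| <= h * r -> `|v| <= h * r' -> `|u - v| <= h * (r + r').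
  by move=> *; rewrite mulrDr; apply: le_trans (ler_normB _ _) _; exact: lerD.
rewrite !phaseDE !mxE; split.
- by have := nB _ _ sq sq'; congr (`|_| <= _); ring.
- by have := nB _ _ sp sp'; congr (`|_| <= _); ring.
- by have := nB _ _ sz sz'; congr (`|_| <= _); ring.
Qed.

(** Pathwise increment form with arbitrary force f and noise path w. Keeping both abstract makes the
    class stable under differences, so the gap between two solutions is again such a path. *)
Definition langevin_path (x : R -> phase R d) (f w : R -> 'rV[R]_d) : Prop :=
  {within [set t : R | 0 <= t], continuous x} /\
  forall (c : 'I_d) (a b : R), 0 <= a -> a <= b ->
  let q t := qof (x t) 0 c in
  let p t := pof (x t) 0 c in
  let z t := zof (x t) 0 c in
  [/\ mu.-integrable `[a, b] (fun s => (- (be * q s) + f s 0 c + la * z s)%:E),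
      q b - q a = \int[mu]_(s in `[a, b]) p s,
      p b - p a = \int[mu]_(s in `[a, b]) (- (be * q s) + f s 0 c + la * z s)
    & z b - z a = \int[mu]_(s in `[a, b]) (- (la * p s) - al * z s)
        + Num.sqrt 2 * (w b 0 c - w a 0 c)].

Lemma within_continuous_coord (x : R -> phase R d) (A : set R) (c : 'I_d) :
  {within A, continuous x} ->
  [/\ {within A, continuous (fun t => qof (x t) 0 c)},
      {within A, continuous (fun t => pof (x t) 0 c)}
    & {within A, continuous (fun t => zof (x t) 0 c)}].
Proof.
have C (g : phase R d -> 'rV[R]_d) : continuous g -> {within A, continuous x} ->
    {within A, continuous (fun t => g (x t) 0 c)}.
  move=> cg cx; apply: (@within_continuous_comp _ _ _ A x (fun y => g y 0 c)) => //.
  move=> y _; apply: (@continuous_comp _ _ _ g (fun v : 'rV[R]_d => v 0 c)) => //.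
    exact: cg.
  exact: coord_continuous.
move=> cx; split; apply: C => //.
- exact: continuous_qof.
- exact: continuous_pof.
- exact: continuous_zof.
Qed.

Lemma within_continuous_integrable (g : R -> R) (a b : R) : 0 <= a ->
  {within [set t : R | 0 <= t], continuous g} ->
  mu.-integrable `[a, b] (EFin \o g).
Proof.
move=> a0 cg; apply: continuous_compact_integrable; first exact: segment_compact.
apply: continuous_subspaceW cg => s /=; rewrite in_itv/= => /andP[+ _].
exact: le_trans.
Qed.

Lemma Rintegral_segmentB (g : R -> R) (a b : R) : 0 <= a -> a <= b ->
  mu.-integrable `[0, b] (EFin \o g) ->
  \int[mu]_(s in `[0, b]) g s - \int[mu]_(s in `[0, a]) g s =
  \int[mu]_(s in `[a, b]) g s.
Proof.
move=> a0 ab ig; rewrite Rintegral_itvB ?bnd_simp//.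
rewrite Rintegral_itv_obnd_cbnd//; apply: integrableS ig => //.
by move=> s /=; rewrite !in_itv/= => /andP[s1 ->]; rewrite (le_trans a0)// ltW.
Qed.

Lemma Rintegral_near_cst (g : R -> R) (a h g0 e : R) : 0 <= h ->
  mu.-integrable `[a, a + h] (EFin \o g) ->
  (forall s, a <= s <= a + h -> `|g s - g0| <= e) ->
  `|\int[mu]_(s in `[a, a + h]) g s - h * g0| <= h * e.
Proof.
move=> h0 ig ge.
have len : fine (mu `[a, a + h]) = h.
  by rewrite lebesgue_measure_itv/= lte_fin; case: ltP => //= ?; lra.
have icst (k : R) : mu.-integrable `[a, a + h] (EFin \o cst k).
  apply: continuous_compact_integrable; first exact: segment_compact.
  by apply: continuous_subspaceT => ?; exact: cvg_cst.
have -> : h * g0 = \int[mu]_(s in `[a, a + h]) cst g0 s.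
  by rewrite Rintegral_cst// len mulrC.
rewrite -RintegralB//.
have iB : mu.-integrable `[a, a + h] (EFin \o (fun s => g s - cst g0 s)).
  by apply/(integrableB _ ig (icst g0)).
apply: (le_trans (le_normr_Rintegral _ iB)) => //.
have -> : h * e = \int[mu]_(s in `[a, a + h]) cst e s.
  by rewrite Rintegral_cst// len mulrC.
by apply: le_Rintegral => //; exact: integrable_norm.
Qed.

Hypotheses (be0 : 0 <= be) (la0 : 0 <= la) (al0 : 0 <= al).

(** Over one step every integrand stays close to its value at the left end. The 1 in the factor
    accounts for the position equation, whose integrand is p itself. *)
Lemma langevin_path_step (x : R -> phase R d) f w (F : 'rV[R]_d) (a h e phi : R) : langevin_path x f w ->
  0 <= a -> 0 <= h -> 0 <= e -> 0 <= phi ->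
  (forall s, a <= s <= a + h -> ball (x a) e (x s)) ->
  (forall s c, a <= s <= a + h -> `|f s 0 c - F 0 c| <= phi) ->
  step h ((1 + al + be + la) * e + phi) F (x a) (x (a + h)) (w (a + h) - w a).
Proof.
move=> [cx X] a0 h0 e0 phi0 xe fphi c.
have aah : a <= a + h by lra.
have [ig qE pE zE] := X c a (a + h) a0 aah.
have [cq cp cz] := within_continuous_coord c cx.
have E s : a <= s <= a + h -> [/\ `|qof (x s) 0 c - qof (x a) 0 c| <= e,
    `|pof (x s) 0 c - pof (x a) 0 c| <= e
    & `|zof (x s) 0 c - zof (x a) 0 c| <= e].
  move=> /xe /phase_ball_coord /(_ c)[Hq Hp Hz].
  by split; rewrite distrC ltW.
have [ale bee lae] : [/\ 0 <= al * e, 0 <= be * e & 0 <= la * e].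
  by split; rewrite mulr_ge0.
split.
- rewrite qE; apply: Rintegral_near_cst => //.
    exact: within_continuous_integrable.
  by move=> s /E[_ ? _]; lra.
- rewrite pE; apply: Rintegral_near_cst => //.
  move=> s sa; have [Hq _ Hz] := E s sa; have Hf := fphi s c sa.
  rewrite (_ : _ - _ = - (be * (qof (x s) 0 c - qof (x a) 0 c)) + (f s 0 c - F 0 c)
    + la * (zof (x s) 0 c - zof (x a) 0 c)); last by ring.
  apply: le_trans (ler_normD _ _) _; apply: le_trans (lerD (ler_normD _ _) (lexx _)) _.
  rewrite normrN !normrM (ger0_norm be0) (ger0_norm la0).
  by have := ler_wpM2l be0 Hq; have := ler_wpM2l la0 Hz; lra.
- rewrite zE !mxE.
  rewrite [X in `|X|](_ : _ = \int[mu]_(s in `[a, a + h])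
     (- (la * pof (x s) 0 c) - al * zof (x s) 0 c)
     - h * (- (la * pof (x a) 0 c) - al * zof (x a) 0 c)); last by ring.
  apply: Rintegral_near_cst => //.
    apply: within_continuous_integrable => // t.
    apply: cvgB; last by apply: cvgMr; exact: cz.
    by apply: cvgN; apply: cvgMr; exact: cp.
  move=> s sa; have [_ Hp Hz] := E s sa.
  rewrite [X in `|X|](_ : _ = - (la * (pof (x s) 0 c - pof (x a) 0 c)) +
    - (al * (zof (x s) 0 c - zof (x a) 0 c))); last by ring.
  apply: le_trans (ler_normD _ _) _.
  rewrite !normrN !normrM (ger0_norm al0) (ger0_norm la0).
  by have := ler_wpM2l la0 Hp; have := ler_wpM2l al0 Hz; lra.
Qed.

Lemma langevin_pathB (x x' : R -> phase R d) f f' w w' : langevin_path x f w ->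
  langevin_path x' f' w' ->
  langevin_path (fun t => x t - x' t) (fun t => f t - f' t) (fun t => w t - w' t).
Proof.
move=> [cx X] [cx' X']; split.
  by move=> t; apply: cvgB; [exact: cx|exact: cx'].
move=> c a b a0 ab.
have [ig qE pE zE] := X c a b a0 ab; have [ig' qE' pE' zE'] := X' c a b a0 ab.
have [cq cp cz] := within_continuous_coord c cx.
have [cq' cp' cz'] := within_continuous_coord c cx'.
have ci g := @within_continuous_integrable g a b a0.
have E : (fun s => - (be * qof (x s - x' s) 0 c) + (f s - f' s) 0 c
     + la * zof (x s - x' s) 0 c) =
   (fun s => (- (be * qof (x s) 0 c) + f s 0 c + la * zof (x s) 0 c)
   - (- (be * qof (x' s) 0 c) + f' s 0 c + la * zof (x' s) 0 c)).
  by apply/funext => s; rewrite !phaseDE !mxE; ring.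
split.
- rewrite (_ : (fun s => _%:E) = EFin \o (fun s => - (be * qof (x s - x' s) 0 c) + (f s - f' s) 0 c
     + la * zof (x s - x' s) 0 c))// E.
  exact/(integrableB _ ig ig').
- transitivity ((qof (x b) 0 c - qof (x a) 0 c) - (qof (x' b) 0 c - qof (x' a) 0 c)).
    by rewrite !phaseDE !mxE; ring.
  rewrite qE qE' -RintegralB//; [|exact: ci|exact: ci].
  by apply: eq_Rintegral => s _; rewrite !phaseDE !mxE.
- transitivity ((pof (x b) 0 c - pof (x a) 0 c) - (pof (x' b) 0 c - pof (x' a) 0 c)).
    by rewrite !phaseDE !mxE; ring.
  by rewrite pE pE' -RintegralB// E.
- transitivity ((zof (x b) 0 c - zof (x a) 0 c) - (zof (x' b) 0 c - zof (x' a) 0 c)).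
    by rewrite !phaseDE !mxE; ring.
  have zc (y : R -> phase R d) : {within [set t : R | 0 <= t], continuous y} ->
     mu.-integrable `[a, b] (EFin \o (fun s => - (la * pof (y s) 0 c) - al * zof (y s) 0 c)).
    move=> cy; apply: ci => t; have [_ cyp cyz] := within_continuous_coord c cy.
    apply: cvgB; last by apply: cvgMr; exact: cyz.
    by apply: cvgN; apply: cvgMr; exact: cyp.
  have -> : \int[mu]_(s in `[a, b])
      (- (la * pof (x s - x' s) 0 c) - al * zof (x s - x' s) 0 c) =
    \int[mu]_(s in `[a, b]) ((- (la * pof (x s) 0 c) - al * zof (x s) 0 c) -
      (- (la * pof (x' s) 0 c) - al * zof (x' s) 0 c)).
    by apply: eq_Rintegral => s _; rewrite !phaseDE !mxE; ring.
  by rewrite zE zE' [in RHS]RintegralB//; [rewrite !mxE; ring|exact: zc|exact: zc].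
Qed.

Lemma langevin_solution_path (A : 'rV[R]_d -> 'rV[R]_d) (dO : measure_display)
    (Omega : measurableType dO) (Pr : probability Omega R)
    (F W : R -> Omega -> 'rV[R]_d) (X0 : Omega -> phase R d)
    (X : R -> Omega -> phase R d) :
  {ae Pr, forall w, W 0 w = 0} ->
  langevin_solution al be la A Pr F W X0 X ->
  {ae Pr, forall w, [/\ X 0 w = X0 w, W 0 w = 0 & langevin_path (fun t => X t w)
     (fun s => - A (qof (X s w)) - F s w) (fun t => W t w)]}.
Proof.
move=> W0 sol; apply: filterS2 W0 sol => w W0 [cX sol].
have I0 (g : R -> 'rV[R]_d) : time_integral 0 g = 0.
  by apply/rowP => c; rewrite !mxE set_itv1 Rintegral_set1.
split => //.
  have [_ q0 p0 z0] := sol 0 (lexx _).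
  rewrite (surjective_pairing (X 0 w)) (surjective_pairing (X 0 w).1).
  rewrite (surjective_pairing (X0 w)) (surjective_pairing (X0 w).1).
  move: q0 p0 z0; rewrite !I0 !addr0 W0 scaler0 addr0 /qof /pof /zof.
  by move=> -> -> ->.
split => // c a b a0 ab.
have b0 : 0 <= b := le_trans a0 ab.
have [_ qa pa za] := sol a a0; have [ig qb pb zb] := sol b b0.
have [cq cp cz] := within_continuous_coord c cX.
have ci g := @within_continuous_integrable g 0 b (lexx _).
have sub : `[a, b] `<=` `[0, b].
  by move=> s /=; rewrite !in_itv/= => /andP[s1 ->]; rewrite (le_trans a0).
have E : (fun s => - (be * qof (X s w) 0 c) + (- A (qof (X s w)) - F s w) 0 c
     + la * zof (X s w) 0 c) =
  (fun s => (- (be *: qof (X s w)) - A (qof (X s w)) - F s w + la *: zof (X s w)) 0 c).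
  by apply/funext => s; rewrite !mxE; ring.
split.
- rewrite (_ : (fun s => _%:E) = EFin \o (fun s => - (be * qof (X s w) 0 c)
     + (- A (qof (X s w)) - F s w) 0 c + la * zof (X s w) 0 c))// E.
  by apply: integrableS (ig c).
- rewrite qa qb !mxE -(Rintegral_segmentB a0 ab)//; last exact: ci.
  by ring.
- rewrite pa pb !mxE E -(Rintegral_segmentB a0 ab)//; last exact: ig.
  by ring.
- have tz t : time_integral t (fun s => - (la *: pof (X s w)) - al *: zof (X s w)) 0 c =
      \int[mu]_(s in `[0, t]) (- (la * pof (X s w) 0 c) - al * zof (X s w) 0 c).
    by rewrite mxE; apply: eq_Rintegral => s _; rewrite !mxE.
  have addE (u v r : 'rV[R]_d) : (u + v + r) 0 c = u 0 c + v 0 c + r 0 c by rewrite !mxE.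
  rewrite za zb !addE !tz -(Rintegral_segmentB a0 ab)//; first by rewrite !mxE; ring.
  apply: ci => t; apply: cvgB; last by apply: cvgMr; exact: cz.
  by apply: cvgN; apply: cvgMr; exact: cp.
Qed.

End paths.

(** * Upper bounds on means and a discrete Gronwall lemma *)

Section mean_le.
Context (dO : measure_display) (T : measurableType dO) (R : realType)
  (P : probability T R).
Implicit Types (f g : T -> R) (K L : R).

(* Expectations of nonnegative functions are only ever bounded from above. *)
Definition mean_le f K : Prop :=
  [/\ measurable_fun setT f, forall w, 0 <= f w
    & (\int[P]_w (f w)%:E <= K%:E)%E].

Lemma mean_le_ge0 f K : mean_le f K -> 0 <= K.
Proof.
by move=> [_ f0 fK]; rewrite -lee_fin; apply: le_trans fK; apply: integral_ge0 => w _; rewrite lee_fin.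
Qed.

Lemma mean_leW f K L : K <= L -> mean_le f K -> mean_le f L.
Proof. by move=> KL [? ? fK]; split => //; apply: le_trans fK _; rewrite lee_fin. Qed.

Lemma mean_le_dom f g K : mean_le g K -> measurable_fun setT f ->
  (forall w, 0 <= f w) -> {ae P, forall w, f w <= g w} -> mean_le f K.
Proof.
move=> [mg g0 gK] mf f0 fg; split => //; apply: le_trans gK.
apply: ae_ge0_le_integral => //; try by move=> w _; rewrite lee_fin.
- exact/measurable_EFinP.
- exact/measurable_EFinP.
- by apply: filterS fg => w fg _; rewrite lee_fin.
Qed.

Lemma mean_le_cst K : 0 <= K -> mean_le (fun=> K) K.
Proof.
move=> K0; split => //.
by rewrite integral_cst//= probability_setT mule1.
Qed.

Lemma mean_leD f g K L : mean_le f K -> mean_le g L ->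
  mean_le (fun w => f w + g w) (K + L).
Proof.
move=> [mf f0 fK] [mg g0 gL]; split.
- exact: measurable_funD.
- by move=> w; rewrite addr_ge0.
- under eq_integral do rewrite EFinD.
  rewrite ge0_integralD//; try by move=> w _; rewrite lee_fin.
  + by rewrite EFinD leeD.
  + exact/measurable_EFinP.
  + exact/measurable_EFinP.
Qed.

Lemma mean_leZ c f K : 0 <= c -> mean_le f K -> mean_le (fun w => c * f w) (c * K).
Proof.
move=> c0 [mf f0 fK]; split.
- exact: measurable_funM.
- by move=> w; rewrite mulr_ge0.
- under eq_integral do rewrite EFinM.
  rewrite ge0_integralZl_EFin//; last 2 first.
  + by move=> w _; rewrite lee_fin.
  + exact/measurable_EFinP.
  + by rewrite EFinM lee_wpmul2l.
Qed.

Lemma mean_le_sum (I : Type) (r : seq I) (f : I -> T -> R) (K : I -> R) :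
  (forall i, mean_le (f i) (K i)) ->
  mean_le (fun w => \sum_(i <- r) f i w) (\sum_(i <- r) K i).
Proof.
move=> fK; elim: r => [|i r IH].
  by under [X in mean_le X]eq_fun do rewrite big_nil; rewrite big_nil; exact: mean_le_cst.
under [X in mean_le X]eq_fun do rewrite big_cons.
by rewrite big_cons; exact: mean_leD.
Qed.

(** Fatou's lemma. The threshold n0 may depend on the sample point, so schemes need only be compared
    with solutions path by path. *)
Lemma mean_le_liminf f (g : nat -> T -> R) K (n1 : nat) :
  measurable_fun setT f -> (forall w, 0 <= f w) ->
  (forall n, (n1 <= n)%N -> mean_le (g n) K) ->
  {ae P, forall w, forall e, 0 < e -> exists n0, forall n, (n0 <= n)%N ->
     f w <= g n w + e} ->
  mean_le f K.
Proof.
move=> mf f0 gK fg; split => //.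
pose G n w := (g (n1 + n)%N w)%:E.
have gK' n : mean_le (g (n1 + n)%N) K by apply: gK; exact: leq_addr.
have mG n : measurable_fun setT (G n).
  by apply/measurable_EFinP; have [] := gK' n.
have G0 n w : setT w -> (0 <= G n w)%E.
  by move=> _; rewrite lee_fin; have [_ ->] := gK' n.
have mGi : measurable_fun setT (fun w => limn_einf (G ^~ w)).
  apply: (@emeasurable_fun_cvg _ _ _ _ (fun n w => einfs (G ^~ w) n)).
    by move=> n; exact: measurable_fun_einfs.
  by move=> w _; rewrite limn_einf_lim; exact: is_cvg_einfs.
apply: (@le_trans _ _ (\int[P]_w limn_einf (G ^~ w))%E).
  apply: ae_ge0_le_integral => //.
  - by move=> w _; rewrite lee_fin.
  - exact/measurable_EFinP.
  - move=> w _; rewrite limn_einf_lim.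
    apply: lime_ge; first exact: is_cvg_einfs.
    by apply: nearW => n; apply: le_ereal_inf_tmp => _ [m _ <-]; exact: G0.
  apply: filterS fg => w fgw _.
  apply/lee_addgt0Pr => e e0; have [n0 H] := fgw e e0.
  rewrite -leeBlDr// limn_einf_lim (cvg_lim _ (@cvg_einfs_sup _ _))//.
  apply: le_trans (ereal_sup_ubound _); last by exists n0.
  apply: le_ereal_inf_tmp => _ [m /= n0m <-].
  rewrite -EFinB lee_fin lerBlDr; apply: H.
  by apply: leq_trans n0m _; exact: leq_addl.
apply: le_trans (fatou P measurableT mG G0) _.
rewrite limn_einf_lim (cvg_lim _ (@cvg_einfs_sup _ _))//.
apply: ge_ereal_sup => _ [n _ <-].
apply: le_trans (ereal_inf_lbound _) _; first by exists n => /=.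
by have [] := gK' n.
Qed.

End mean_le.

(** * Discrete Gronwall inequality with dissipation *)

Section discrete_gronwall.
Context (R : realType).

(** Discrete counterpart of the kernel exp(- k (t - s)) ds. Its total mass is at most 1 / k whatever
    the horizon, which is why the final bounds are uniform in time. *)
Definition gronwall_weight (k h : R) (n j : nat) : R := h * (1 - k * h) ^+ (n - j.+1).

Lemma discrete_gronwall (k h : R) n (S G : nat -> R) : k * h <= 1 ->
  (forall j, (j < n)%N -> S j.+1 <= (1 - k * h) * S j + h * G j) ->
  S n <= (1 - k * h) ^+ n * S 0%N + \sum_(j < n) gronwall_weight k h n j * G j.
Proof.
move=> kh1 HS.
suff H m : (m <= n)%N -> S m <=
    (1 - k * h) ^+ m * S 0%N + \sum_(j < m) gronwall_weight k h m j * G j.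
  exact: H.
elim: m => [_|m IH mn]; first by rewrite big_ord0 expr0 mul1r addr0.
apply: le_trans (HS m mn) _.
rewrite big_ord_recr /= /gronwall_weight subnn expr0 mulr1 addrA lerD2r.
have -> : (1 - k * h) ^+ m.+1 * S 0%N +
    \sum_(i < m) h * (1 - k * h) ^+ (m.+1 - i.+1) * G i =
  (1 - k * h) * ((1 - k * h) ^+ m * S 0%N +
    \sum_(i < m) h * (1 - k * h) ^+ (m - i.+1) * G i).
  rewrite mulrDr exprS mulrA; congr (_ + _).
  rewrite mulr_sumr; apply: eq_bigr => i _.
  by rewrite subSn// exprS; ring.
by apply: ler_wpM2l; [rewrite subr_ge0|exact/IH/ltnW].
Qed.

Lemma gronwall_weight_ge0 (k h : R) n j : 0 <= h -> k * h <= 1 ->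
  0 <= gronwall_weight k h n j.
Proof. by move=> h0 kh; rewrite mulr_ge0// exprn_ge0// subr_ge0. Qed.

Lemma gronwall_weight_sum (k h : R) n : 0 < k -> 0 <= h -> k * h <= 1 ->
  \sum_(j < n) gronwall_weight k h n j <= k^-1.
Proof.
move=> k0 h0 kh.
have -> : \sum_(j < n) gronwall_weight k h n j =
    k^-1 * (1 - (1 - k * h) ^+ n).
  elim: n => [|n IH]; first by rewrite big_ord0 expr0; ring.
  rewrite big_ord_recr /= {2}/gronwall_weight subnn expr0 mulr1.
  rewrite (_ : \sum_(i < n) _ = (1 - k * h) * \sum_(j < n) gronwall_weight k h n j).
    by rewrite IH exprS; field; rewrite gt_eqF.
  rewrite mulr_sumr; apply: eq_bigr => i _.
  by rewrite /gronwall_weight subSn// exprS; ring.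
rewrite -[leRHS]mulr1; apply: ler_wpM2l; first by rewrite invr_ge0 ltW.
have : 0 <= (1 - k * h) ^+ n by rewrite exprn_ge0// subr_ge0.
by lra.
Qed.

End discrete_gronwall.

(** The recursion is pathwise, with an error e beyond a sample-dependent threshold, while the
    sources [G] and [H] are bounded only in mean. The weights are deterministic with mass at most 1
    / k, so means pass through the sum and t drops out of the bound. *)
Lemma mean_le_gronwall (dO : measure_display) (T : measurableType dO) (R : realType)
    (P : probability T R) (k t K0 K K' : R) (n1 : nat) (S : nat -> nat -> T -> R)
    (S0 Z : T -> R) (G : nat -> nat -> T -> R) (H : nat -> T -> R) :
  0 < k -> 0 <= t -> measurable_fun setT Z -> (forall w, 0 <= Z w) ->
  mean_le P S0 K0 -> (forall n j, (n1 <= n)%N -> (j < n)%N -> mean_le P (G n j) K) ->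
  (forall n, (n1 <= n)%N -> mean_le P (H n) K') ->
  {ae P, forall w, forall e, 0 < e -> exists n0, forall n, (n0 <= n)%N ->
    [/\ S n 0%N w <= S0 w,
      forall j, (j < n)%N -> S n j.+1 w <=
         (1 - k * (t / n%:R)) * S n j w + (t / n%:R) * (G n j w + e)
      & Z w <= S n n w + H n w + e]} ->
  mean_le P Z (K0 + K / k + K').
Proof.
move=> k0 t0 mZ Z0 S0K GK HK rec.
have [n2 n2P] : exists n2, (n1 < n2)%N /\ forall n, (n2 <= n)%N -> k * (t / n%:R) <= 1.
  exists (maxn n1.+1 (Num.truncn (k * t)).+1); split; first by rewrite leq_max ltnS leqnn.
  move=> n; rewrite geq_max -[k * t]divr1 => /andP[_ /(mesh_lt ltr01)[_ /ltW]].
  by rewrite mulrA.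
have [n12 kh] := n2P.
pose Gn n w := \sum_(j < n) gronwall_weight k (t / n%:R) n j * G n j w.
have hge n : 0 <= t / n%:R :> R by rewrite divr_ge0.
have GnK n : (n2 <= n)%N -> mean_le P (Gn n) (K / k).
  move=> n2n.
  apply: (@mean_leW _ _ _ _ _ (\sum_(j < n) gronwall_weight k (t / n%:R) n j * K)).
    rewrite -mulr_suml mulrC; apply: ler_wpM2l; last exact: gronwall_weight_sum (kh _ n2n).
    have n0 : (0 < n)%N by rewrite (leq_trans _ n2n)// (leq_ltn_trans _ n12).
    by apply: (@mean_le_ge0 _ _ _ P (G n 0%N)); apply: GK => //; apply: leq_trans n2n; exact: ltnW.
  apply: (mean_le_sum (index_enum 'I_n)) => j; apply: mean_leZ.
    by apply: gronwall_weight_ge0 => //; exact: kh.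
  by apply: GK => //; apply: leq_trans n2n; exact: ltnW.
apply: (@mean_le_liminf _ _ _ P Z (fun n w => S0 w + Gn n w + H n w) _ n2) => //.
  move=> n n2n; apply: mean_leD; first by apply: mean_leD => //; exact: GnK.
  by apply: HK; apply: leq_trans n2n; exact: ltnW.
apply: filterS rec => w rec e e0.
(* The error enters once in the final inequality and, through the weights, at most 1 / k times more;
   hence the divisor. *)
have e'0 : 0 < e / (1 + k^-1) by rewrite divr_gt0// addr_gt0// invr_gt0.
set e' := e / (1 + k^-1) in e'0.
have [n0 {}rec] := rec e' e'0; exists (maxn n0 n2) => n; rewrite geq_max => /andP[n0n n2n].
have [r1 r2 r3] := rec n n0n.
have khn := kh n n2n.
have := discrete_gronwall khn r2.
have -> : \sum_(j < n) gronwall_weight k (t / n%:R) n j * (G n j w + e') =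
   Gn n w + e' * \sum_(j < n) gronwall_weight k (t / n%:R) n j.
  rewrite mulr_sumr /Gn -big_split; apply: eq_bigr => j _ /=; ring.
have := ler_wpM2l (ltW e'0) (gronwall_weight_sum n k0 (hge n) khn) => w1 w2.
have S00 : 0 <= S0 w by have [_ ->] := S0K.
have p1 : (1 - k * (t / n%:R)) ^+ n * S n 0%N w <= S0 w.
  have a0 : 0 <= 1 - k * (t / n%:R) by rewrite subr_ge0.
  apply: le_trans (ler_wpM2l (exprn_ge0 n a0) r1) _.
  have a1 : 1 - k * (t / n%:R) <= 1 by have := mulr_ge0 (ltW k0) (hge n); lra.
  by rewrite ler_piMl// exprn_ile1.
have ee : e = e' + e' / k.
  have k1 : 1 + k^-1 != 0 by rewrite gt_eqF// addr_gt0// invr_gt0.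
  by rewrite -[in X in X + _](mulr1 e') -mulrDr /e' divfK.
by rewrite [in leRHS]ee; lra.
Qed.

(** * Independence *)

Lemma bigcap_seq_eqType (I : eqType) (U : Type) (s : seq I) (E : I -> set U) :
  \bigcap_(i in [set` s]) E i = \big[setI/setT]_(i <- s) E i.
Proof.
elim: s => [|i s IH].
  by rewrite big_nil eqEsubset; split=> // w _ i.
rewrite big_cons -IH eqEsubset; split=> w /=.
  move=> H; split; first by apply: H; rewrite /= mem_head.
  by move=> j /= js; apply: H; rewrite /= inE js orbT.
by move=> [Ei Es] j /=; rewrite inE => /predU1P[->//|js]; exact: Es.
Qed.

Section independence.
Context (R : realType) (dO : measure_display) (Omega : measurableType dO)
  (P : probability Omega R).

Lemma independentP (I : eqType) (F : I -> set (set Omega)) : independent P F <->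
  forall (s : seq I) (E : I -> set Omega), uniq s ->
    (forall i, i \in s -> F i (E i)) ->
    P (\big[setI/setT]_(i <- s) E i) = (\prod_(i <- s) P (E i))%E.
Proof.
by split=> H s E us FE; have := H s E us FE; rewrite bigcap_seq_eqType.
Qed.

Lemma sub_independent (I : eqType) (F G : I -> set (set Omega)) :
  (forall i, G i `<=` F i) -> independent P F -> independent P G.
Proof. by move=> GF H s E us GE; apply: H => // i /GE; exact: GF. Qed.

Lemma probability_fin_num (A : set Omega) : measurable A -> (P A \is a fin_num)%E.
Proof. by move=> mA; exact: fin_num_measure. Qed.

(** Both sides are finite measures in A that agree on a pi-system containing the whole space, so
    uniqueness of measures applies. *)
Lemma probability_pi_lambda (G : set (set Omega)) (C : set Omega) :
  G `<=` measurable -> setI_closed G -> G setT -> measurable C ->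
  (forall A, G A -> P (A `&` C) = (P A * P C)%E) ->
  forall A, <<s G >> A -> P (A `&` C) = (P A * P C)%E.
Proof.
move=> Gm GI GT mC H A sA.
have c0 : 0 <= fine (P C) by rewrite fine_ge0.
have PC : P C = (NngNum c0)%:num%:E by rewrite /= fineK// probability_fin_num.
have cov : \bigcup_(k : nat) (setT : set Omega) = setT.
  by rewrite eqEsubset; split=> // w _; exists 0%N.
have := @g_sigma_algebra_measure_unique _ _ _ G Gm (fun=> setT) (fun=> GT)
  cov (mrestr P mC) (mscale (NngNum c0) P) GI.
rewrite /mrestr /mscale/= => E; rewrite PC muleC; apply: E => //.
- by move=> B GB; rewrite /mrestr /mscale/= (H _ GB) PC muleC.
- by move=> _; rewrite /mrestr setTI ltey_eq probability_fin_num.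
Qed.

Lemma independent_g_sigma (I : eqType) (F : I -> set (set Omega)) :
  (forall i, F i `<=` measurable) -> (forall i, setI_closed (F i)) ->
  (forall i, F i setT) -> independent P F ->
  independent P (fun i => <<s F i >>).
Proof.
move=> Fm FI FT /independentP H; apply/independentP => s E us sE.
have sFm i : <<s F i >> `<=` measurable.
  by apply: smallest_sub => //; exact: sigma_algebra_measurable.
(* The classes are enlarged one index at a time: those with index in r have already been replaced by
   their sigma-algebras. *)
suff K (r : seq I) : forall s E, uniq s -> (forall i, i \in s ->
    if i \in r then <<s F i >> (E i) else F i (E i)) ->
    P (\big[setI/setT]_(i <- s) E i) = (\prod_(i <- s) P (E i))%E.
  by apply: (K s) => // i is_; rewrite is_; exact: sE.
elim: r => [|i0 r IH] {sE us E}s E us sE; first exact: H.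
have [i0s|i0s] := boolP (i0 \in s); last first.
  apply: IH => // i is_; have := sE i is_; rewrite inE.
  by case: eqP => // ii0; rewrite -ii0 is_ in i0s.
rewrite !(perm_big _ (perm_to_rem i0s))/= !big_cons.
have us' : uniq (rem i0 s) by exact: rem_uniq.
have i0s' : i0 \notin rem i0 s by rewrite mem_rem_uniqF.
have sE' i : i \in rem i0 s -> if i \in r then <<s F i >> (E i) else F i (E i).
  move=> irem; have ii0 : i != i0 by apply/eqP => ii0; rewrite ii0 (negbTE i0s') in irem.
  by have := sE i (mem_rem irem); rewrite inE (negbTE ii0).
have mE i : i \in rem i0 s -> measurable (E i).
  by move=> /sE'; case: ifP => _; [exact: sFm|exact: Fm].
rewrite -(IH (rem i0 s) E us' sE').
apply: (@probability_pi_lambda (F i0)) => //.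
- rewrite big_seq_cond; apply: big_ind => //; first exact: measurableI.
  by move=> i /andP[/mE].
- move=> A FA; rewrite (IH (rem i0 s) E us' sE').
  pose E' i := if i == i0 then A else E i.
  have EE' : forall i, i \in rem i0 s -> E' i = E i.
    by move=> i irem; rewrite /E'; case: eqP => // ii0; rewrite ii0 (negbTE i0s') in irem.
  have := IH (i0 :: rem i0 s) E'; rewrite /= i0s' us' => /(_ isT).
  have E'0 : E' i0 = A by rewrite /E' eqxx.
  rewrite !big_cons E'0.
  rewrite (eq_big_seq _ EE') (eq_big_seq (fun i => P (E i)))//; last first.
    by move=> i /EE' ->.
  apply=> i; rewrite inE => /predU1P[->|irem].
    by rewrite /E' eqxx; case: ifP => // _; exact: sub_gen_smallest.
  by rewrite EE'//; exact: sE'.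
- by have := sE i0 i0s; rewrite inE eqxx.
Qed.

(** Finite intersections of events of one group form a pi-system, and an intersection over distinct
    groups is again one over distinct indices, so the product rule holds before passing to
    sigma-algebras. It serves, for instance, to merge the initial datum and the noise of each
    particle. *)
Lemma independent_group (I J : eqType) (F : I -> set (set Omega)) (g : I -> J) :
  (forall i, F i `<=` measurable) -> (forall i, setI_closed (F i)) ->
  (forall i, F i setT) -> independent P F ->
  independent P (fun j => <<s \bigcup_(i in [set i | g i = j]) F i >>).
Proof.
move=> Fm FI FT /independentP H.
pose G j := [set E | exists (s : seq I) (A : I -> set Omega),
  [/\ uniq s, forall i, i \in s -> g i = j /\ F i (A i)
    & E = \big[setI/setT]_(i <- s) A i]].
have GT j : G j setT by exists [::], (fun=> setT); rewrite big_nil.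
have GI j : setI_closed (G j).
  move=> _ _ [s [A [us sA ->]]] [s' [A' [us' sA' ->]]].
  exists (undup (s ++ s')), (fun i => (if i \in s then A i else setT) `&`
    (if i \in s' then A' i else setT)); split; first exact: undup_uniq.
    move=> i; rewrite mem_undup mem_cat => iss'; split.
      by move: iss' => /orP[/sA[]|/sA'[]].
    apply: FI; first by case: ifP => // /sA[].
    by case: ifP => // /sA'[].
  rewrite -!bigcap_seq_eqType eqEsubset; split=> w /=.
    move=> [wA wA'] i _; split; first by case: ifP => // is_; exact: wA.
    by case: ifP => // is_; exact: wA'.
  move=> wss'; split=> i /= is_.
    by have [] := wss' i (_ : i \in _); rewrite ?mem_undup ?mem_cat ?is_.
  by have [] := wss' i (_ : i \in _); rewrite ?mem_undup ?mem_cat ?is_ ?orbT.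
have Gm j : G j `<=` measurable.
  move=> _ [s [A [us sA ->]]]; rewrite big_seq_cond; apply: big_ind => //.
    exact: measurableI.
  by move=> i /andP[/sA[_ /Fm]].
apply: (@sub_independent _ (fun j => <<s G j >>)).
  move=> j; apply: smallest_sub; first exact: smallest_sigma_algebra.
  move=> A [i /= gi FA]; apply: sub_gen_smallest.
  exists [:: i], (fun=> A); split=> //; last by rewrite big_seq1.
  by move=> i'; rewrite inE => /eqP ->.
apply: independent_g_sigma => //.
apply/independentP => js E; move=> ujs sE.
suff [s [A [us sA -> ->]]] : exists (s : seq I) (A : I -> set Omega),
  [/\ uniq s, forall i, i \in s -> g i \in js /\ F i (A i),
   \big[setI/setT]_(j <- js) E j = \big[setI/setT]_(i <- s) A i
   & (\prod_(j <- js) P (E j) = \prod_(i <- s) P (A i))%E].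
  by apply: H => // i /sA[].
elim: js ujs sE => [_ _|j js IH /= /andP[jjs ujs] sE].
  by exists [::], (fun=> setT); rewrite !big_nil.
have [|s [A [us sA E1 E2]]] := IH ujs.
  by move=> i ijs; apply: sE; rewrite inE ijs orbT.
have [s' [A' [us' sA' E']]] := sE j (mem_head _ _).
have dis i : i \in s -> (g i == j) = false.
  move=> /sA[gi _]; apply/negbTE; apply: contraNneq jjs => <-.
  exact: gi.
pose A2 i := if g i == j then A' i else A i.
have A2E i : i \in s -> A2 i = A i by move=> /dis; rewrite /A2 => ->.
have A2E' i : i \in s' -> A2 i = A' i by move=> /sA'[gi _]; rewrite /A2 gi eqxx.
exists (s' ++ s), A2; split.
- rewrite cat_uniq us us' andbT /=; apply/hasPn => i /dis gij.
  by apply/negP => /sA'[/eqP]; rewrite gij.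
- move=> i; rewrite mem_cat => /orP[is_|is_].
    by have [gi FA] := sA' i is_; rewrite gi inE eqxx A2E'.
  by have [gi FA] := sA i is_; rewrite inE gi orbT A2E.
- by rewrite big_cons big_cat/= E1 E' (eq_big_seq _ A2E) (eq_big_seq _ A2E').
- rewrite big_cons big_cat/= E2 E'; congr (_ * _)%E.
    have -> : (\prod_(i <- s') P (A2 i) = \prod_(i <- s') P (A' i))%E.
      by apply: eq_big_seq => i /A2E' ->.
    by apply: H => // i /sA'[].
  by apply: eq_big_seq => i /A2E ->.
Qed.

Lemma independent2 (I : eqType) (F : I -> set (set Omega)) i j A B :
  independent P F -> i != j -> F i A -> F j B -> P (A `&` B) = (P A * P B)%E.
Proof.
move=> /independentP H ij FA FB.
have := H [:: i; j] (fun k => if k == i then A else B).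
rewrite !big_cons !big_nil eqxx eq_sym (negbTE ij) setIT mule1; apply.
  by rewrite /= inE ij.
by move=> k; rewrite !inE => /orP[] /eqP ->; rewrite ?eqxx// eq_sym (negbTE ij).
Qed.

End independence.

Section sigma_var.
Context (dO dT : measure_display) (Omega : measurableType dO) (T : measurableType dT).

Lemma sigma_varP (X : Omega -> T) A :
  sigma_var X A <-> exists2 B, measurable B & X @^-1` B = A.
Proof.
by split=> -[B mB <-]; exists B => //; rewrite setTI.
Qed.

Lemma sigma_var_sub (X : Omega -> T) : measurable_fun setT X ->
  sigma_var X `<=` measurable.
Proof. by move=> mX _ [B mB <-]; exact: mX. Qed.

Lemma sigma_var_setI (X : Omega -> T) : setI_closed (sigma_var X).
Proof.
move=> _ _ /sigma_varP[A mA <-] /sigma_varP[B mB <-]; apply/sigma_varP.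
by exists (A `&` B); [exact: measurableI|].
Qed.

Lemma sigma_var_setT (X : Omega -> T) : sigma_var X setT.
Proof. by apply/sigma_varP; exists setT. Qed.

Lemma sigma_var_g_sigma (G : set (set Omega)) (X : Omega -> T) :
  measurable_fun setT (X : g_sigma_algebraType G -> T) -> sigma_var X `<=` <<s G >>.
Proof. by move=> mX _ [B mB <-]; exact: mX. Qed.

Lemma g_sigma_measurable_fun (G : set (set Omega)) (X : Omega -> T) :
  sigma_var X `<=` <<s G >> -> measurable_fun setT (X : g_sigma_algebraType G -> T).
Proof. by move=> XG _ B mB; apply: XG; exists B. Qed.

End sigma_var.

Section pair_law.
Context (R : realType) (dO d1 d2 : measure_display) (Omega : measurableType dO)
  (T1 : measurableType d1) (T2 : measurableType d2) (P : probability Omega R).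
Variables (U : {RV P >-> T1}) (V : {RV P >-> T2}).
Hypothesis UV : forall A B, measurable A -> measurable B ->
  P (U @^-1` A `&` V @^-1` B) = (P (U @^-1` A) * P (V @^-1` B))%E.

Let UVf w := (U w, V w).
Let mUV : measurable_fun setT UVf.
Proof. exact: measurable_fun_pair. Qed.
HB.instance Definition _ := isMeasurableFun.Build _ _ _ _ UVf mUV.
Let UVrv : {RV P >-> (T1 * T2)%type} := UVf.

Lemma pair_law X : measurable X ->
  (distribution P U \x distribution P V)%E X = distribution P UVrv X.
Proof.
apply: product_measure_unique => A B mA mB.
by rewrite /distribution/= /pushforward -UV.
Qed.

(** The law of (U, V) is a product, so Fubini allows V to be integrated first with U frozen, and
    that inner integral vanishes. *)
Lemma independent_mean0 (h : T1 * T2 -> R) : measurable_fun setT h ->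
  P.-integrable setT (fun w => (h (U w, V w))%:E) ->
  (forall u, P.-integrable setT (fun w => (h (u, V w))%:E)) ->
  (forall u, \int[P]_w (h (u, V w))%:E = 0)%E ->
  (\int[P]_w (h (U w, V w))%:E = 0)%E.
Proof.
move=> mh ih ihu h0.
have mhE : measurable_fun setT (EFin \o h) by exact/measurable_EFinP.
have lawE : forall X, measurable X -> X `<=` setT ->
    distribution P UVrv X = (distribution P U \x distribution P V)%E X.
  by move=> X mX _; rewrite -pair_law.
have ihd : (distribution P UVrv).-integrable setT (EFin \o h).
  apply/integrableP; split => //.
  rewrite ge0_integral_distribution//; last exact: measurableT_comp.
  by move/integrableP: ih => [].
have ihp : (distribution P U \x distribution P V)%E.-integrable setT (EFin \o h).
  apply/integrableP; split => //.
  rewrite -(eq_measure_integral _ lawE).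
  by move/integrableP: ihd => [].
transitivity (\int[distribution P UVrv]_x (EFin \o h) x)%E.
  by rewrite integral_distribution.
rewrite (eq_measure_integral _ lawE).
rewrite -(fubini1 ihp); apply: integral0_eq => u _.
rewrite /fubini_F -[RHS](h0 u).
rewrite integral_distribution//.
- by apply: measurableT_comp => //; exact: pair1_measurable.
- exact: ihu.
Qed.
End pair_law.

(** * Borel measurability *)

Section coordinates.
Context (R : realType) (dO : measure_display) (Omega : measurableType dO)
  (I : finType).

(* A neighbourhood in the coordinates is a countable union of dyadic cubes. *)
Lemma measurable_of_coordinates (x : I -> Omega -> R) (U : set Omega) :
  (forall i, measurable_fun setT (x i)) ->
  (forall w, U w -> exists2 e : R, 0 < e &
     forall w', (forall i, `|x i w - x i w'| < e) -> U w') ->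
  measurable U.
Proof.
move=> mx HU.
pose code (n : nat) w : {ffun I -> int} := [ffun i => Num.floor (n.+1%:R * x i w)].
pose fiber n c := [set w | code n w = c].
have mfiber n c : measurable (fiber n c).
  have -> : fiber n c = \bigcap_(i in [set: I])
     ((fun w => n.+1%:R * x i w) @^-1` `[(c i)%:~R, (c i + 1)%:~R[).
    rewrite eqEsubset; split=> w /=.
      move=> <- i _ /=; rewrite ffunE in_itv/= floor_le_tmp.
      by rewrite floorD1_gt.
    move=> H; apply/ffunP => i; rewrite ffunE.
    have := H i Logic.I; rewrite /= in_itv/= => /andP[h1 h2].
    by apply/eqP; rewrite floor_eq h1 h2.
  apply: fin_bigcap_measurable => // i _.
  rewrite -[X in measurable X]setTI.
  have : measurable_fun setT (fun w => n.+1%:R * x i w) by exact: measurable_funM.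
  by apply.
have -> : U = \bigcup_n \bigcup_m
   (if unpickle m is Some c then
     if pselect (fiber n c `<=` U) then fiber n c else set0 else set0).
  rewrite eqEsubset; split=> w.
    move=> Uw; have [e e0 He] := HU w Uw.
    have [n ne] : exists n : nat, n.+1%:R^-1 < e.
      exists (Num.truncn e^-1); rewrite invf_plt ?posrE//; exact: truncnS_gt.
    exists n => //; exists (pickle (code n w)) => //.
    rewrite pickleK; case: pselect => //= H; exfalso; apply: H => w' ww'.
    apply: He => i.
    have n0 : 0 < n.+1%:R :> R by [].
    have := congr1 (fun g : {ffun I -> int} => g i) ww'; rewrite !ffunE => fl.
    have a1 := floor_le_tmp (n.+1%:R * x i w); have a2 := floorD1_gt (n.+1%:R * x i w).
    have b1 := floor_le_tmp (n.+1%:R * x i w'); have b2 := floorD1_gt (n.+1%:R * x i w').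
    apply: lt_trans ne; rewrite -(ltr_pM2l n0) divff ?gt_eqF//.
    rewrite -[X in X * _]gtr0_norm// -normrM ltr_norml mulrBr.
    rewrite fl in b1 b2; rewrite !intrD/= in a2 b2.
    by apply/andP; split; lra.
  move=> [n _ [m _]]; case: unpickle => // c; case: pselect => //= H.
  exact: H.
apply: bigcupT_measurable => n; apply: bigcupT_measurable => m.
case: (unpickle m) => [c|]; last exact: measurable0.
by case: ifP => _; [exact: mfiber|exact: measurable0].
Qed.

End coordinates.

Section borel.
Context (R : realType).

Lemma measurable_rVP (dO : measure_display) (Omega : measurableType dO) (d : nat)
    (X : Omega -> 'rV[R]_d) :
  (forall c, measurable_fun setT (fun w => X w 0 c)) -> measurable_fun setT X.
Proof.
have E : @measurable _ 'rV[R]_d = <<s [set U : set 'rV[R]_d | open U] >> by [].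
move=> mX; apply: (measurability _ E).
move=> _ [U oU <-]; rewrite setTI.
apply: (@measurable_of_coordinates R _ _ 'I_d (fun c w => X w 0 c)) => // w /= Uw.
have /nbhs_ballP[e /= e0 eU] := open_nbhs_nbhs (conj oU Uw).
exists e => // w' ww'; apply: eU; split=> // i j; rewrite (ord1 i).
exact: ww'.
Qed.

Lemma continuous_measurable_rV (d : nat) (f : 'rV[R]_d -> R) :
  continuous f -> measurable_fun setT f.
Proof.
move=> /continuousP cf; apply: (measurability _ (RGenOInfty.measurableE R)) => //.
move=> _ [_ [a ->] <-]; rewrite setTI; apply: sub_sigma_algebra => /=.
by apply: cf; rewrite set_itvoy; exact: open_gt.
Qed.

Lemma measurable_coord (d : nat) (c : 'I_d) :
  measurable_fun setT (fun v : 'rV[R]_d => v 0 c).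
Proof. apply: continuous_measurable_rV; exact: coord_continuous. Qed.

Lemma measurable_phase_coord (dO : measure_display) (Omega : measurableType dO)
    (d : nat) (X : Omega -> phase R d) (c : 'I_d) : measurable_fun setT X ->
  [/\ measurable_fun setT (fun w => qof (X w) 0 c),
      measurable_fun setT (fun w => pof (X w) 0 c)
    & measurable_fun setT (fun w => zof (X w) 0 c)].
Proof.
move=> mX.
have m1 : measurable_fun setT (fun w => (X w).1) by exact: measurableT_comp measurable_fst mX.
have mc (Y : Omega -> 'rV[R]_d) : measurable_fun setT Y -> measurable_fun setT (fun w => Y w 0 c).
  by move=> mY; apply: (measurableT_comp (measurable_coord c)) mY.
split; apply: mc.
- exact: measurableT_comp measurable_fst m1.
- exact: measurableT_comp measurable_snd m1.
- exact: measurableT_comp measurable_snd mX.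
Qed.

Lemma measurable_phaseP (dO : measure_display) (Omega : measurableType dO)
    (d : nat) (X : Omega -> phase R d) :
  (forall c, [/\ measurable_fun setT (fun w => qof (X w) 0 c),
      measurable_fun setT (fun w => pof (X w) 0 c)
    & measurable_fun setT (fun w => zof (X w) 0 c)]) -> measurable_fun setT X.
Proof.
move=> mX.
have -> : X = (fun w => (qof (X w), pof (X w), zof (X w))).
  by apply/funext => w; rewrite /qof /pof /zof -!surjective_pairing.
apply: measurable_fun_pair; last by apply: measurable_rVP => c; have [] := mX c.
by apply: measurable_fun_pair; apply: measurable_rVP => c; have [] := mX c.
Qed.

(** The uniform balls form a filter that converges to x in every coordinate, hence in the pointwise
    topology. *)
Lemma ptws_nbhs_ball (k : nat) (U : pseudoMetricType R)
    (x : {ptws 'I_k -> U}) (A : set {ptws 'I_k -> U}) : nbhs x A ->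
  exists2 e : R, 0 < e & forall y : {ptws 'I_k -> U},
    (forall i, ball (x i) e (y i)) -> A y.
Proof.
pose B (e : R) := [set y : {ptws 'I_k -> U} | forall i, ball (x i) e (y i)].
pose F := filter_from [set e : R | 0 < e] B.
have FF : Filter F.
  apply: filter_from_filter; first by exists 1 => /=.
  move=> e1 e2 /= e10 e20; exists (Num.min e1 e2) => /=.
    by rewrite lt_min e10.
  move=> y /= xy; split=> i; apply: le_ball (xy i); by rewrite ge_min lexx ?orbT.
have Fx : F --> x.
  apply/cvg_sup => i V; rewrite nbhsE => -[_ [[W oW <-] /= Wx] WV].
  have /nbhs_ballP[e /= e0 eW] : nbhs (x i) W := open_nbhs_nbhs (conj oW Wx).
  by exists e => // y xy; apply: WV; apply: eW; exact: xy.
by move=> /Fx [e /= e0 eA]; exists e => // y xy; exact: eA.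
Qed.

End borel.

(** * Gaussian variables *)

Section gaussian.
Context (R : realType).
Local Notation mu := (@lebesgue_measure R).

(** The Radon-Nikodym derivative of the normal law and the explicit density have the same integral
    over every measurable set, hence agree almost everywhere. *)
Lemma ge0_integral_normal_prob (m s : R) (f : R -> \bar R) :
  (forall x, 0 <= f x)%E -> measurable_fun setT f ->
  (\int[normal_prob m s]_x f x = \int[mu]_x (f x * (normal_pdf m s x)%:E))%E.
Proof.
move=> f0 mf.
have dom := normal_prob_dominates m s.
rewrite -(Radon_Nikodym_SigmaFinite.change_of_variables dom)//.
have mpdf : measurable_fun setT (fun x => (normal_pdf m s x)%:E).
  by apply/measurable_EFinP; exact: measurable_normal_pdf.
have ifn := Radon_Nikodym_SigmaFinite.f_integrable dom.
apply: ae_eq_integral => //.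
- by apply: emeasurable_funM => //; exact: (measurable_int mu ifn).
- by apply: emeasurable_funM.
apply: ae_eqe_mul2l => /=; apply: integral_ae_eq => //.
by move=> E _ mE; rewrite -Radon_Nikodym_SigmaFinite.f_integral.
Qed.

(* Comparison with a wider Gaussian bounds the variance without computing it. *)
Lemma normal_pdf_sqr_bound (s x : R) : 0 < s ->
  x ^+ 2 * normal_pdf 0 s x <= 16 * s ^+ 2 * normal_pdf 0 (2 * s) x.
Proof.
move=> s0; have sn0 : s != 0 by rewrite gt_eqF.
have s2n0 : 2 * s != 0 by rewrite gt_eqF// mulr_gt0.
rewrite !normal_pdfE// /normal_peak /normal_fun !subr0.
have -> : Num.sqrt ((2 * s) ^+ 2 * pi *+ 2) = 2 * Num.sqrt (s ^+ 2 * pi *+ 2).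
  have -> : (2 * s) ^+ 2 * pi *+ 2 = 2 ^+ 2 * (s ^+ 2 * pi *+ 2) :> R.
    by rewrite -!(mulr_natr (_ * pi)); ring.
  by rewrite sqrtrM ?sqr_ge0// sqrtr_sqr ger0_norm.
set S := Num.sqrt _.
have S0 : 0 < S.
  by rewrite sqrtr_gt0 pmulrn_lgt0// mulr_gt0 ?pi_gt0 ?exprn_gt0.
(* In terms of u the two exponentials are exp(- 4 u) and exp(- u), and x^2 is 8 s^2 u. The
   inequality then reduces to u exp(- u) <= 1 and exp(- u) <= 1. *)
pose u := x ^+ 2 / (s ^+ 2 * 8).
have u0 : 0 <= u.
  have s8 : 0 <= s ^+ 2 * 8 by rewrite mulr_ge0 ?sqr_ge0.
  by rewrite divr_ge0 ?sqr_ge0.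
have s2 : s ^+ 2 != 0 by rewrite expf_neq0.
have -> : - x ^+ 2 / (s ^+ 2 *+ 2) = - u + - u + (- u + - u).
  by rewrite /u -mulr_natr; field.
have -> : - x ^+ 2 / ((2 * s) ^+ 2 *+ 2) = - u.
  by rewrite /u -mulr_natr; field.
have Eu := expR_gt0 (- u).
have h1 : u * expR (- u) <= 1.
  have := expR_ge1Dx u; rewrite expRN => h.
  by rewrite ler_pdivrMr ?expR_gt0// mul1r; lra.
have h2 : expR (- u) <= 1 by rewrite -expR0 ler_expR oppr_le0.
have -> : x ^+ 2 = 8 * s ^+ 2 * u by rewrite /u; field.
rewrite !expRD invfM.
set e := expR (- u) in Eu h1 h2 *.
have -> : 8 * s ^+ 2 * u * (S^-1 * (e * e * (e * e))) =
   (8 * s ^+ 2 * S^-1 * e) * ((u * e) * (e * e)) by ring.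
have -> : 16 * s ^+ 2 * (2^-1 * S^-1 * e) = (8 * s ^+ 2 * S^-1 * e) * 1 by field; rewrite gt_eqF.
have e0 := ltW Eu.
have ee : e * e <= 1 := mulr_ile1 e0 e0 h2 h2.
have ue := mulr_ile1 (mulr_ge0 u0 e0) (mulr_ge0 e0 e0) h1 ee.
apply: ler_wpM2l => //.
by rewrite mulr_ge0// mulr_ge0 ?invr_ge0 ?ltW// mulr_gt0// exprn_gt0.
Qed.

Section normal_variable.
Context (dO : measure_display) (Omega : measurableType dO) (P : probability Omega R)
  (X : {RV P >-> R}) (s : R).
Hypotheses (s0 : 0 < s)
  (lawX : forall U, measurable U -> P (X @^-1` U) = normal_prob 0 s U).

(* [normal_prob] lives on [measurableTypeR R], which has the same measurable sets
   as [R] but another display. *)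
Let XR : Omega -> measurableTypeR R := X.
Let mXR : measurable_fun setT XR.
Proof. exact: (@measurable_funPT _ _ _ _ X). Qed.
HB.instance Definition _ :=
  isMeasurableFun.Build _ _ Omega (measurableTypeR R) XR mXR.

Lemma ge0_integral_normal_variable (f : R -> \bar R) :
  (forall x, 0 <= f x)%E -> measurable_fun setT f ->
  (\int[P]_w f (X w) = \int[mu]_x (f x * (normal_pdf 0 s x)%:E))%E.
Proof.
move=> f0 mf; rewrite -ge0_integral_normal_prob//.
have := @ge0_integral_distribution _ _ _ (measurableTypeR R) _ P (XR : {RV P >-> measurableTypeR R}) f mf f0.
rewrite /comp => <-.
by apply: eq_measure_integral => A mA _; exact: lawX.
Qed.

Lemma normal_variable_sqr : mean_le P (fun w => X w ^+ 2) (16 * s ^+ 2).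
Proof.
have msqr : measurable_fun setT (fun x : R => x ^+ 2) by exact: measurable_funX.
split; [by apply: measurable_funX; exact: measurable_funPT | by move=> w; exact: sqr_ge0 |].
rewrite (@ge0_integral_normal_variable (fun x => (x ^+ 2)%:E)); last 2 first.
- by move=> x; rewrite lee_fin sqr_ge0.
- exact/measurable_EFinP.
have mp (r : R) : measurable_fun setT (fun x => (normal_pdf 0 r x)%:E).
  by apply/measurable_EFinP; exact: measurable_normal_pdf.
have msqrE : measurable_fun setT (fun x : R => (x ^+ 2)%:E) by exact/measurable_EFinP.
apply: (@le_trans _ _ (\int[mu]_x ((16 * s ^+ 2)%:E * (normal_pdf 0 (2 * s) x)%:E))%E).
  apply: ge0_le_integral => //.
  - by move=> x _; rewrite mule_ge0// lee_fin ?sqr_ge0 ?normal_pdf_ge0.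
  - by apply: emeasurable_funM; [exact: msqrE|exact: mp].
  - by apply: emeasurable_funM; [exact: measurable_cst|exact: mp].
  - by move=> x _; rewrite -!EFinM lee_fin; exact: normal_pdf_sqr_bound.
have p0 x : setT x -> (0 <= (normal_pdf 0 (2 * s) x)%:E)%E.
  by move=> _; rewrite lee_fin normal_pdf_ge0.
have k0 : 0 <= 16 * s ^+ 2 by rewrite mulr_ge0 ?sqr_ge0.
rewrite (ge0_integralZl_EFin mu measurableT p0 (mp _) k0).
by rewrite integral_normal_pdf mule1.
Qed.

Lemma sqr_integrable_integrable (d' : measure_display) (T : measurableType d')
    (Q : probability T R) (Y : T -> R) (K : R) :
  measurable_fun setT Y -> mean_le Q (fun w => Y w ^+ 2) K ->
  Q.-integrable setT (EFin \o Y).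
Proof.
move=> mY mK; apply/integrableP; split; first exact/measurable_EFinP.
have [_ _ +] : mean_le Q (fun w => `|Y w|) (1 + K).
  apply: (mean_le_dom (mean_leD (mean_le_cst Q ler01) mK)) => //.
    exact: measurableT_comp.
  apply: aeW => w; have : 0 <= (`|Y w| - 1) ^+ 2 by exact: sqr_ge0.
  rewrite -(real_normK (num_real (Y w))); have := normr_ge0 (Y w).
  move: `|Y w| => y y0; rewrite sqrrB1; have := sqr_ge0 y; lra.
by move=> /le_lt_trans; apply; exact: ltry.
Qed.

(** Since the density is even, the integral of |x| against it is twice the integral over x >= 0. It
    is also the sum of the integrals of the positive and negative parts; these are finite, hence
    equal. *)
Lemma normal_variable_mean : (\int[P]_w (X w)%:E = 0)%E.
Proof.
have iX : P.-integrable setT (EFin \o X).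
  by apply: sqr_integrable_integrable normal_variable_sqr; exact: measurable_funPT.
have mEFin : measurable_fun setT (@EFin R) by [].
rewrite integralE.
have mid : measurable_fun setT (fun x : R => x%:E) by exact/measurable_EFinP.
have E1 := ge0_integral_normal_variable (@funepos_ge0 _ _ (fun x : R => x%:E)) (measurable_funepos mid).
have E2 := ge0_integral_normal_variable (@funeneg_ge0 _ _ (fun x : R => x%:E)) (measurable_funeneg mid).
set g := normal_pdf 0 s.
have g0 x : 0 <= g x by exact: normal_pdf_ge0.
have sn0 : s != 0 by rewrite gt_eqF.
have mg : measurable_fun setT (EFin \o g).
  by apply/measurable_EFinP; exact: measurable_normal_pdf.
pose fp x : \bar R := ((@EFin R)^\+%E x * (g x)%:E)%E.
pose fn x : \bar R := ((@EFin R)^\-%E x * (g x)%:E)%E.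
have mfp : measurable_fun setT fp.
  by apply: emeasurable_funM; [exact: measurable_funepos|exact: mg].
have mfn : measurable_fun setT fn.
  by apply: emeasurable_funM; [exact: measurable_funeneg|exact: mg].
have fp0 x : (0 <= fp x)%E by rewrite mule_ge0 ?lee_fin ?funepos_ge0.
have fn0 x : (0 <= fn x)%E by rewrite mule_ge0 ?lee_fin ?funeneg_ge0.
pose f x := `|x| * g x.
have f0 x : 0 <= f x by rewrite mulr_ge0.
have cf : continuous f.
  by move=> x; apply: cvgM; [exact: norm_continuous|exact: continuous_normal_pdf].
have sf : f =1 f \o -%R.
  move=> x; rewrite /f/= normrN; congr (_ * _).
  by rewrite /g !normal_pdfE// /normal_fun !subr0 sqrrN.
have fE x : (f x)%:E = (fp x + fn x)%E.
  rewrite /fp /fn -ge0_muleDl ?funepos_ge0 ?funeneg_ge0// EFinM; congr (_ * _)%E.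
  by have := congr1 (fun h => h x) (fune_abse (@EFin R)).
have posE : (\int[mu]_(x in [set x | (0 <= x)%R]) (f x)%:E = \int[mu]_x fp x)%E.
  rewrite integral_mkcond; apply: eq_integral => x _.
  rewrite patchE; case: ifPn => [|]; rewrite ?inE/=.
    move=> x0; rewrite /f /fp ger0_norm// EFinM funeposE; congr (_ * _)%E.
    by apply/esym/max_idPl; rewrite lee_fin.
  rewrite notin_setE/= => /negP; rewrite -ltNge => x0.
  rewrite /fp funeposE (_ : maxe _ _ = 0)%E ?mul0e//.
  by apply/max_idPr; rewrite lee_fin ltW.
have dbl : (\int[mu]_x fp x + \int[mu]_x fn x = \int[mu]_x fp x + \int[mu]_x fp x)%E.
  rewrite -ge0_integralD//.
  transitivity (\int[mu]_x (f x)%:E)%E; first by apply: eq_integral => x _; rewrite fE.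
  by rewrite (ge0_symfun_integralT f0 cf sf) posE mule_natl mule2n.
have eqp : (\int[P]_w (fun w => (X w)%:E)^\+ w = \int[P]_w (@EFin R)^\+ (X w))%E.
  by apply: eq_integral => w _; rewrite !funeposE.
have eqm : (\int[P]_w (fun w => (X w)%:E)^\- w = \int[P]_w (@EFin R)^\- (X w))%E.
  by apply: eq_integral => w _; rewrite !funenegE.
have fin : (\int[mu]_x fp x)%E \is a fin_num.
  rewrite /fp /g -E1 -eqp.
  exact: (integrable_fin_num measurableT (integrable_funepos measurableT iX)).
rewrite eqp eqm E1 E2 -/g -/fp -/fn.
move: dbl => /(congr1 (fun y => y - \int[mu]_x fp x)%E).
by rewrite addeAC subee// add0e addeK// => ->; rewrite subee.
Qed.

End normal_variable.
End gaussian.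

(** * The noise scheme *)

Section orthogonal.
Context (R : realType) (dO : measure_display) (T : measurableType dO)
  (P : probability T R).

Lemma mean_le_mul_integrable (f g : T -> R) (K L : R) :
  measurable_fun setT f -> measurable_fun setT g ->
  mean_le P (fun w => f w ^+ 2) K -> mean_le P (fun w => g w ^+ 2) L ->
  P.-integrable setT (fun w => (f w * g w)%:E).
Proof.
move=> mf mg fK gL; apply/integrableP; split.
  by apply/measurable_EFinP; exact: measurable_funM.
have [_ _ +] : mean_le P (fun w => `|f w * g w|) (K + L).
  apply: (mean_le_dom (mean_leD fK gL)) => //.
    by apply: measurableT_comp => //; exact: measurable_funM.
  apply: aeW => w; rewrite normrM.
  rewrite -(real_normK (num_real (f w))) -(real_normK (num_real (g w))).
  have := sqr_ge0 (`|f w| - `|g w|); have := normr_ge0 (f w); have := normr_ge0 (g w).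
  move: `|f w| `|g w| => x y; rewrite sqrrB -mulr_natr.
  by have := sqr_ge0 x; have := sqr_ge0 y; lra.
by move=> /le_lt_trans; apply; exact: ltry.
Qed.

(** Pythagoras. It is used for the Brownian increments of the Gaussian scheme, and for the N terms
    of the fluctuation, where it produces the rate 1 / N. *)
Lemma mean_le_orthogonal_sum (n : nat) (Y : 'I_n -> T -> R) (K : 'I_n -> R) :
  (forall j, measurable_fun setT (Y j)) ->
  (forall j, mean_le P (fun w => Y j w ^+ 2) (K j)) ->
  (forall j l, j != l -> (\int[P]_w (Y j w * Y l w)%:E = 0)%E) ->
  mean_le P (fun w => (\sum_(j < n) Y j w) ^+ 2) (\sum_(j < n) K j).
Proof.
move=> mY YK ort.
have iYY j l : P.-integrable setT (fun w => (Y j w * Y l w)%:E).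
  exact: mean_le_mul_integrable (YK j) (YK l).
split.
- by apply: measurable_funX; exact: measurable_sum.
- by move=> w; exact: sqr_ge0.
have E w : ((\sum_(j < n) Y j w) ^+ 2)%:E =
    (\sum_(j < n) \sum_(l < n) (Y j w * Y l w)%:E)%E.
  rewrite expr2 big_distrlr/= -sumEFin; apply: eq_bigr => j _.
  by rewrite -sumEFin.
under eq_integral do rewrite E.
rewrite integral_sum//; last by move=> j; apply: integrable_sum => // l _; exact: iYY.
rewrite -sumEFin; apply: lee_sum => j _.
rewrite integral_sum//.
have -> : (\sum_(l < n) \int[P]_w (Y j w * Y l w)%:E = \int[P]_w (Y j w ^+ 2)%:E)%E.
  rewrite (bigD1 j)//= [X in (_ + X)%E]big1; last first.
    by move=> l lj; rewrite ort// eq_sym.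
  by rewrite adde0; apply: eq_integral => w _; rewrite expr2.
by have [] := YK j.
Qed.

End orthogonal.

Section noise_scheme.
Context (R : realType) (d : nat) (al be la : R).

(** The Euler scheme of the linear equation without [A] and [B], started at 0; it is the Gaussian
    reference of the moment bounds. *)
Fixpoint noise_scheme (h : R) (n : nat -> 'rV[R]_d) (k : nat) : phase R d :=
  if k is k'.+1 then
    let x := noise_scheme h n k' in
    (qof x + h *: pof x,
     pof x + h *: (- (be *: qof x) + la *: zof x),
     zof x + h *: (- (la *: pof x) - al *: zof x) + Num.sqrt 2 *: n k')
  else 0.

Lemma noise_scheme_step h n k :
  step al be la h 0 0 (noise_scheme h n k) (noise_scheme h n k.+1) (n k).
Proof.
move=> c; rewrite !mulr0 !normr_le0 /=.
by split; rewrite /qof /pof /zof /= !mxE; apply/eqP; ring.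
Qed.

(* Response of the linear scheme to a unit impulse in the noise. *)
Fixpoint impulse (h : R) (k : nat) : R * R * R :=
  if k is k'.+1 then
    let: (q, p, z) := impulse h k' in
    (q + h * p, p + h * (- (be * q) + la * z), z + h * (- (la * p) - al * z))
  else (0, 0, Num.sqrt 2).

(** Discrete Duhamel formula: by linearity, the noise of step j is propagated over the k - j - 1
    steps that follow. *)
Lemma noise_scheme_impulse h n k (c : 'I_d) :
  [/\ qof (noise_scheme h n k) 0 c = \sum_(j < k) (impulse h (k - j.+1)).1.1 * n j 0 c,
      pof (noise_scheme h n k) 0 c = \sum_(j < k) (impulse h (k - j.+1)).1.2 * n j 0 c
    & zof (noise_scheme h n k) 0 c = \sum_(j < k) (impulse h (k - j.+1)).2 * n j 0 c].
Proof.
elim: k => [|k]; first by rewrite !big_ord0 /qof /pof /zof /= !mxE.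
have E (j : 'I_k) : impulse h (k.+1 - j.+1) = impulse h (k - j.+1).+1.
  by rewrite subSn.
rewrite /qof /pof /zof !big_ord_recr /= subnn /= !mul0r !addr0 => -[IHq IHp IHz].
rewrite !mxE IHq IHp IHz.
split.
- rewrite mulr_sumr -big_split; apply: eq_bigr => j _; rewrite E /=.
  by case: (impulse h (k - j.+1)) => [[q p] z] /=; ring.
- rewrite !mulr_sumr -sumrN -big_split/= mulr_sumr -big_split/=.
  apply: eq_bigr => j _; rewrite E /=.
  by case: (impulse h (k - j.+1)) => [[q p] z] /=; ring.
- rewrite !mulr_sumr -!sumrN -big_split/= mulr_sumr; congr (_ + _).
  rewrite -big_split/=; apply: eq_bigr => j _; rewrite E /=.
  by case: (impulse h (k - j.+1)) => [[q p] z] /=; ring.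
Qed.

End noise_scheme.

(** * Brownian increments on a uniform grid *)

Definition brownian_increment (R : realType) (d : nat) (T : Type)
    (W : R -> T -> 'rV[R]_d) (h : R) (k : nat) (w : T) : 'rV[R]_d :=
  W (k.+1%:R * h) w - W (k%:R * h) w.

Section brownian_increments.
Context (R : realType) (d : nat) (dO : measure_display) (T : measurableType dO)
  (P : probability T R) (W : R -> T -> 'rV[R]_d) (h : R).
Hypotheses (mW : forall t, measurable_fun setT (W t)) (bW : brownian_motion P W)
  (h0 : 0 < h).

Lemma measurable_brownian_increment k (c : 'I_d) :
  measurable_fun setT (fun w => brownian_increment W h k w 0 c).
Proof.
have mc t : measurable_fun setT (fun w => W t w 0 c).
  exact: (measurableT_comp (measurable_coord c)) (mW t).
have -> : (fun w => brownian_increment W h k w 0 c) =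
    (fun w => W (k.+1%:R * h) w 0 c - W (k%:R * h) w 0 c).
  by apply/funext => w; rewrite !mxE.
exact: measurable_funB.
Qed.

Let inc k c : {RV P >-> R} := mfun_Sub (mem_set (measurable_brownian_increment k c)).

Let inc_law k c U : measurable U -> P (inc k c @^-1` U) = normal_prob 0 (Num.sqrt h) U.
Proof.
have [_ _ law _] := bW => mU.
have t0 : 0 <= k%:R * h by rewrite mulr_ge0// ltW.
have ts : k%:R * h < k.+1%:R * h by rewrite ltr_pM2r// ltr_nat.
have tsE : k.+1%:R * h - k%:R * h = h by rewrite -natr1; ring.
by have [_ /(_ c U mU)] := law _ _ t0 ts; rewrite tsE.
Qed.

Let sqrth : 0 < Num.sqrt h. Proof. by rewrite sqrtr_gt0. Qed.

Lemma brownian_increment_sqr k (c : 'I_d) :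
  mean_le P (fun w => brownian_increment W h k w 0 c ^+ 2) (16 * h).
Proof.
have := @normal_variable_sqr _ _ _ P (inc k c) _ sqrth (inc_law k c).
by rewrite sqr_sqrtr// ltW.
Qed.

Lemma brownian_increment_orthogonal j k (c : 'I_d) : j != k ->
  (\int[P]_w (brownian_increment W h j w 0 c * brownian_increment W h k w 0 c)%:E = 0)%E.
Proof.
move=> jk; have [_ _ _ ind] := bW.
have tau0 : 0 <= 0%:R * h by rewrite mul0r.
have tauS l : l%:R * h <= l.+1%:R * h by rewrite ler_pM2r// ler_nat.
have indep := ind (fun l => l%:R * h) tau0 tauS.
have msqr (l : nat) := brownian_increment_sqr l c.
have mB (l : nat) := measurable_brownian_increment l c.
have ik : P.-integrable setT (EFin \o inc k c).
  exact: (@sqr_integrable_integrable R _ _ P _ _ (mB k) (msqr k)).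
apply: (@independent_mean0 _ _ _ _ _ _ _ P (inc j c) (inc k c) _ (fun x => x.1 * x.2)).
- move=> A B mA mB'; apply: (independent2 indep jk).
    apply/sigma_varP; exists ((fun v : 'rV[R]_d => v 0 c) @^-1` A) => //.
    by rewrite -[X in measurable X]setTI; exact: measurable_coord.
  apply/sigma_varP; exists ((fun v : 'rV[R]_d => v 0 c) @^-1` B) => //.
  by rewrite -[X in measurable X]setTI; exact: measurable_coord.
- by apply: measurable_funM; [exact: measurable_fst|exact: measurable_snd].
- exact: mean_le_mul_integrable (mB j) (mB k) (msqr j) (msqr k).
- by move=> u; have := integrableZl measurableT u ik.
- move=> u /=; under eq_integral do rewrite EFinM.
  rewrite integralZl//.
  by rewrite (@normal_variable_mean _ _ _ P (inc k c) _ sqrth (inc_law k c)) mule0.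
Qed.

End brownian_increments.

(** * Euclidean norms on phase space *)

Section phase_sqnorm.
Context (R : realType) (d : nat).
Implicit Types (x y : phase R d).

Lemma sqnorm_ge0 (v : 'rV[R]_d) : 0 <= sqnorm v.
Proof. by apply: sumr_ge0 => c _; exact: sqr_ge0. Qed.

Lemma phase_sqnormE x : phase_sqnorm x =
  \sum_(c < d) (qof x 0 c ^+ 2 + pof x 0 c ^+ 2 + zof x 0 c ^+ 2).
Proof. by rewrite /phase_sqnorm /sqnorm !big_split. Qed.

Lemma phase_sqnorm_ge0 x : 0 <= phase_sqnorm x.
Proof. by rewrite /phase_sqnorm !addr_ge0// sqnorm_ge0. Qed.

Lemma sqnormD (u v : 'rV[R]_d) : sqnorm (u + v) <= 2 * sqnorm u + 2 * sqnorm v.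
Proof.
rewrite /sqnorm !mulr_sumr -big_split; apply: ler_sum => c _.
by rewrite mxE; exact: sqrD_le.
Qed.

Lemma sqnormN (v : 'rV[R]_d) : sqnorm (- v) = sqnorm v.
Proof. by apply: eq_bigr => c _; rewrite mxE sqrrN. Qed.

Lemma phase_sqnormD x y :
  phase_sqnorm (x + y) <= 2 * phase_sqnorm x + 2 * phase_sqnorm y.
Proof.
rewrite /phase_sqnorm !phaseDE.
have := sqnormD (qof x) (qof y); have := sqnormD (pof x) (pof y).
by have := sqnormD (zof x) (zof y); lra.
Qed.

Lemma phase_sqnormN x : phase_sqnorm (- x) = phase_sqnorm x.
Proof. by rewrite /phase_sqnorm !phaseDE !sqnormN. Qed.

Lemma sqnorm_coord (v : 'rV[R]_d) (c : 'I_d) : v 0 c ^+ 2 <= sqnorm v.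
Proof. by rewrite /sqnorm (bigD1 c)//= lerDl sumr_ge0// => i _; exact: sqr_ge0. Qed.

Lemma sqnorm_phase x : sqnorm (qof x) <= phase_sqnorm x.
Proof. by rewrite /phase_sqnorm -addrA lerDl addr_ge0 ?sqnorm_ge0. Qed.

Lemma sqnorm_pof x : sqnorm (pof x) <= phase_sqnorm x.
Proof. by rewrite /phase_sqnorm addrAC lerDr addr_ge0 ?sqnorm_ge0. Qed.

Lemma sqnorm_zof x : sqnorm (zof x) <= phase_sqnorm x.
Proof. by rewrite /phase_sqnorm lerDr addr_ge0 ?sqnorm_ge0. Qed.

Lemma phase_sqnorm0 : phase_sqnorm (0 : phase R d) = 0.
Proof.
by rewrite phase_sqnormE big1// => i _; rewrite /qof /pof /zof /= !mxE expr0n/= !addr0.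
Qed.

Lemma measurable_phase_sqnorm (dO : measure_display) (T : measurableType dO)
    (X : T -> phase R d) : measurable_fun setT X ->
  measurable_fun setT (fun w => phase_sqnorm (X w)).
Proof.
move=> mX; under eq_fun do rewrite phase_sqnormE.
apply: measurable_sum => c; have [mq mp mz] := measurable_phase_coord c mX.
by do 2 (apply: measurable_funD; last exact: measurable_funX); exact: measurable_funX.
Qed.

End phase_sqnorm.

Definition phase_lyap (R : realType) (d : nat) (be la b : R) (x : phase R d) : R :=
  \sum_(c < d) lyap be la b (qof x 0 c) (pof x 0 c) (zof x 0 c).

(** Force and noise are absent from [lyap_step]: common noise is cancelled beforehand by [stepB],
    and what remains of the forces is counted in the error [rho]. *)
Record lyapunov_bounds (R : realType) (d : nat) (al be la : R)
    (V : phase R d -> R) (m M k C h0 : R) : Prop := LyapunovBounds {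
  lyap_m0 : 0 < m;
  lyap_M0 : 0 < M;
  lyap_k0 : 0 < k;
  lyap_C0 : 0 < C;
  lyap_h0 : 0 < h0;
  lyap_kh : k * h0 <= 1;
  lyap_ge : forall x, m * phase_sqnorm x <= V x;
  lyap_le : forall x, V x <= M * phase_sqnorm x;
  lyap_step : forall h rho x y, 0 < h -> h <= h0 -> 0 <= rho ->
    step al be la h rho 0 x y 0 -> V y <= (1 - k * h) * V x + C * h * rho ^+ 2 }.

(** Only C depends on d, through the sum over coordinates, and its extra 1 makes it positive. The
    other constants are shared because the Gaussian scheme is studied one coordinate at a time, in
    dimension 1, and the solutions in dimension d. *)
Lemma lyapunov_exists (R : realType) (al be la : R) :
  0 < al -> 0 < be -> 0 < la -> exists b m M k h0 : R, forall d, exists C,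
    lyapunov_bounds (d := d) al be la (phase_lyap be la b) m M k C h0.
Proof.
move=> a0 b0 l0.
have [b [m [M [k [C [h0 [[m0 M0 k0] C0 h00 kh [H1 H2]]]]]]]] := lyapunov_step a0 b0 l0.
exists b, m, M, k, h0 => d; exists (d%:R * C + 1); split => //.
- by rewrite ltr_wpDl// mulr_ge0.
- move=> x; rewrite phase_sqnormE mulr_sumr; apply: ler_sum => c _.
  by have [] := H1 (qof x 0 c) (pof x 0 c) (zof x 0 c).
- move=> x; rewrite phase_sqnormE mulr_sumr; apply: ler_sum => c _.
  by have [] := H1 (qof x 0 c) (pof x 0 c) (zof x 0 c).
move=> h rho x y hgt0 hh0 rho0 st.
have -> : (d%:R * C + 1) * h * rho ^+ 2 = \sum_(c < d) (C * h * rho ^+ 2) + h * rho ^+ 2.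
  by rewrite sumr_const card_ord -mulr_natl; ring.
rewrite addrA ler_wpDr//; first by rewrite mulr_ge0 ?sqr_ge0// ltW.
rewrite mulr_sumr -big_split/=; apply: ler_sum => c _.
have [sq sp sz] := st c; apply: H2 => //; first by move: sp; rewrite mxE addr0.
by move: sz; rewrite mxE mulr0 subr0.
Qed.

Section noise_scheme_mean.
Context (R : realType) (d : nat) (al be la b m M k C h0 : R).
Hypothesis HV : lyapunov_bounds (d := 1) al be la (phase_lyap be la b) m M k C h0.

Let imp_phase h j : phase R 1 :=
  (const_mx (impulse al be la h j).1.1, const_mx (impulse al be la h j).1.2,
   const_mx (impulse al be la h j).2).

(** The impulse is a noise-free trajectory started from (0, 0, sqrt 2), where the form is at most 2
    M. It decays geometrically, and h times the geometric sum is at most 1 / k: a discrete version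
    of the finiteness of the stationary variance. *)
Lemma impulse_sqr_sum h n : 0 < h -> h <= h0 ->
  h * \sum_(j < n) ((impulse al be la h j).1.1 ^+ 2 + (impulse al be la h j).1.2 ^+ 2
     + (impulse al be la h j).2 ^+ 2) <= 2 * M / (m * k).
Proof.
move=> h_gt0 hh0; have [m0 M0 k0 C0 h00 kh0 Vge Vle Vst] := HV.
have kh : k * h <= 1 by apply: le_trans kh0; rewrite ler_pM2l.
pose V j := phase_lyap be la b (imp_phase h j).
have VS j : V j.+1 <= (1 - k * h) * V j.
  have st : step al be la h 0 0 (imp_phase h j) (imp_phase h j.+1) 0.
    move=> c; rewrite !mulr0 !normr_le0 /imp_phase /=.
    case: (impulse al be la h j) => [[q p] z].
    by split; rewrite /qof /pof /zof /= !mxE; apply/eqP; ring.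
  by have := Vst _ _ _ _ h_gt0 hh0 (lexx 0) st; rewrite expr0n/= mulr0 addr0.
have V0 : V 0%N <= 2 * M.
  apply: le_trans (Vle _) _; rewrite phase_sqnormE big_ord1 /imp_phase /qof /pof /zof /= !mxE.
  by rewrite expr0n/= !add0r sqr_sqrtr// mulrC.
have VP j : V j <= (1 - k * h) ^+ j * (2 * M).
  elim: j => [|j IH]; first by rewrite expr0 mul1r.
  apply: le_trans (VS j) _; rewrite exprS -mulrA; apply: ler_wpM2l => //.
  by rewrite subr_ge0.
have sumV : \sum_(j < n) h * (1 - k * h) ^+ j <= k^-1.
  have := gronwall_weight_sum n k0 (ltW h_gt0) kh.
  by rewrite [X in _ -> X <= _](reindex_inj rev_ord_inj).
rewrite mulr_sumr.
apply: (@le_trans _ _ (\sum_(j < n) (2 * M / m) * (h * (1 - k * h) ^+ j))).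
  apply: ler_sum => j _.
  have -> : 2 * M / m * (h * (1 - k * h) ^+ j) = h * ((1 - k * h) ^+ j * (2 * M) / m) by ring.
  apply: ler_wpM2l; first exact: ltW.
  rewrite ler_pdivlMr//; apply: le_trans (VP j).
  apply: le_trans (Vge _).
  by rewrite phase_sqnormE big_ord1 /imp_phase /qof /pof /zof /= !mxE mulrC.
rewrite -mulr_sumr.
have -> : 2 * M / (m * k) = 2 * M / m * k^-1 by rewrite invfM; ring.
by apply: ler_wpM2l => //; rewrite divr_ge0 ?mulr_ge0// ltW.
Qed.

(** Orthogonality bounds each squared coordinate in mean by a sum of squared impulses times 16 h,
    the bound on the variance of an increment; 32 is 16 times the 2 of [impulse_sqr_sum]. *)
Lemma noise_scheme_mean (dO : measure_display) (T : measurableType dO)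
    (P : probability T R) (W : R -> T -> 'rV[R]_d) (h : R) (n : nat) :
  (forall t, measurable_fun setT (W t)) -> brownian_motion P W -> 0 < h -> h <= h0 ->
  mean_le P (fun w => phase_sqnorm
     (noise_scheme al be la h ((brownian_increment W h)^~ w) n))
    (d%:R * (32 * M / (m * k))).
Proof.
move=> mW bW h_gt0 hh0.
under [X in mean_le _ X]eq_fun do rewrite phase_sqnormE.
have -> : d%:R * (32 * M / (m * k)) = \sum_(c < d) (32 * M / (m * k)).
  by rewrite sumr_const card_ord mulr_natl.
apply: (mean_le_sum (index_enum 'I_d)) => c.
have lin (a : nat -> R) : mean_le P
   (fun w => (\sum_(j < n) a (n - j.+1)%N * brownian_increment W h j w 0 c) ^+ 2)
   (\sum_(j < n) a (n - j.+1)%N ^+ 2 * (16 * h)).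
  apply: mean_le_orthogonal_sum => [j|j|j l jl].
  - by apply: measurable_funM => //; exact: measurable_brownian_increment.
  - under [X in mean_le _ X]eq_fun do rewrite exprMn.
    by apply: mean_leZ; [exact: sqr_ge0|exact: brownian_increment_sqr].
  - have iBB := mean_le_mul_integrable (measurable_brownian_increment h mW j c)
      (measurable_brownian_increment h mW l c) (brownian_increment_sqr mW bW h_gt0 j c)
      (brownian_increment_sqr mW bW h_gt0 l c).
    transitivity (\int[P]_w ((a (n - j.+1)%N * a (n - l.+1)%N)%:E *
       (brownian_increment W h j w 0 c * brownian_increment W h l w 0 c)%:E))%E.
      by apply: eq_integral => w _; rewrite -EFinM; congr EFin; ring.
    by rewrite integralZl// brownian_increment_orthogonal// mule0.
have [lq lp lz] := And3 (lin (fun j => (impulse al be la h j).1.1))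
  (lin (fun j => (impulse al be la h j).1.2)) (lin (fun j => (impulse al be la h j).2)).
have := mean_leD (mean_leD lq lp) lz.
rewrite -!big_split/= => H.
apply: (@mean_leW _ _ _ _ _ (16 * (h * \sum_(j < n) ((impulse al be la h j).1.1 ^+ 2 +
   (impulse al be la h j).1.2 ^+ 2 + (impulse al be la h j).2 ^+ 2)))).
  have -> : 32 * M / (m * k) = 16 * (2 * M / (m * k)) by ring.
  by apply: ler_wpM2l => //; exact: impulse_sqr_sum.
rewrite (_ : 16 * _ = \sum_(j < n)
   ((impulse al be la h (n - j.+1)).1.1 ^+ 2 * (16 * h) +
      (impulse al be la h (n - j.+1)).1.2 ^+ 2 * (16 * h) +
      (impulse al be la h (n - j.+1)).2 ^+ 2 * (16 * h))).
  congr (mean_le _ _ _): H; apply/funext => w.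
  by have [-> -> ->] := noise_scheme_impulse al be la h ((brownian_increment W h)^~ w) n c.
rewrite !mulr_sumr (reindex_inj rev_ord_inj)/=.
by apply: eq_bigr => j _; ring.
Qed.

End noise_scheme_mean.

(** * Tracking a path by a scheme *)

Definition oscillation_le (R : realType) (U : pseudoMetricType R) (x : R -> U)
    (T e : R) (n : nat) : Prop := (0 < n)%N /\
  forall j s, (j < n)%N -> j%:R * (T / n%:R) <= s <= j.+1%:R * (T / n%:R) ->
    ball (x (j%:R * (T / n%:R))) e (x s).

Lemma partition_oscillation (R : realType) (U : pseudoMetricType R) (x : R -> U)
    (T e : R) : {within [set t : R | 0 <= t], continuous x} -> 0 < T -> 0 < e ->
  exists n0, forall n, (n0 <= n)%N -> oscillation_le x T e n.
Proof.
move=> cx T0 e0; have [r r0 H] := heine T cx e0.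
exists (Num.truncn (T / r)).+1 => n /(mesh_lt r0)[nR hr].
split=> [|j]; first by rewrite -(ltr0n R).
move=> s jn /andP[js sj].
have h0 : 0 < T / n%:R by rewrite divr_gt0.
have jT : j.+1%:R * (T / n%:R) <= T.
  by rewrite mulrCA ger_pMr// ler_pdivrMr// mul1r ler_nat.
have j0 : 0 <= j%:R * (T / n%:R) by rewrite mulr_ge0// ltW.
rewrite -natr1 mulrDl mul1r in sj jT.
apply: H; rewrite ?j0 ?(le_trans j0 js) ?(le_trans sj jT) ?(le_trans js (le_trans sj jT))//.
by rewrite distrC ger0_norm ?subr_ge0// ltrBlDr addrC (le_lt_trans sj)// ltrD2l.
Qed.

Lemma sqnorm_ball (R : realType) (d : nat) (x y : phase R d) (e : R) :
  ball x e y -> sqnorm (qof y - qof x) <= d%:R * e ^+ 2.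
Proof.
move=> /phase_ball_coord xy; rewrite mulr_natl -[X in _ <= _ *+ X]card_ord -sumr_const.
apply: ler_sum => c _; rewrite !mxE; have [qc _ _] := xy c.
have e0 : 0 <= e := le_trans (normr_ge0 _) (ltW qc).
by rewrite -(real_normK (num_real _)) distrC ler_sqr ?nnegrE// ltW.
Qed.

Section tracking.
Context (R : realType) (d : nat) (al be la : R) (V : phase R d -> R)
  (m M k C h0 : R).
Hypotheses (al0 : 0 < al) (be0 : 0 < be) (la0 : 0 < la)
  (HV : lyapunov_bounds al be la V m M k C h0).

(** The threshold on n depends on the path alone, so one n serves every step j and every scheme y.
    [F] is the force used by the scheme, phi bounds how far the true force strays from it during the
    step, and e absorbs the oscillation of the path. *)
Lemma tracking (x : R -> phase R d) f w (T e : R) :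
  langevin_path al be la x f w -> 0 < T -> 0 < e ->
  exists n0, forall n, (n0 <= n)%N ->
    let h := T / n%:R in
    [/\ (0 < n)%N, h <= h0 & forall j y y' F r phi, (j < n)%N -> 0 <= r -> 0 <= phi ->
      step al be la h r F y y' (w (j.+1%:R * h) - w (j%:R * h)) ->
      (forall s, j%:R * h <= s <= j.+1%:R * h -> sqnorm (f s - F) <= phi) ->
      V (x (j.+1%:R * h) - y') <=
        (1 - k * h) * V (x (j%:R * h) - y) + h * (4 * C * (phi + r ^+ 2) + e)].
Proof.
move=> xP T0 e0; have [m0 M0 k0 C0 h00 kh0 Vge Vle Vst] := HV.
pose La := 1 + al + be + la.
have La0 : 0 < La by rewrite /La !addr_gt0.
have CL0 : 0 < 2 * C * La ^+ 2 by rewrite !mulr_gt0// exprn_gt0.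
have [De De0 /(_ De (ltW De0) (lexx De)) De2] := sqr_small (ltW CL0) e0.
have [n1 H1] := partition_oscillation (proj1 xP) T0 De0.
exists (maxn n1 (Num.truncn (T / h0)).+1) => n; rewrite geq_max => /andP[n1n hn] h.
have [n0 osc] := H1 n n1n; have [nR /ltW hh0] := mesh_lt h00 hn.
have h_gt0 : 0 < h by rewrite divr_gt0.
split=> // j y y' F r phi jn r0 phi0 st fF.
have j0 : 0 <= j%:R * h by rewrite mulr_ge0// ltW.
have jS : j.+1%:R * h = j%:R * h + h by rewrite -natr1 mulrDl mul1r.
have stx : step al be la h (La * De + Num.sqrt phi) F (x (j%:R * h)) (x (j.+1%:R * h))
    (w (j.+1%:R * h) - w (j%:R * h)).
  rewrite jS; apply: langevin_path_step xP j0 _ _ _ _ _; try exact: ltW.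
  - exact: sqrtr_ge0.
  - by move=> s sj; apply: osc; rewrite // jS.
  - move=> s c sj; have := fF s; rewrite jS => /(_ sj) fs.
    have -> : f s 0 c - F 0 c = (f s - F) 0 c by rewrite !mxE.
    rewrite -sqrtr_sqr ler_sqrt//; apply: le_trans fs; exact: sqnorm_coord.
have := stepB stx st; rewrite !subrr => std.
have rho0 : 0 <= La * De + Num.sqrt phi + r.
  by rewrite !addr_ge0 ?sqrtr_ge0// mulr_ge0// ltW.
apply: le_trans (Vst _ _ _ _ h_gt0 hh0 rho0 std) _; rewrite lerD2l.
have -> : C * h * (La * De + Num.sqrt phi + r) ^+ 2 =
   h * (C * (La * De + (Num.sqrt phi + r)) ^+ 2) by rewrite addrA; ring.
apply: ler_wpM2l; first exact: ltW.
have s1 := sqrD_le (La * De) (Num.sqrt phi + r).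
have s2 := sqrD_le (Num.sqrt phi) r; rewrite sqr_sqrtr// in s2.
have s3 : (La * De + (Num.sqrt phi + r)) ^+ 2 <=
   4 * (phi + r ^+ 2) + 2 * (La * De) ^+ 2 by lra.
apply: le_trans (ler_wpM2l (ltW C0) s3) _; rewrite mulrDr.
apply: lerD; first by rewrite mulrCA mulrA.
by apply: le_trans De2; rewrite exprMn; apply: eqW; ring.
Qed.

(** The scheme carries no force here, and that of the path is treated as an error. Its growth in q
    splits into a part in y, kept as a source, and a part in x - y, which the condition on L makes
    at most half of the dissipation; hence the rate k / 2. *)
Lemma tracking_absorb (x : R -> phase R d) f w (T e L c : R) :
  langevin_path al be la x f w -> 0 < T -> 0 < e -> 0 <= L -> 0 <= c ->
  32 * C * L <= k * m ->
  (forall s, 0 <= s <= T -> sqnorm (f s) <= L * sqnorm (qof (x s)) + c) ->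
  exists n0, forall n, (n0 <= n)%N ->
    let h := T / n%:R in
    [/\ (0 < n)%N, h <= h0 & forall j y y' r, (j < n)%N -> 0 <= r ->
      step al be la h r 0 y y' (w (j.+1%:R * h) - w (j%:R * h)) ->
      V (x (j.+1%:R * h) - y') <= (1 - k / 2 * h) * V (x (j%:R * h) - y)
        + h * (4 * C * (4 * L * phase_sqnorm y + c + r ^+ 2) + e)].
Proof.
move=> xP T0 e0 L0 c0 CL fL; have [m0 M0 k0 C0 h00 kh0 Vge Vle Vst] := HV.
have e20 : 0 < e / 2 by rewrite divr_gt0.
have K0 : 0 <= 8 * C * L * d%:R by rewrite !mulr_ge0// ltW.
have [De De0 /(_ De (ltW De0) (lexx De)) De2] := sqr_small K0 e20.
have [n1 H1] := partition_oscillation (proj1 xP) T0 De0.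
have [n2 H2] := tracking xP T0 e20.
exists (maxn n1 n2) => n; rewrite geq_max => /andP[/H1[n0 osc] /H2].
set h := T / n%:R => -[_ hh0 tr]; split=> // j y y' r jn r0 st.
have nR : 0 < n%:R :> R by rewrite ltr0n.
have h_gt0 : 0 < h by rewrite divr_gt0.
have j0 : 0 <= j%:R * h by rewrite mulr_ge0// ltW.
have jT : j.+1%:R * h <= T by rewrite mulrCA ger_pMr// ler_pdivrMr// mul1r ler_nat.
pose ex := x (j%:R * h) - y.
pose phi := L * (4 * phase_sqnorm ex + 4 * phase_sqnorm y + 2 * (d%:R * De ^+ 2)) + c.
have phi0 : 0 <= phi.
  have := phase_sqnorm_ge0 ex; have := phase_sqnorm_ge0 y => y0 ex0.
  by rewrite /phi addr_ge0// mulr_ge0// !addr_ge0// mulr_ge0// mulr_ge0// sqr_ge0.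
have := tr j y y' 0 r phi jn r0 phi0 st; rewrite -/ex => H.
apply: le_trans (H _) _.
  move=> s /andP[js sj]; rewrite subr0.
  apply: le_trans (fL s _) _; first by rewrite (le_trans j0 js) (le_trans sj jT).
  rewrite lerD2r; apply: ler_wpM2l => //.
  have /sqnorm_ball b1 : ball (x (j%:R * h)) De (x s) by apply: osc; rewrite // js.
  have -> : qof (x s) = (qof ex + qof y) + (qof (x s) - qof (x (j%:R * h))).
    by rewrite /ex phaseDE subrK addrC subrK.
  have := sqnormD (qof ex + qof y) (qof (x s) - qof (x (j%:R * h))).
  have := sqnormD (qof ex) (qof y); have := sqnorm_phase ex; have := sqnorm_phase y.
  by lra.
have V1 : 16 * C * L * phase_sqnorm ex <= k / 2 * V ex.
  apply: (@le_trans _ _ (k / 2 * (m * phase_sqnorm ex))).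
    have := ler_wpM2r (phase_sqnorm_ge0 ex) CL; lra.
  by apply: ler_wpM2l => //; rewrite divr_ge0// ltW.
rewrite -subr_ge0.
have -> : (1 - k / 2 * h) * V ex + h * (4 * C * (4 * L * phase_sqnorm y + c + r ^+ 2) + e)
   - ((1 - k * h) * V ex + h * (4 * C * (phi + r ^+ 2) + e / 2)) =
   h * ((k / 2 * V ex - 16 * C * L * phase_sqnorm ex) +
     (e / 2 - 8 * C * L * d%:R * De ^+ 2)) by rewrite /phi; field.
by apply: mulr_ge0; [exact: ltW|apply: addr_ge0; rewrite subr_ge0].
Qed.

End tracking.

(** * Lipschitz maps in squared norms *)

Section lipschitz.
Context (R : realType) (d : nat).

Lemma lipschitz_sqnorm (L : R) (A : 'rV[R]_d -> 'rV[R]_d) : 0 <= L ->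
  lipschitz_map L A -> forall u v, sqnorm (A u - A v) <= L ^+ 2 * sqnorm (u - v).
Proof.
move=> L0 LA u v; have := LA u v; rewrite /enorm => H.
rewrite -[sqnorm (A u - A v)]sqr_sqrtr ?sqnorm_ge0//.
rewrite -[sqnorm (u - v)]sqr_sqrtr ?sqnorm_ge0// -exprMn.
by rewrite ler_sqr ?nnegrE ?mulr_ge0 ?sqrtr_ge0.
Qed.

Lemma lipschitz_sqnorm_le (L : R) (A : 'rV[R]_d -> 'rV[R]_d) : 0 <= L ->
  lipschitz_map L A -> forall u, sqnorm (A u) <= 2 * L ^+ 2 * sqnorm u + 2 * sqnorm (A 0).
Proof.
move=> L0 LA u; have := lipschitz_sqnorm L0 LA u 0; rewrite subr0.
have := sqnormD (A u - A 0) (A 0); rewrite subrK; lra.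
Qed.

Lemma odd_lipschitz_sqnorm (L : R) (B : 'rV[R]_d -> 'rV[R]_d) : 0 <= L ->
  lipschitz_map L B -> odd_map B -> forall u, sqnorm (B u) <= L ^+ 2 * sqnorm u.
Proof.
move=> L0 LB oB u; have := lipschitz_sqnorm L0 LB u 0.
have -> : B 0 = 0.
  apply/rowP => c; have /rowP/(_ c) := oB 0; rewrite oppr0 !mxE => H.
  by lra.
by rewrite !subr0.
Qed.

Lemma lipschitz_measurable (L : R) (A : 'rV[R]_d -> 'rV[R]_d) (c : 'I_d) : 0 <= L ->
  lipschitz_map L A -> measurable_fun setT (fun v => A v 0 c).
Proof.
move=> L0 LA; apply: continuous_measurable_rV => v W /= /nbhs_ballP[e /= e0 eW].
pose K := L ^+ 2 * d%:R.
have K0 : 0 <= K by rewrite mulr_ge0 ?sqr_ge0.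
have K1 : 0 < K + 1 by rewrite ltr_wpDl.
apply/nbhs_ballP; exists (e / (K + 1)) => /=; first by rewrite divr_gt0.
move=> v' [r0 vv']; apply: eW; rewrite /ball/=.
have := lipschitz_sqnorm L0 LA v v'.
move/(le_trans (sqnorm_coord _ c)); rewrite !mxE => H.
have H2 : sqnorm (v - v') <= d%:R * (e / (K + 1)) ^+ 2.
  rewrite mulr_natl -[X in _ <= _ *+ X]card_ord -sumr_const.
  apply: ler_sum => c' _; rewrite !mxE -(real_normK (num_real _)).
  have b : `|v 0 c' - v' 0 c'| < e / (K + 1) := vv' 0 c'.
  by rewrite ler_sqr ?nnegrE// ltW// (le_lt_trans _ b).
have H3 : `|A v 0 c - A v' 0 c| ^+ 2 <= K * (e / (K + 1)) ^+ 2.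
  rewrite real_normK ?num_real//; apply: le_trans H _.
  by rewrite /K -mulrA; apply: ler_wpM2l => //; exact: sqr_ge0.
rewrite -(@ltr_pXn2r _ 2)// ?nnegrE ?ltW//.
apply: le_lt_trans H3 _; rewrite exprMn mulrCA gtr_pMr ?exprn_gt0// exprVn.
rewrite ltr_pdivrMr ?exprn_gt0// mul1r.
have : 0 <= K ^+ 2 by exact: sqr_ge0.
by rewrite sqrrD1 mulr2n; lra.
Qed.

End lipschitz.

(** * Jensen's inequality and the mean field *)

Section jensen.
Context (R : realType) (dO : measure_display) (T : measurableType dO)
  (P : probability T R).

Lemma integrable_cstP (r : R) : P.-integrable setT (EFin \o cst r).
Proof.
apply: (@sqr_integrable_integrable R _ _ P (cst r) (r ^+ 2)) => //.
exact: mean_le_cst (sqr_ge0 r).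
Qed.

Lemma Rintegral_cstP (r : R) : \int[P]_w (cst r w) = r.
Proof. by rewrite Rintegral_cst//= probability_setT mulr1. Qed.

Lemma mean_le_fine (f : T -> R) (K : R) : mean_le P f K ->
  exists2 L, (\int[P]_w (f w)%:E)%E = L%:E & L <= K.
Proof.
move=> fK; have [mf f0 le] := fK.
exists (fine (\int[P]_w (f w)%:E)).
  rewrite fineK// ge0_fin_numE; first exact: le_lt_trans le (ltry _).
  by apply: integral_ge0 => w _; rewrite lee_fin.
rewrite -lee_fin fineK// ge0_fin_numE; first exact: le_lt_trans le (ltry _).
by apply: integral_ge0 => w _; rewrite lee_fin.
Qed.

(** Jensen's inequality, by integrating the tangent-line bound 2 y Y - y^2 <= Y^2 at the mean y. *)
Lemma Rintegral_sqr_le (Y : T -> R) (K : R) : measurable_fun setT Y ->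
  mean_le P (fun w => Y w ^+ 2) K -> (\int[P]_w Y w) ^+ 2 <= K.
Proof.
move=> mY YK; have iY := sqr_integrable_integrable mY YK.
have [L YL LK] := mean_le_fine YK; apply: le_trans LK.
set y := \int[P]_w Y w.
have iYY : P.-integrable setT (EFin \o (fun w => Y w ^+ 2)).
  have := mean_le_mul_integrable mY mY YK YK.
  by under eq_fun do rewrite -expr2.
have iyY : P.-integrable setT (EFin \o (fun w => 2 * y * Y w)).
  have := integrableZl measurableT (2 * y) iY.
  by rewrite /comp; under eq_fun do rewrite -EFinM.
have := @le_Rintegral _ _ _ P setT (fun w => 2 * y * Y w - cst (y ^+ 2) w)
   (fun w => Y w ^+ 2) measurableT.
rewrite RintegralB//; last exact: integrable_cstP.
rewrite RintegralZl// Rintegral_cstP -/y [X in _ <= X]/Rintegral YL /=.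
have -> : 2 * y * y - y ^+ 2 = y ^+ 2 by ring.
apply=> //.
- have := integrableB measurableT iyY (integrable_cstP (y ^+ 2)).
  by rewrite /comp; under eq_fun do rewrite -EFinB.
- move=> w _; rewrite -subr_ge0 /cst.
  have -> : Y w ^+ 2 - (2 * y * Y w - y ^+ 2) = (Y w - y) ^+ 2 by ring.
  exact: sqr_ge0.
Qed.

Lemma row_Rintegral_sqnorm_le (d : nat) (Y : T -> 'rV[R]_d) (K : R) :
  (forall c, measurable_fun setT (fun w => Y w 0 c)) ->
  mean_le P (fun w => sqnorm (Y w)) K ->
  sqnorm (\row_c \int[P]_w (Y w 0 c)) <= K.
Proof.
move=> mY YK.
have mY2 c : measurable_fun setT (fun w => Y w 0 c ^+ 2) by exact: measurable_funX.
have Yc c : mean_le P (fun w => Y w 0 c ^+ 2) K.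
  apply: mean_le_dom YK _ _ _ => //; first by move=> w; exact: sqr_ge0.
  by apply: aeW => w; exact: sqnorm_coord.
have [L YL LK] := mean_le_fine YK; apply: le_trans LK.
rewrite -lee_fin -YL /sqnorm.
under eq_integral do rewrite -sumEFin.
rewrite ge0_integral_sum//; last 2 first.
  - by move=> c; exact/measurable_EFinP.
  - by move=> c w _; rewrite lee_fin sqr_ge0.
rewrite -sumEFin; apply: lee_sum => c _; rewrite mxE.
have [Lc YcL LcK] := mean_le_fine (Yc c).
rewrite YcL lee_fin; apply: Rintegral_sqr_le => //.
by split=> //; [move=> w; exact: sqr_ge0|rewrite YcL].
Qed.

End jensen.

Section convolution.
Context (R : realType) (d : nat) (B : 'rV[R]_d -> 'rV[R]_d) (CB : R).
Hypotheses (CB0 : 0 <= CB) (LB : lipschitz_map CB B) (oB : odd_map B).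

Section one_law.
Context (dO : measure_display) (T : measurableType dO) (P : probability T R)
  (X : {RV P >-> phase R d}) (mu : probability (phase R d) R) (U : R).
Hypotheses (XU : mean_le P (fun w => phase_sqnorm (X w)) U) (Xmu : has_law X mu).

Lemma measurable_interaction (dO' : measure_display) (T' : measurableType dO')
    (u v : T' -> phase R d) (c : 'I_d) :
  measurable_fun setT u -> measurable_fun setT v ->
  measurable_fun setT (fun w => B (qof (u w) - qof (v w)) 0 c).
Proof.
move=> mu' mv; apply: (measurableT_comp (lipschitz_measurable c CB0 LB)).
apply: measurable_rVP => c'; under eq_fun do rewrite !mxE.
have [mq _ _] := measurable_phase_coord c' mu'.
have [mq' _ _] := measurable_phase_coord c' mv.
exact: measurable_funB.
Qed.

Lemma measurable_shift_interaction (dO' : measure_display) (T' : measurableType dO')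
    (q : 'rV[R]_d) (v : T' -> phase R d) (c : 'I_d) :
  measurable_fun setT v -> measurable_fun setT (fun w => B (q - qof (v w)) 0 c).
Proof. by move=> mv; exact: (@measurable_interaction _ _ (fun=> (q, 0, 0)) v). Qed.

Lemma interaction_mean q : mean_le P (fun w => sqnorm (B (q - qof (X w))))
  (2 * CB ^+ 2 * (sqnorm q + U)).
Proof.
have -> : 2 * CB ^+ 2 * (sqnorm q + U) =
    2 * CB ^+ 2 * sqnorm q + 2 * CB ^+ 2 * U by ring.
have c20 : 0 <= 2 * CB ^+ 2 by rewrite mulr_ge0 ?sqr_ge0.
have q0 : 0 <= 2 * CB ^+ 2 * sqnorm q by rewrite mulr_ge0 ?sqnorm_ge0.
apply: mean_le_dom (mean_leD (mean_le_cst P q0) (mean_leZ c20 XU)) _ _ _.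
- apply: measurable_sum => c; apply: measurable_funX.
  by apply: measurable_shift_interaction; exact: measurable_funPT.
- by move=> w; exact: sqnorm_ge0.
- apply: aeW => w; apply: le_trans (odd_lipschitz_sqnorm CB0 LB oB _) _.
  have := sqnormD q (- qof (X w)); rewrite sqnormN => h.
  have := sqnorm_phase (X w) => h2.
  have -> : 2 * CB ^+ 2 * sqnorm q + 2 * CB ^+ 2 * phase_sqnorm (X w) =
    CB ^+ 2 * (2 * sqnorm q + 2 * phase_sqnorm (X w)) by ring.
  by apply: ler_wpM2l; [exact: sqr_ge0|lra].
Qed.

Lemma interaction_integrable q c :
  P.-integrable setT (EFin \o (fun w => B (q - qof (X w)) 0 c)).
Proof.
have mB : measurable_fun setT (fun w => B (q - qof (X w)) 0 c).
  by apply: measurable_shift_interaction; exact: measurable_funPT.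
apply: (sqr_integrable_integrable mB).
apply: mean_le_dom (interaction_mean q) _ _ _; first exact: measurable_funX.
- by move=> w; exact: sqr_ge0.
- by apply: aeW => w; exact: sqnorm_coord.
Qed.

Lemma convolE q : convol B mu q = \row_c \int[P]_w (B (q - qof (X w)) 0 c).
Proof.
apply/rowP => c; rewrite !mxE /Rintegral; congr fine.
pose f (x : phase R d) := (B (q - qof x) 0 c)%:E.
transitivity (\int[distribution P X]_x f x)%E.
  by apply: eq_measure_integral => A mA _; exact: esym (Xmu mA).
apply: integral_distribution; last exact: interaction_integrable.
by apply/measurable_EFinP; apply: measurable_shift_interaction; exact: measurable_id.
Qed.

Lemma convol_bound q : sqnorm (convol B mu q) <= 2 * CB ^+ 2 * (sqnorm q + U).
Proof.
rewrite convolE; apply: row_Rintegral_sqnorm_le; last exact: interaction_mean.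
by move=> c; apply: measurable_shift_interaction; exact: measurable_funPT.
Qed.

End one_law.

(** Any coupling of the two laws bounds the difference of the convolutions. It is applied to a
    single process, at one time for regularity in q and at two times for regularity in t. *)
Lemma convol_sub (dO : measure_display) (T : measurableType dO) (P : probability T R)
    (X X' : {RV P >-> phase R d}) (mu mu' : probability (phase R d) R) (U U' K : R)
    (q q' : 'rV[R]_d) :
  mean_le P (fun w => phase_sqnorm (X w)) U -> has_law X mu ->
  mean_le P (fun w => phase_sqnorm (X' w)) U' -> has_law X' mu' ->
  mean_le P (fun w => sqnorm ((q - qof (X w)) - (q' - qof (X' w)))) K ->
  sqnorm (convol B mu q - convol B mu' q') <= CB ^+ 2 * K.
Proof.
move=> XU Xmu XU' Xmu' XK.
rewrite (convolE XU Xmu) (convolE XU' Xmu').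
have mX : measurable_fun setT X by exact: measurable_funPT.
have mX' : measurable_fun setT X' by exact: measurable_funPT.
pose Y w := B (q - qof (X w)) - B (q' - qof (X' w)).
have mY c : measurable_fun setT (fun w => Y w 0 c).
  by under eq_fun do rewrite !mxE; apply: measurable_funB; exact: measurable_shift_interaction.
have -> : \row_c \int[P]_w B (q - qof (X w)) 0 c - \row_c \int[P]_w B (q' - qof (X' w)) 0 c
    = \row_c \int[P]_w (Y w 0 c).
  apply/rowP => c; rewrite !mxE -RintegralB//.
  - by apply: eq_Rintegral => w _; rewrite !mxE.
  - exact: interaction_integrable XU _ _.
  - exact: interaction_integrable XU' _ _.
apply: row_Rintegral_sqnorm_le => //.
apply: mean_le_dom (mean_leZ (sqr_ge0 CB) XK) _ _ _.
- by apply: measurable_sum => c; exact: measurable_funX.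
- by move=> w; exact: sqnorm_ge0.
- by apply: aeW => w; exact: lipschitz_sqnorm.
Qed.

End convolution.

(** * Second moments *)

(** Supplies the sample path that serves as reference for the first moment bound. *)
Lemma ae_nonempty (R : realType) (dO : measure_display) (T : measurableType dO)
    (P : probability T R) (Q : T -> Prop) : {ae P, forall w, Q w} -> exists w, Q w.
Proof.
move=> aeQ; apply: contrapT => nQ.
have : P.-negligible setT.
  by apply: negligibleS aeQ => w _ /= Qw; apply: nQ; exists w.
move=> /(negligibleP P measurableT) /=; rewrite probability_setT => /eqP.
by rewrite onee_eq0.
Qed.

Lemma continuous_sqnorm (R : realType) (d : nat) : continuous (@sqnorm R d).
Proof.
apply: continuous_big; first exact: add_continuous.
move=> c _ u.
apply: (@continuous_comp _ _ _ (fun v : 'rV[R]_d => v 0 c) (fun r : R => r ^+ 2)).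
  exact: coord_continuous.
exact: exprn_continuous.
Qed.

Lemma continuous_phase_sqnorm (R : realType) (d : nat) : continuous (@phase_sqnorm R d).
Proof.
have C (g : phase R d -> 'rV[R]_d) : continuous g -> continuous (fun x => sqnorm (g x)).
  move=> cg x; apply: (@continuous_comp _ _ _ g (@sqnorm R d)); first exact: cg.
  exact: continuous_sqnorm.
move=> x; apply: cvgD; last exact: (C _ (@continuous_zof R d)).
by apply: cvgD; [exact: (C _ (@continuous_qof R d))|exact: (C _ (@continuous_pof R d))].
Qed.

Lemma within_continuous_bounded (R : realType) (U : topologicalType) (g : U -> R)
    (w : R -> U) (T : R) : continuous g ->
  0 <= T -> {within [set t : R | 0 <= t], continuous w} ->
  exists K, forall s, 0 <= s <= T -> g (w s) <= K.
Proof.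
move=> cg T0 cw.
have cgw : {within `[0, T], continuous (fun s => g (w s))}.
  apply: (@within_continuous_comp _ _ _ _ w g); first by move=> v _; exact: cg.
  by apply: continuous_subspaceW cw => s /=; rewrite in_itv/= => /andP[].
have [s0 _ H] := EVT_max T0 cgw.
by exists (g (w s0)) => s sT; apply: H; rewrite in_itv.
Qed.

Lemma subrBB (U : zmodType) (x y z t : U) : x - y - (z - t) = x - z - (y - t).
Proof. by rewrite !opprB addrACA [RHS]addrACA (addrC (- y)). Qed.

Section moments.
Context (R : realType) (d : nat) (al be la b m M k C1 C h0 : R).
Local Notation V := (@phase_lyap R d be la b).
Hypotheses (al0 : 0 < al) (be0 : 0 < be) (la0 : 0 < la)
  (HV1 : lyapunov_bounds (d := 1) al be la (phase_lyap be la b) m M k C1 h0)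
  (HV : lyapunov_bounds al be la V m M k C h0).

Definition noise_bound : R := d%:R * (32 * M / (m * k)).

(** The summands are the three terms of [mean_le_gronwall]: the initial difference, the source
    divided by the rate k / 2, and the cost of returning from the tracked difference to X. [K]
    bounds the squared reference noise; [D0] and [D] are squared norms of the reference at the two
    end times. *)
Definition reference_moment_bound (U0 L c K D0 D : R) : R :=
  4 * M / m * (U0 + D0)
  + 8 * C / m * (4 * L * (2 * noise_bound + 4 * K) + c + 2 * (la + al) ^+ 2 * K)
    / (k / 2)
  + (4 * noise_bound + 4 * D).

Context (dO : measure_display) (Omega : measurableType dO) (P : probability Omega R)
  (X0 : {RV P >-> phase R d}) (W : R -> {RV P >-> 'rV[R]_d})
  (X : R -> {RV P >-> phase R d}) (U0 : R).
Hypotheses (bW : brownian_motion P W) (mX0 : mean_le P (fun w => phase_sqnorm (X0 w)) U0).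

(** Subtracting this curve from the Gaussian scheme makes the increments match those of [W - ws].
    The noise [ws] is a single sample, so it is bounded by its size on the interval and not by a
    variance. *)
Definition noise_phase (v : 'rV[R]_d) : phase R d := (0, 0, Num.sqrt 2 *: v).

Lemma noise_phase_sqnorm v : phase_sqnorm (noise_phase v) = 2 * sqnorm v.
Proof.
rewrite phase_sqnormE /noise_phase /qof /pof /zof /sqnorm mulr_sumr /=.
by apply: eq_bigr => c _; rewrite !mxE exprMn sqr_sqrtr// expr0n/= !add0r.
Qed.

Lemma noise_phase_step h v v' K : 0 <= h -> sqnorm v <= K ->
  step al be la h ((la + al) * Num.sqrt (2 * K)) 0 (noise_phase v) (noise_phase v')
    (v' - v).
Proof.
move=> h_ge0 vK c.
have s0 := sqrtr_ge0 (2 * K).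
have la_al : 0 <= la + al by rewrite addr_ge0 ?ltW.
have vc : `|Num.sqrt 2 * v 0 c| <= Num.sqrt (2 * K).
  rewrite -sqrtr_sqr ler_sqrt ?mulr_ge0 ?(le_trans (sqnorm_ge0 v) vK)//.
  rewrite exprMn sqr_sqrtr//; apply: ler_wpM2l => //.
  exact: le_trans (sqnorm_coord v c) vK.
rewrite /noise_phase /qof /pof /zof /= !mxE; split.
- by rewrite mulr0 !subr0 normr0 !mulr_ge0.
- rewrite (_ : _ - _ = - (h * (la * (Num.sqrt 2 * v 0 c)))); last by ring.
  rewrite normrN normrM ger0_norm// ler_wpM2l// normrM (gtr0_norm la0).
  by apply: ler_pM => //; [exact: ltW|rewrite lerDl ltW].
- rewrite (_ : _ - _ = h * (al * (Num.sqrt 2 * v 0 c))); last by ring.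
  rewrite normrM ger0_norm// ler_wpM2l// normrM (gtr0_norm al0).
  by apply: ler_pM => //; [exact: ltW|rewrite lerDr ltW].
Qed.

(* The reference [xs] is a fixed sample path when no moment is known yet, and [0]
   afterwards. *)
Lemma reference_moment (f : R -> Omega -> 'rV[R]_d) (t L c K : R)
    (xs : R -> phase R d) (fs ws : R -> 'rV[R]_d) :
  0 < t -> 0 <= L -> 0 <= c -> 0 <= K -> 32 * C * L <= k * m -> ws 0 = 0 ->
  (forall s, 0 <= s <= t -> sqnorm (ws s) <= K) ->
  {ae P, forall w, [/\ X 0 w = X0 w,
    langevin_path al be la (fun s => X s w - xs s) (fun s => f s w - fs s)
      (fun s => W s w - ws s)
    & forall s, 0 <= s <= t ->
        sqnorm (f s w - fs s) <= L * sqnorm (qof (X s w - xs s)) + c]} ->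
  mean_le P (fun w => phase_sqnorm (X t w)) (reference_moment_bound U0 L c K
    (phase_sqnorm (xs 0)) (phase_sqnorm (xs t - noise_phase (ws t)))).
Proof.
move=> t0 L0 c0 K0 CL ws0 wsK good; have [m0 M0 k0 C0 h00 kh0 Vge Vle Vst] := HV.
pose g n j w := noise_scheme al be la (t / n%:R)
  ((brownian_increment W (t / n%:R))^~ w) j.
pose Cst := 8 * C / m.
have Cst0 : 0 <= Cst by rewrite divr_ge0 ?mulr_ge0// ltW.
pose r := (la + al) * Num.sqrt (2 * K).
have r0 : 0 <= r by rewrite mulr_ge0 ?sqrtr_ge0 ?addr_ge0 ?ltW.
have r2 : r ^+ 2 = 2 * (la + al) ^+ 2 * K.
  by rewrite exprMn sqr_sqrtr ?mulr_ge0//; ring.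
pose y n j w := g n j w - noise_phase (ws (j%:R * (t / n%:R))).
pose n1 := (Num.truncn (t / h0)).+1.
have hn n : (n1 <= n)%N -> 0 < t / n%:R /\ t / n%:R <= h0.
  by move=> /(mesh_lt h00)[nR /ltW]; rewrite divr_gt0.
have gK n j : (n1 <= n)%N -> mean_le P (fun w => phase_sqnorm (g n j w)) noise_bound.
  by move=> /hn[h1 h2]; apply: (noise_scheme_mean HV1).
(* The factor 2 / m turns the lower bound on the form into 2 |x|^2 <= S, as needed to split X into
   the tracked difference and the rest. *)
pose S n j w := 2 / m * V (X (j%:R * (t / n%:R)) w - xs (j%:R * (t / n%:R)) - y n j w).
pose S0 w := 4 * M / m * (phase_sqnorm (X0 w) + phase_sqnorm (xs 0)).
pose G n j w := Cst * (4 * L * (2 * phase_sqnorm (g n j w) + 4 * K) + c + r ^+ 2).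
pose H n w := 4 * phase_sqnorm (g n n w) + 4 * phase_sqnorm (xs t - noise_phase (ws t)).
rewrite /reference_moment_bound -r2 -/Cst.
have k20 : 0 < k / 2 by rewrite divr_gt0.
have KL0 : 0 <= L * K by rewrite mulr_ge0.
apply: (@mean_le_gronwall _ _ _ P (k / 2) t _ _ _ n1 S S0 _ G H) => //.
- exact: ltW.
- by apply: measurable_phase_sqnorm; exact: measurable_funPT.
- by move=> w; exact: phase_sqnorm_ge0.
- apply: mean_leZ; first by rewrite divr_ge0 ?mulr_ge0// ltW.
  by apply: mean_leD => //; apply: mean_le_cst; exact: phase_sqnorm_ge0.
- move=> n j n1n _; apply: mean_leZ => //.
  apply: mean_leD; last by apply: mean_le_cst; exact: sqr_ge0.
  apply: mean_leD; last exact: mean_le_cst.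
  apply: mean_leZ; first by rewrite mulr_ge0.
  apply: mean_leD; last by apply: mean_le_cst; rewrite mulr_ge0.
  by apply: mean_leZ => //; exact: gK.
- move=> n n1n; apply: mean_leD; first by apply: mean_leZ => //; exact: gK.
  by apply: mean_le_cst; rewrite mulr_ge0 ?phase_sqnorm_ge0.
apply: filterS good => w [Xw0 xP fL] e e0.
have em0 : 0 < m / 2 * e by rewrite mulr_gt0// divr_gt0.
have [n0 trk] := tracking_absorb al0 be0 la0 HV xP t0 em0 L0 c0 CL fL.
exists (maxn n0 n1) => n; rewrite geq_max => /andP[/trk[npos hh0 rec] /hn[h_gt0 _]].
have nR : 0 < n%:R :> R by rewrite ltr0n.
have ends : n%:R * (t / n%:R) = t by rewrite mulrC divfK// gt_eqF.
split.
- rewrite /S /y mul0r ws0 /g /= Xw0.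
  have -> : noise_phase 0 = 0 by rewrite /noise_phase scaler0.
  rewrite !subr0 /S0.
  apply: le_trans (ler_wpM2l _ (Vle _)) _; first by rewrite divr_ge0 ?ltW.
  have := phase_sqnormD (X0 w) (- xs 0); rewrite phase_sqnormN => hD.
  have -> : 4 * M / m * (phase_sqnorm (X0 w) + phase_sqnorm (xs 0)) =
    2 / m * (M * (2 * phase_sqnorm (X0 w) + 2 * phase_sqnorm (xs 0))) by ring.
  apply: ler_wpM2l; first by rewrite divr_ge0 ?ltW.
  by apply: ler_wpM2l => //; exact: ltW.
- move=> j jn.
  have j0 : 0 <= j%:R * (t / n%:R) by rewrite mulr_ge0// ltW.
  have jT : j%:R * (t / n%:R) <= t.
    by rewrite mulrCA ger_pMr// ler_pdivrMr// mul1r ler_nat ltnW.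
  have wj : sqnorm (ws (j%:R * (t / n%:R))) <= K by apply: wsK; rewrite j0.
  have st : step al be la (t / n%:R) r 0 (y n j w) (y n j.+1 w)
     (W (j.+1%:R * (t / n%:R)) w - ws (j.+1%:R * (t / n%:R)) -
      (W (j%:R * (t / n%:R)) w - ws (j%:R * (t / n%:R)))).
    have := stepB (noise_scheme_step al be la (t / n%:R)
      ((brownian_increment W (t / n%:R))^~ w) j)
      (noise_phase_step (ws (j.+1%:R * (t / n%:R))) (ltW h_gt0) wj).
    rewrite add0r subr0 /brownian_increment.
    by rewrite subrBB.
  have := rec j _ _ r jn r0 st.
  rewrite -(ler_pM2l (divr_gt0 (ltr0n _ 2) m0)) -/(S n j.+1 w) => hrec.
  apply: le_trans hrec _; rewrite mulrDr.
  have -> : 2 / m * ((1 - k / 2 * (t / n%:R)) * V (X (j%:R * (t / n%:R)) w -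
      xs (j%:R * (t / n%:R)) - y n j w)) = (1 - k / 2 * (t / n%:R)) * S n j w.
    by rewrite /S; ring.
  rewrite lerD2l.
  have -> : 2 / m * (t / n%:R * (4 * C * (4 * L * phase_sqnorm (y n j w) + c + r ^+ 2) +
      m / 2 * e)) = t / n%:R * (Cst * (4 * L * phase_sqnorm (y n j w) + c + r ^+ 2) + e).
    by rewrite /Cst; field; rewrite !gt_eqF.
  apply: ler_wpM2l; first exact: ltW.
  rewrite lerD2r; apply: ler_wpM2l => //; rewrite !lerD2r; apply: ler_wpM2l.
    by rewrite mulr_ge0.
  have := phase_sqnormD (g n j w) (- noise_phase (ws (j%:R * (t / n%:R)))).
  by rewrite phase_sqnormN noise_phase_sqnorm -/(y n j w); lra.
- have e1 : 2 * phase_sqnorm (X t w - xs t - y n n w) <= S n n w.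
    rewrite /S ends mulrAC ler_pdivlMr// -mulrA ler_pM2l// mulrC.
    exact: Vge.
  have := phase_sqnormD (X t w - xs t - y n n w)
     (g n n w + (xs t - noise_phase (ws t))).
  have -> : X t w - xs t - y n n w + (g n n w + (xs t - noise_phase (ws t))) = X t w.
    rewrite /y ends; move: (g n n w) (noise_phase _) (xs t) => a1 a2 a3.
    by rewrite (addrCA a1) (addrC a3) addrA subrK subrK.
  have := phase_sqnormD (g n n w) (xs t - noise_phase (ws t)).
  by rewrite /H; have := ltW e0; lra.
Qed.

End moments.

(** * The nonlinear process *)

Lemma law_mean_le (R : realType) (d : nat) (dO : measure_display)
    (Omega : measurableType dO) (P : probability Omega R) (Y : {RV P >-> phase R d})
    (nu : probability (phase R d) R) : has_law Y nu -> finite_second_moment nu ->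
  mean_le P (fun w => phase_sqnorm (Y w)) (fine (\int[nu]_x (phase_sqnorm x)%:E)).
Proof.
move=> Ynu fin; split.
- by apply: measurable_phase_sqnorm; exact: measurable_funPT.
- by move=> w; exact: phase_sqnorm_ge0.
rewrite fineK ?ge0_fin_numE//; last first.
  by apply: integral_ge0 => x _; rewrite lee_fin phase_sqnorm_ge0.
have mE : measurable_fun setT (fun x : phase R d => (phase_sqnorm x)%:E).
  by apply/measurable_EFinP; exact: (measurable_phase_sqnorm (@measurable_id _ _ setT)).
have := @ge0_integral_distribution _ _ _ _ _ P Y _ mE.
move=> /(_ (fun x => _)); rewrite /comp => <-; last first.
  by move=> x; rewrite lee_fin phase_sqnorm_ge0.
apply: eqW.
by apply: eq_measure_integral => U mU _; exact: Ynu.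
Qed.

Lemma sqr_sum_le (R : realType) (n : nat) (a : 'I_n -> R) :
  (\sum_(j < n) a j) ^+ 2 <= n%:R * \sum_(j < n) a j ^+ 2.
Proof.
have -> : n%:R * \sum_(j < n) a j ^+ 2 =
    \sum_(i < n) \sum_(j < n) (a i ^+ 2 / 2 + a j ^+ 2 / 2).
  transitivity (\sum_(i < n) (n%:R * (a i ^+ 2 / 2) + (\sum_(j < n) a j ^+ 2) / 2)).
    rewrite big_split/= sumr_const card_ord -mulr_sumr -mulr_suml.
    by rewrite -[X in _ = _ + X]mulr_natl; field.
  apply: eq_bigr => i _; rewrite big_split/= sumr_const card_ord mulr_suml.
  by rewrite mulr_natl.
rewrite expr2 big_distrlr/=; apply: ler_sum => i _; apply: ler_sum => j _.
by have := sqr_ge0 (a i - a j); rewrite sqrrB -mulr_natr; lra.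
Qed.

Lemma sqnorm_sum_le (R : realType) (d n : nat) (v : 'I_n -> 'rV[R]_d) :
  sqnorm (\sum_(j < n) v j) <= n%:R * \sum_(j < n) sqnorm (v j).
Proof.
rewrite /sqnorm exchange_big/= mulr_sumr; apply: ler_sum => c _.
by rewrite summxE; exact: sqr_sum_le.
Qed.

Lemma sqnormZ (R : realType) (d : nat) (a : R) (v : 'rV[R]_d) :
  sqnorm (a *: v) = a ^+ 2 * sqnorm v.
Proof. by rewrite /sqnorm mulr_sumr; apply: eq_bigr => c _; rewrite mxE exprMn. Qed.

(** Finite sums replace the time integral of the velocity, so that means are taken term by term
    instead of exchanging expectation and time integral. *)
Lemma langevin_path_riemann (R : realType) (d : nat) (al be la : R)
    (x : R -> phase R d) f w (s t e : R) : langevin_path al be la x f w ->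
  0 <= s -> s < t -> 0 < e -> exists n0, forall n, (n0 <= n)%N -> (0 < n)%N /\
  let h := (t - s) / n%:R in
  forall c, `|(qof (x t) - qof (x s) - \sum_(j < n) h *: pof (x (s + j%:R * h))) 0 c|
     <= (t - s) * e.
Proof.
move=> [cx X] s0 st e0; have [r r0 H] := heine t cx e0.
have ts0 : 0 < t - s by rewrite subr_gt0.
exists (Num.truncn ((t - s) / r)).+1 => n /(mesh_lt r0)[nR hr].
split=> [|h c]; first by rewrite -(ltr0n R).
have h0 : 0 < h by rewrite divr_gt0.
have hn : n%:R * h = t - s by rewrite /h mulrC divfK// gt_eqF.
pose u j := s + j%:R * h.
have uS j : u j.+1 = u j + h by rewrite /u -natr1 mulrDl mul1r addrA.
have u0 j : 0 <= u j by rewrite addr_ge0// mulr_ge0// ltW.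
have ut j : (j < n)%N -> u j.+1 <= t.
  by move=> jn; rewrite /u -lerBrDl -hn ler_pM2r// ler_nat.
have E j : (j < n)%N ->
    `|qof (x (u j.+1)) 0 c - qof (x (u j)) 0 c - h * pof (x (u j)) 0 c| <= h * e.
  move=> jn; have uu : u j <= u j.+1 by rewrite uS lerDl ltW.
  have [_ -> _ _] := X c (u j) (u j.+1) (u0 j) uu.
  rewrite uS; apply: Rintegral_near_cst; first exact: ltW.
      have [_ cp _] := within_continuous_coord c cx.
      exact: within_continuous_integrable.
    move=> v /andP[uv vu].
    have vt : v <= t by apply: le_trans vu _; rewrite -uS; exact: ut.
    have := H (u j) v; rewrite u0 (le_trans uv vt) vt (le_trans (u0 j) uv) => /(_ isT isT).
    rewrite distrC ger0_norm ?subr_ge0//.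
    have vr : v - u j < r by apply: le_lt_trans hr; rewrite lerBlDl.
    by move=> /(_ vr)/phase_ball_coord/(_ c)[_ + _]; rewrite distrC; exact: ltW.
have tel : qof (x t) 0 c - qof (x s) 0 c =
    \sum_(j < n) (qof (x (u j.+1)) 0 c - qof (x (u j)) 0 c).
  rewrite -(big_mkord xpredT (fun j => qof (x (u j.+1)) 0 c - qof (x (u j)) 0 c)).
  have un : u n = t by rewrite /u hn addrC subrK.
  have us : u 0%N = s by rewrite /u mul0r addr0.
  by rewrite (telescope_sumr (fun j => qof (x (u j)) 0 c))// un us.
rewrite [X in `|X|](_ : _ = \sum_(j < n) (qof (x (u j.+1)) 0 c - qof (x (u j)) 0 c
   - h * pof (x (u j)) 0 c)); last first.
  rewrite big_split/= -tel sumrN !mxE summxE; congr (_ - _).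
  by apply: eq_bigr => j _; rewrite mxE.
apply: le_trans (ler_norm_sum _ _ _) _; rewrite -hn -mulrA.
apply: (@le_trans _ _ (\sum_(j < n) h * e)).
  by apply: ler_sum => j _; exact: E.
by rewrite sumr_const card_ord mulr_natl.
Qed.

Lemma sqnorm_lipschitz (R : realType) (d : nat) (f : 'rV[R]_d -> 'rV[R]_d) (L : R) :
  0 <= L -> (forall u v, sqnorm (f u - f v) <= L * sqnorm (u - v)) ->
  lipschitz_map (Num.sqrt L) f.
Proof. by move=> L0 Lf u v; rewrite /enorm -sqrtrM// ler_sqrt ?mulr_ge0 ?sqnorm_ge0. Qed.

Lemma ae_eq_probability (R : realType) (dO : measure_display) (Omega : measurableType dO)
    (P : probability Omega R) (A B : set Omega) : measurable A -> measurable B ->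
  {ae P, forall w, A w <-> B w} -> P A = P B.
Proof.
move=> mA mB AB; rewrite -(setIT A) -(setIT B) -!integral_indic//.
apply: ae_eq_integral => //; try by apply/measurable_EFinP; exact: measurable_indic.
apply: filterS AB => w AB _; rewrite !indicE; congr ((nat_of_bool _)%:R%:E).
by apply/idP/idP => /set_mem; rewrite inE; apply AB.
Qed.

(** An event of [X i] is the preimage of some set, and the preimage of that set under [Y i] differs
    from it by a null set; a finite intersection involves only finitely many of these. *)
Lemma independent_ae (R : realType) (dO dT : measure_display) (Omega : measurableType dO)
    (T : measurableType dT) (P : probability Omega R) (I : eqType)
    (X Y : I -> Omega -> T) :
  (forall i, measurable_fun setT (X i)) -> (forall i, measurable_fun setT (Y i)) ->
  (forall i, {ae P, forall w, X i w = Y i w}) ->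
  independent P (fun i => sigma_var (Y i)) -> independent P (fun i => sigma_var (X i)).
Proof.
move=> mX mY XY /independentP ind; apply/independentP => s E us sE.
have [A HA] : exists A : I -> set T, forall i, i \in s ->
    measurable (A i) /\ E i = X i @^-1` A i.
  suff /choice[A HA] : forall i, exists Ai : set T, i \in s ->
      measurable Ai /\ E i = X i @^-1` Ai by exists A.
  move=> i; have [is_|nis] := boolP (i \in s); last by exists setT.
  by have /sigma_varP[B mB <-] := sE i is_; exists B.
have eqi i : i \in s -> P (E i) = P (Y i @^-1` A i).
  move=> is_; have [mA ->] := HA i is_; apply: ae_eq_probability.
  - by rewrite -[X in measurable X]setTI; exact: mX.
  - by rewrite -[X in measurable X]setTI; exact: mY.
  - by apply: filterS (XY i) => w /= ->.
rewrite (eq_big_seq _ eqi) -ind//; last first.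
  by move=> i is_; have [mA _] := HA i is_; apply/sigma_varP; exists (A i).
apply: ae_eq_probability.
- rewrite big_seq_cond; apply: big_ind => //; first exact: measurableI.
  move=> i /andP[is_ _]; have [mA ->] := HA i is_.
  by rewrite -[X in measurable X]setTI; exact: mX.
- rewrite big_seq_cond; apply: big_ind => //; first exact: measurableI.
  move=> i /andP[is_ _]; have [mA _] := HA i is_.
  by rewrite -[X in measurable X]setTI; exact: mY.
rewrite -!bigcap_seq_eqType.
suff : {ae P, forall w, forall i, i \in s -> X i w = Y i w}.
  apply: filterS => w XYw; split=> H i /= is_; have := H i is_; have [mA ->] := HA i is_;
    by rewrite /= XYw.
elim: s {us sE HA eqi} => [|i s IH]; first exact: aeW.
apply: filterS2 (XY i) IH => w e1 e2 j; rewrite inE => /predU1P[->//|]; exact: e2.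
Qed.

Section nonlinear_process.
Context (R : realType) (d : nat) (al be la b m M k C1 C h0 : R).
Local Notation V := (@phase_lyap R d be la b).
Hypotheses (al0 : 0 < al) (be0 : 0 < be) (la0 : 0 < la)
  (HV1 : lyapunov_bounds (d := 1) al be la (phase_lyap be la b) m M k C1 h0)
  (HV : lyapunov_bounds al be la V m M k C h0).
Context (A B : 'rV[R]_d -> 'rV[R]_d) (CA CB : R).
Hypotheses (CA0 : 0 <= CA) (CB0 : 0 <= CB) (LA : lipschitz_map CA A)
  (LB : lipschitz_map CB B) (oB : odd_map B)
  (small : 128 * C * (CA ^+ 2 + CB ^+ 2) <= k * m).
Context (rho0 : probability (phase R d) R) (mu : R -> probability (phase R d) R)
  (dO : measure_display) (Omega : measurableType dO) (P : probability Omega R)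
  (X0 : {RV P >-> phase R d}) (W : R -> {RV P >-> 'rV[R]_d})
  (X : R -> {RV P >-> phase R d}).
Hypotheses (fin0 : finite_second_moment rho0)
  (finmu : forall t, 0 <= t -> finite_second_moment (mu t))
  (X0law : has_law X0 rho0) (bW : brownian_motion P W)
  (Xsol : langevin_solution al be la A P
     (fun s w => convol B (mu s) (qof (X s w))) W X0 X)
  (Xlaw : forall t, 0 <= t -> has_law (X t) (mu t)).

Definition force (s : R) (q : 'rV[R]_d) : 'rV[R]_d := - A q - convol B (mu s) q.

Lemma reference_moment_bound_ge0 U L c K D0 D : 0 <= U -> 0 <= L -> 0 <= c ->
  0 <= K -> 0 <= D0 -> 0 <= D ->
  0 <= reference_moment_bound d al la m M k C U L c K D0 D.
Proof.
move=> U0 L0 c0 K0 D00 D1; have [m0 M0 k0 C0 _ _ _ _ _] := HV.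
have nb : 0 <= noise_bound d m M k.
  have mk : 0 < m * k by exact: mulr_gt0.
  rewrite /noise_bound mulr_ge0//; apply: divr_ge0; last exact: ltW.
  by rewrite mulr_ge0// ltW.
have M4 : 0 <= 4 * M by rewrite mulr_ge0// ltW.
have C8 : 0 <= 8 * C by rewrite mulr_ge0// ltW.
have k2 : 0 <= k / 2 by rewrite divr_ge0// ltW.
rewrite /reference_moment_bound; apply: addr_ge0; last by rewrite addr_ge0// mulr_ge0.
apply: addr_ge0; first by rewrite mulr_ge0 ?addr_ge0// divr_ge0// ltW.
apply: divr_ge0 => //; apply: mulr_ge0; first by rewrite divr_ge0// ltW.
apply: addr_ge0; last by rewrite mulr_ge0// mulr_ge0// sqr_ge0.
by rewrite addr_ge0// mulr_ge0 ?mulr_ge0// addr_ge0// mulr_ge0.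
Qed.

Lemma solution_path : {ae P, forall w, [/\ X 0 w = X0 w, W 0 w = 0,
  langevin_path al be la (fun t => X t w) (fun s => force s (qof (X s w)))
    (fun t => W t w)
  & {within [set t : R | 0 <= t], continuous (fun t => W t w)}]}.
Proof.
have [W0 cW _ _] := bW.
apply: filterS2 cW (langevin_solution_path W0 Xsol) => w cw [h1 h2 h3].
by split.
Qed.

Let moment t (t0 : 0 <= t) := law_mean_le (Xlaw t0) (finmu t0).

Lemma convol_lipschitz s q q' : 0 <= s ->
  sqnorm (convol B (mu s) q - convol B (mu s) q') <= CB ^+ 2 * sqnorm (q - q').
Proof.
move=> s0; apply: (convol_sub CB0 LB oB (moment s0) (Xlaw s0) (moment s0) (Xlaw s0)).
under [X in mean_le _ X]eq_fun do rewrite subrBB subrr subr0.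
exact: mean_le_cst (sqnorm_ge0 _).
Qed.

Lemma force_lipschitz s q q' : 0 <= s ->
  sqnorm (force s q - force s q') <= 4 * (CA ^+ 2 + CB ^+ 2) * sqnorm (q - q').
Proof.
move=> s0; rewrite /force.
have -> : - A q - convol B (mu s) q - (- A q' - convol B (mu s) q') =
   - (A q - A q') - (convol B (mu s) q - convol B (mu s) q').
  by rewrite subrBB -opprD opprB addrC; congr (_ - _); rewrite opprK addrC.
have := sqnormD (- (A q - A q')) (- (convol B (mu s) q - convol B (mu s) q')).
have := lipschitz_sqnorm CA0 LA q q'; have := convol_lipschitz q q' s0.
rewrite !sqnormN mulrDr mulrDl.
have := mulr_ge0 (sqr_ge0 CA) (sqnorm_ge0 (q - q')).
have := mulr_ge0 (sqr_ge0 CB) (sqnorm_ge0 (q - q')).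
by lra.
Qed.

Lemma force_bound s U q : 0 <= s -> mean_le P (fun w => phase_sqnorm (X s w)) U ->
  sqnorm (force s q) <= 4 * (CA ^+ 2 + CB ^+ 2) * sqnorm q
     + (4 * sqnorm (A 0) + 4 * CB ^+ 2 * U).
Proof.
move=> s0 XU; rewrite /force.
have := sqnormD (- A q) (- convol B (mu s) q).
have := lipschitz_sqnorm_le CA0 LA q; have := convol_bound CB0 LB oB XU (Xlaw s0) q.
by rewrite !sqnormN; lra.
Qed.

Let U0 := fine (\int[rho0]_x (phase_sqnorm x)%:E).
Let mX0 : mean_le P (fun w => phase_sqnorm (X0 w)) U0 := law_mean_le X0law fin0.
Let L := 4 * (CA ^+ 2 + CB ^+ 2).

Let L0 : 0 <= L. Proof. by rewrite mulr_ge0// addr_ge0 ?sqr_ge0. Qed.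
Let CL : 32 * C * L <= k * m.
Proof. by apply: le_trans small; rewrite /L; apply: eqW; ring. Qed.

Lemma initial_moment : mean_le P (fun w => phase_sqnorm (X 0 w)) U0.
Proof.
apply: mean_le_dom mX0 _ _ _.
- by apply: measurable_phase_sqnorm; exact: measurable_funPT.
- by move=> w; exact: phase_sqnorm_ge0.
- by apply: filterS solution_path => w [-> _ _ _].
Qed.

(** The reference is one sample path of the process itself. In the difference the force is Lipschitz
    in q with constants that do not involve mu, and vanishes with the gap in q, so no prior bound on
    the moments of mu is used; the constant depends on the size of the chosen path on [[0, T]]. *)
Lemma local_moment T : 0 <= T -> exists U, forall t, 0 <= t <= T ->
  mean_le P (fun w => phase_sqnorm (X t w)) U.
Proof.
move=> T0; have [w0 [Xw0 Ww0 xP cW0]] := ae_nonempty solution_path.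
have [K HK] := within_continuous_bounded (@continuous_sqnorm R d) T0 cW0.
have [D HD] := within_continuous_bounded (@continuous_phase_sqnorm R d) T0 (proj1 xP).
have K0 : 0 <= K by apply: le_trans (HK 0 _); [exact: sqnorm_ge0|rewrite lexx].
have D0 : 0 <= D by apply: le_trans (HD 0 _); [exact: phase_sqnorm_ge0|rewrite lexx].
have [m0 M0 k0 C0 h00 _ _ _ _] := HV.
exists (U0 + reference_moment_bound d al la m M k C U0 L 0 K D (2 * D + 4 * K)).
have bnd0 : 0 <= reference_moment_bound d al la m M k C U0 L 0 K D (2 * D + 4 * K).
  have U00 := mean_le_ge0 mX0.
  by apply: reference_moment_bound_ge0 => //; rewrite addr_ge0 ?mulr_ge0.
move=> t /andP[]; rewrite le_eqVlt => /predU1P[<- _|t0 tT].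
  by apply: mean_leW initial_moment; rewrite lerDl.
have dsub s : 0 <= s <= t -> 0 <= s <= T.
  by move=> /andP[-> st]; rewrite (le_trans st).
have tt : 0 <= t <= T by rewrite ltW.
have HKt s : 0 <= s <= t -> sqnorm (W s w0) <= K by move=> /dsub; exact: HK.
have cc : 0 <= 0 :> R by [].
apply: mean_leW (@reference_moment R d al be la b m M k C1 C h0 al0 be0 la0 HV1 HV
  _ _ P X0 W X U0 bW mX0 (fun s w => force s (qof (X s w))) t L 0 K
  (X^~ w0) (fun s => force s (qof (X s w0))) (W^~ w0) t0 L0 cc K0 CL Ww0 HKt _); last first.
  apply: filterS solution_path => w [h1 h2 h3 _]; split => //.
    exact: langevin_pathB h3 xP.
  move=> s /andP[s0 _]; rewrite addr0; apply: le_trans (force_lipschitz _ _ s0) _.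
  by rewrite phaseDE.
apply: ler_wpDl; first exact: mean_le_ge0 mX0.
have D0' : phase_sqnorm (X 0 w0) <= D by apply: HD; rewrite lexx.
have Dt : phase_sqnorm (X t w0 - noise_phase (W t w0)) <= 2 * D + 4 * K.
  have := phase_sqnormD (X t w0) (- noise_phase (W t w0)).
  rewrite phase_sqnormN noise_phase_sqnorm.
  have := HD t tt; have := HK t tt; lra.
have Mm : 0 <= 4 * M / m by rewrite divr_ge0 ?mulr_ge0 ?ltW.
rewrite /reference_moment_bound; apply: lerD; last by lra.
by rewrite lerD2r; apply: ler_wpM2l => //; lra.
Qed.

(** The factor 2 solves u <= U0 + K0 + u / 2. The law at time 0 enters, the later laws do not. *)
Definition moment_bound : R :=
  2 * (U0 + reference_moment_bound d al la m M k C U0 L (4 * sqnorm (A 0)) 0 0 0).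

(* The supremum of the moments over [0, t] is finite by [local_moment], and the
   smallness condition bounds it by a constant plus half of itself. *)
Lemma uniform_moment t : 0 <= t ->
  mean_le P (fun w => phase_sqnorm (X t w)) moment_bound.
Proof.
move=> t0; have [m0 M0 k0 C0 h00 _ _ _ _] := HV.
have [U HU] := local_moment t0.
pose mt s := fine (\int[P]_w (phase_sqnorm (X s w))%:E).
have mtU s K : mean_le P (fun w => phase_sqnorm (X s w)) K -> mt s <= K /\
    mean_le P (fun w => phase_sqnorm (X s w)) (mt s).
  move=> sK; have [Ls E1 E2] := mean_le_fine sK; rewrite /mt E1; split => //.
  by have [h1 h2 _] := sK; split => //; rewrite E1.
pose E := [set mt s | s in [set s | 0 <= s <= t]].
have supE : has_sup E.
  split; first by exists (mt 0), 0 => //=; rewrite lexx.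
  by exists U => _ [s /= st <-]; have [] := mtU _ _ (HU s st).
pose Us := sup E.
have HUs s : 0 <= s <= t -> mean_le P (fun w => phase_sqnorm (X s w)) Us.
  move=> st; have [_] := mtU _ _ (HU s st); apply: mean_leW.
  by apply: (ub_le_sup (proj2 supE)); exists s.
have Us0 : 0 <= Us by apply: (mean_le_ge0 (HUs 0 _)); rewrite lexx.
pose K0 := reference_moment_bound d al la m M k C U0 L (4 * sqnorm (A 0)) 0 0 0.
have K00 : 0 <= K0.
  have U00 := mean_le_ge0 mX0; have A00 := sqnorm_ge0 (A 0).
  by apply: reference_moment_bound_ge0 => //; rewrite ?mulr_ge0.
have key s : 0 <= s <= t -> mean_le P (fun w => phase_sqnorm (X s w)) (U0 + K0 + Us / 2).
  move=> /andP[]; rewrite le_eqVlt => /predU1P[<- _|s0 st].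
    by apply: mean_leW initial_moment; rewrite -addrA lerDl addr_ge0// divr_ge0.
  pose c := 4 * sqnorm (A 0) + 4 * CB ^+ 2 * Us.
  have c0 : 0 <= c.
    by rewrite addr_ge0 ?mulr_ge0 ?sqnorm_ge0 ?sqr_ge0.
  have zero u : 0 <= u <= s -> sqnorm (0 : 'rV[R]_d) <= 0.
    by move=> _; rewrite /sqnorm big1// => i _; rewrite mxE expr0n.
  apply: mean_leW (@reference_moment R d al be la b m M k C1 C h0 al0 be0 la0 HV1 HV
    _ _ P X0 W X U0 bW mX0 (fun s w => force s (qof (X s w))) s L c 0
    (fun=> 0) (fun=> 0) (fun=> 0) s0 L0 c0 (lexx 0) CL erefl zero _); last first.
    apply: filterS solution_path => w [h1 h2 h3 _]; split => //.
      by under eq_fun do rewrite subr0; under [X in langevin_path _ _ _ _ X]eq_fun do rewrite subr0;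
        under [X in langevin_path _ _ _ _ _ X]eq_fun do rewrite subr0.
    move=> u /andP[u0 us]; rewrite !subr0; apply: force_bound => //.
    by apply: HUs; rewrite u0 (le_trans us st).
  have -> : noise_phase (0 : 'rV[R]_d) = 0 by rewrite /noise_phase scaler0.
  rewrite subr0 phase_sqnorm0.
  have -> : reference_moment_bound d al la m M k C U0 L c 0 0 0 = K0
     + 64 * C * CB ^+ 2 / (m * k) * Us.
    by rewrite /K0 /reference_moment_bound /c; field; rewrite !gt_eqF.
  (* The later laws enter the force bound only through 4 CB^2 Us; this is the coefficient of Us
     after the recursion. *)
  have h : 64 * C * CB ^+ 2 / (m * k) <= 2^-1.
    rewrite ler_pdivrMr ?mulr_gt0//.
    have : 0 <= C * CA ^+ 2 by rewrite mulr_ge0 ?sqr_ge0 ?ltW.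
    by have := small; lra.
  have := ler_wpM2r Us0 h; have := mean_le_ge0 mX0; lra.
have UsK : Us <= U0 + K0 + Us / 2.
  apply: ge_sup; first by case: supE.
  by move=> _ [s /= st <-]; have [] := mtU _ _ (key s st).
apply: mean_leW (HUs t _); last by rewrite t0 lexx.
by rewrite /moment_bound -/K0; lra.
Qed.

Local Notation M0 := moment_bound.

(** The position is the integral of the velocity, so Cauchy-Schwarz gives an increment quadratic in
    t - s with no noise contribution. The factor 2 splits off the Riemann remainder. *)
Lemma position_increment s t : 0 <= s -> s < t ->
  mean_le P (fun w => sqnorm (qof (X t w) - qof (X s w))) (2 * (t - s) ^+ 2 * M0).
Proof.
move=> s0 st; have ts0 : 0 < t - s by rewrite subr_gt0.
pose Rn n w := 2 * ((t - s) * \sum_(j < n) (t - s) / n%:R *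
   phase_sqnorm (X (s + j%:R * ((t - s) / n%:R)) w)).
have mq u : measurable_fun setT (fun w => sqnorm (qof (X t w) - qof (X u w))).
  apply: measurable_sum => c; apply: measurable_funX; under eq_fun do rewrite !mxE.
  have [h1 _ _] := measurable_phase_coord c (@measurable_funPT _ _ _ _ (X t)).
  have [h2 _ _] := measurable_phase_coord c (@measurable_funPT _ _ _ _ (X u)).
  exact: measurable_funB.
apply: (@mean_le_liminf _ _ _ P _ Rn _ 1%N) => //.
- by move=> w; exact: sqnorm_ge0.
- move=> n n0; have nR : 0 < n%:R :> R by rewrite ltr0n.
  have -> : 2 * (t - s) ^+ 2 * M0 = 2 * ((t - s) * \sum_(j < n) (t - s) / n%:R * M0).
    rewrite sumr_const card_ord -mulr_natl.
    by field; rewrite gt_eqF.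
  apply: mean_leZ => //; apply: mean_leZ; first exact: ltW.
  apply: (mean_le_sum (index_enum 'I_n)) => j; apply: mean_leZ.
    by rewrite divr_ge0 ?ltW.
  by apply: uniform_moment; rewrite addr_ge0// mulr_ge0// divr_ge0 ?ltW.
apply: filterS solution_path => w [_ _ xP _] e e0.
have K0 : 0 <= 2 * (d%:R * (t - s) ^+ 2).
  by apply: mulr_ge0 => //; apply: mulr_ge0 => //; exact: sqr_ge0.
have [De De0 /(_ De (ltW De0) (lexx De)) De2] := sqr_small K0 e0.
have {}De2 : 2 * (d%:R * ((t - s) * De) ^+ 2) <= e by move: De2; congr (_ <= _); ring.
have [n0 H] := langevin_path_riemann xP s0 st De0.
exists n0 => n /H[npos]; set h := (t - s) / n%:R => osc.
have nR : 0 < n%:R :> R by rewrite ltr0n.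
have hpos : 0 < h by rewrite divr_gt0.
set v := \sum_(j < n) h *: pof (X (s + j%:R * h) w).
have -> : qof (X t w) - qof (X s w) = v + (qof (X t w) - qof (X s w) - v).
  by rewrite [RHS]addrC subrK.
apply: le_trans (sqnormD _ _) _; apply: lerD.
  rewrite /Rn; apply: ler_wpM2l => //.
  apply: le_trans (sqnorm_sum_le _) _.
  have -> : t - s = n%:R * h by rewrite /h mulrC divfK// gt_eqF.
  rewrite -mulrA; apply: ler_wpM2l => //; rewrite mulr_sumr; apply: ler_sum => j _.
  rewrite (_ : n%:R * h / n%:R = h); last by field; rewrite gt_eqF.
  rewrite sqnormZ expr2 -mulrA; apply: ler_wpM2l; first exact: ltW.
  apply: ler_wpM2l; first exact: ltW.
  exact: sqnorm_pof.
apply: le_trans De2; apply: ler_wpM2l => //.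
rewrite mulr_natl -[X in _ <= _ *+ X]card_ord -sumr_const; apply: ler_sum => c _.
by rewrite -(real_normK (num_real _)) ler_sqr ?nnegrE// ?mulr_ge0 ?ltW//.
Qed.

Lemma convol_time s t q : 0 <= s -> s <= t ->
  sqnorm (convol B (mu t) q - convol B (mu s) q) <= 2 * CB ^+ 2 * (t - s) ^+ 2 * M0.
Proof.
move=> s0; rewrite le_eqVlt => /predU1P[->|st].
  rewrite subrr /sqnorm big1 ?subrr ?expr0n/= ?mulr0 ?mul0r// => i _.
  by rewrite mxE expr0n.
have t0 : 0 <= t := le_trans s0 (ltW st).
rewrite (_ : 2 * CB ^+ 2 * (t - s) ^+ 2 * M0 = CB ^+ 2 * (2 * (t - s) ^+ 2 * M0)); last by ring.
apply: (convol_sub CB0 LB oB (uniform_moment t0) (Xlaw t0) (uniform_moment s0) (Xlaw s0)).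
under [X in mean_le _ X]eq_fun do rewrite subrBB subrr sub0r sqnormN.
exact: position_increment.
Qed.

(** The law enters as a given function of time, so the scheme is an explicit function of the initial
    datum and finitely many Brownian increments. *)
Fixpoint euler (h : R) (n : nat -> 'rV[R]_d) (x0 : phase R d) (j : nat) : phase R d :=
  if j is j'.+1 then
    let x := euler h n x0 j' in
    (qof x + h *: pof x,
     pof x + h *: (- (be *: qof x) + force (j'%:R * h) (qof x) + la *: zof x),
     zof x + h *: (- (la *: pof x) - al *: zof x) + Num.sqrt 2 *: n j')
  else x0.

Lemma euler_step h n x0 j : step al be la h 0 (force (j%:R * h) (qof (euler h n x0 j)))
  (euler h n x0 j) (euler h n x0 j.+1) (n j).
Proof.
move=> c; rewrite !mulr0 !normr_le0 /=; set F := force _ _.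
by split; rewrite /qof /pof /zof /= !mxE; apply/eqP; ring.
Qed.

(** Besides the oscillation of the path, the only error is the replacement of mu_s by the law at the
    grid point, of order h by [convol_time]. The Lipschitz part of the force is absorbed by
    smallness, and both start from the same point. *)
Lemma euler_converges t : 0 < t -> {ae P, forall w, forall e, 0 < e ->
  exists n0, forall n, (n0 <= n)%N ->
  phase_sqnorm (X t w - euler (t / n%:R) ((brownian_increment W (t / n%:R))^~ w) (X0 w) n)
    <= e}.
Proof.
move=> t0; have [m0 M00 k0 C0 h00 kh0 Vge Vle Vst] := HV.
apply: filterS solution_path => w [Xw0 Ww0 xP _] e e0.
have MM0 : 0 <= M0 := mean_le_ge0 (uniform_moment (lexx 0)).
(* The Gronwall bound ee / (k / 2) then equals m e. One third goes to each of the tracking error,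
   the oscillation inside the force and the time dependence of the law. *)
pose ee := m * k / 2 * e.
have ee0 : 0 < ee by rewrite mulr_gt0// divr_gt0// mulr_gt0.
have C16 : 0 <= 16 * C by rewrite mulr_ge0// ltW.
have K1 : 0 <= 16 * C * L * d%:R by rewrite mulr_ge0// mulr_ge0.
have K2 : 0 <= 16 * C * CB ^+ 2 * M0 by rewrite mulr_ge0// mulr_ge0// sqr_ge0.
have ee3 : 0 < ee / 3 by rewrite divr_gt0.
have [De De0 /(_ De (ltW De0) (lexx De)) De2] := sqr_small K1 ee3.
have [h3 h30 h3P] := sqr_small K2 ee3.
have [n1 H1] := partition_oscillation (proj1 xP) t0 De0.
have [n2 H2] := tracking al0 be0 la0 HV xP t0 ee3.
exists (maxn (maxn n1 n2) (Num.truncn (t / h3)).+1) => n.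
rewrite !geq_max => /andP[/andP[/H1[n0 osc] /H2]].
set h := t / n%:R => -[_ hh0 tr] /(mesh_lt h30)[nR /ltW hh3].
have h_gt0 : 0 < h by rewrite divr_gt0.
have h2 := h3P h (ltW h_gt0) hh3.
set y := euler h ((brownian_increment W h)^~ w) (X0 w).
pose S j := V (X (j%:R * h) w - y j).
have rec j : (j < n)%N -> S j.+1 <= (1 - k / 2 * h) * S j + h * ee.
  move=> jn.
  have j0 : 0 <= j%:R * h by rewrite mulr_ge0// ltW.
  pose ex := X (j%:R * h) w - y j.
  pose phi := 2 * (L * (2 * phase_sqnorm ex + 2 * (d%:R * De ^+ 2)))
     + 2 * (2 * CB ^+ 2 * h ^+ 2 * M0).
  have phi0 : 0 <= phi.
    have p1 : 0 <= 2 * phase_sqnorm ex + 2 * (d%:R * De ^+ 2).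
      by rewrite addr_ge0// mulr_ge0 ?phase_sqnorm_ge0// mulr_ge0// sqr_ge0.
    have p2 : 0 <= 2 * CB ^+ 2 * h ^+ 2 * M0.
      by rewrite mulr_ge0// mulr_ge0 ?sqr_ge0// mulr_ge0 ?sqr_ge0.
    by rewrite /phi addr_ge0// mulr_ge0// mulr_ge0.
  have := tr j _ _ _ 0 phi jn (lexx 0) phi0
    (euler_step h ((brownian_increment W h)^~ w) (X0 w) j).
  rewrite -/y -/(S j.+1) -/(S j) => H; apply: le_trans (H _) _.
    move=> s /andP[js sj].
    have s0 : 0 <= s := le_trans j0 js.
    have -> : force s (qof (X s w)) - force (j%:R * h) (qof (y j)) =
       (force s (qof (X s w)) - force s (qof (y j)))
       + - (convol B (mu s) (qof (y j)) - convol B (mu (j%:R * h)) (qof (y j))).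
      rewrite /force; move: (A _) (A _) (convol _ _ _) (convol _ _ _) (convol _ _ _).
      by move=> a1 a2 a3 a4 a5; apply/rowP => c; rewrite !mxE; ring.
    apply: le_trans (sqnormD _ _) _; rewrite sqnormN /phi; apply: lerD.
      apply: ler_wpM2l => //.
      apply: le_trans (force_lipschitz _ _ s0) _.
      apply: ler_wpM2l => //.
      have -> : qof (X s w) - qof (y j) = qof ex + (qof (X s w) - qof (X (j%:R * h) w)).
        by rewrite /ex phaseDE [RHS]addrC addrA subrK.
      apply: le_trans (sqnormD _ _) _.
      have b1 : ball (X (j%:R * h) w) De (X s w) by apply: osc; rewrite // js.
      by have := sqnorm_ball b1; have := sqnorm_phase ex; lra.
    apply: ler_wpM2l => //; apply: le_trans (convol_time _ j0 js) _.
    apply: ler_wpM2r => //; apply: ler_wpM2l; first by rewrite mulr_ge0 ?sqr_ge0.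
    rewrite ler_sqr ?nnegrE ?subr_ge0 ?(ltW h_gt0)//.
    by rewrite lerBlDl; move: sj; rewrite -natr1 mulrDl mul1r.
  have V1 : 16 * C * L * phase_sqnorm ex <= k / 2 * S j.
    apply: (@le_trans _ _ (k / 2 * (m * phase_sqnorm ex))).
      by have := ler_wpM2r (phase_sqnorm_ge0 ex) small; rewrite /L; lra.
    by apply: ler_wpM2l; [rewrite divr_ge0// ltW|exact: Vge].
  rewrite expr0n/= addr0 -subr_ge0.
  have -> : (1 - k / 2 * h) * S j + h * ee - ((1 - k * h) * S j + h * (4 * C * phi + ee / 3))
    = h * ((k / 2 * S j - 16 * C * L * phase_sqnorm ex)
       + (ee / 3 - 16 * C * L * d%:R * De ^+ 2)
       + (ee / 3 - 16 * C * CB ^+ 2 * M0 * h ^+ 2)) by rewrite /phi; field.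
  apply: mulr_ge0; first exact: ltW.
  by apply: addr_ge0; [apply: addr_ge0|]; rewrite subr_ge0.
have k20 : 0 < k / 2 by rewrite divr_gt0.
have kh : k / 2 * h <= 1.
  have : k * h <= 1 by apply: le_trans kh0; rewrite ler_pM2l.
  have : 0 < k * h by exact: mulr_gt0.
  by lra.
have S0 : S 0%N <= 0.
  rewrite /S mul0r Xw0 /y /= subrr; apply: le_trans (Vle _) _.
  by rewrite phase_sqnorm0 mulr0.
have := discrete_gronwall kh rec; rewrite -mulr_suml => gr.
have Sn : S n <= (k / 2)^-1 * ee.
  apply: le_trans gr _; rewrite -[leRHS]add0r; apply: lerD.
    by rewrite mulr_ge0_le0// exprn_ge0// subr_ge0.
  by apply: ler_wpM2r; [exact: ltW|apply: gronwall_weight_sum => //; exact: ltW].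
have ends : n%:R * h = t by rewrite /h mulrC divfK// gt_eqF.
have := le_trans (Vge _) Sn; rewrite ends.
have -> : (k / 2)^-1 * ee = m * e by rewrite /ee; field; rewrite gt_eqF.
by rewrite ler_pM2l.
Qed.

(** * Measurability of the solution with respect to its own data *)

Section adapted.
Context (G : set (set Omega)).
Hypotheses (X0G : sigma_var X0 `<=` <<s G >>)
  (WG : forall t, 0 <= t -> sigma_var (W t) `<=` <<s G >>).

Lemma force_measurable s (c : 'I_d) : 0 <= s ->
  measurable_fun setT (fun q => force s q 0 c).
Proof.
move=> s0; apply: (lipschitz_measurable (L := Num.sqrt L)); first exact: sqrtr_ge0.
by apply: sqnorm_lipschitz => // u v; exact: force_lipschitz.
Qed.

Let OmegaG := g_sigma_algebraType G.

Lemma euler_measurable h j : 0 <= h ->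
  measurable_fun setT (fun w : OmegaG =>
    euler h ((brownian_increment W h)^~ w) (X0 w) j).
Proof.
move=> h_ge0.
have mW l c : measurable_fun setT (fun w : OmegaG => brownian_increment W h l w 0 c).
  rewrite /brownian_increment; under eq_fun do rewrite !mxE.
  have mWt t : 0 <= t -> measurable_fun setT (fun w : OmegaG => W t w 0 c).
    move=> t0; apply: (measurableT_comp (measurable_coord c)).
    exact: (g_sigma_measurable_fun (WG t0)).
  by apply: measurable_funB; apply: mWt; rewrite mulr_ge0.
elim: j => [|j IH]; first exact: (g_sigma_measurable_fun X0G).
apply: measurable_phaseP => c.
have [mq mp mz] := measurable_phase_coord c IH.
have mqv : measurable_fun setT (fun w : OmegaG =>
    qof (euler h ((brownian_increment W h)^~ w) (X0 w) j)).
  by apply: measurable_rVP => c'; have [] := measurable_phase_coord c' IH.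
have mF := measurableT_comp (force_measurable c (mulr_ge0 (ler0n R j) h_ge0)) mqv.
pose e j w := euler h ((brownian_increment W h)^~ w) (X0 w) j.
have [/funext Eq /funext Ep /funext Ez] : [/\
    forall w, qof (e j.+1 w) 0 c = qof (e j w) 0 c + h * pof (e j w) 0 c,
    forall w, pof (e j.+1 w) 0 c = pof (e j w) 0 c + h * (- (be * qof (e j w) 0 c)
      + force (j%:R * h) (qof (e j w)) 0 c + la * zof (e j w) 0 c)
  & forall w, zof (e j.+1 w) 0 c = zof (e j w) 0 c
      + h * (- (la * pof (e j w) 0 c) - al * zof (e j w) 0 c)
      + Num.sqrt 2 * brownian_increment W h j w 0 c].
  split=> w; rewrite /e /= -/(e j w).
  - by rewrite /qof /pof /= !mxE.
  - by move: (force _ _) => F; rewrite /qof /pof /zof /= !mxE.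
  - by move: (brownian_increment _ _ _ _) => n; rewrite /pof /zof /= !mxE.
split.
- rewrite [X in measurable_fun _ X]Eq.
  by apply: measurable_funD => //; exact: measurable_funM.
- rewrite [X in measurable_fun _ X]Ep.
  apply: measurable_funD => //; apply: measurable_funM => //.
  apply: measurable_funD; last exact: measurable_funM.
  apply: measurable_funD; last exact: mF.
  by apply: measurableT_comp => //; exact: measurable_funM.
- rewrite [X in measurable_fun _ X]Ez.
  apply: measurable_funD; last by apply: measurable_funM => //; exact: mW.
  apply: measurable_funD => //; apply: measurable_funM => //.
  apply: measurable_funB; last exact: measurable_funM.
  by apply: measurableT_comp => //; exact: measurable_funM.
Qed.

(* [langevin_solution] does not require adaptedness: it is recovered from the
   convergence of the Euler schemes. *)
Lemma solution_adapted t : 0 <= t -> exists Y : Omega -> phase R d,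
  sigma_var Y `<=` <<s G >> /\ {ae P, forall w, X t w = Y w}.
Proof.
rewrite le_eqVlt => /predU1P[<-|t0].
  exists X0; split=> //.
  by apply: filterS (solution_path) => w [].
pose a n w := euler (t / n%:R)
   ((brownian_increment W (t / n%:R))^~ w) (X0 w) n.
(* An upper limit is measurable everywhere, also where the scheme diverges, and equals the limit
   where the scheme converges. *)
pose lim (u : nat -> R) : R := fine (limn_esup (EFin \o u)).
pose Y w : phase R d := (\row_c lim (fun n => qof (a n w) 0 c),
   \row_c lim (fun n => pof (a n w) 0 c), \row_c lim (fun n => zof (a n w) 0 c)).
have limP (u : nat -> R) (x : R) : u @ \oo --> x -> lim u = x.
  move=> ux; have : (EFin \o u) @ \oo --> x%:E by apply: cvg_EFin => //; exact: nearW.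
  by rewrite /lim => /cvg_limn_einf_sup[_ ->].
have mlim (u : nat -> OmegaG -> R) : (forall n, measurable_fun setT (u n)) ->
    measurable_fun setT (fun w => lim (u^~ w)).
  move=> mu'; apply: measurableT_comp; first exact: fine_measurable.
  by apply: measurable_fun_limn_esup => n; exact/measurable_EFinP.
exists Y; split.
  apply: sigma_var_g_sigma; apply: (@measurable_phaseP _ _ OmegaG) => c.
  have ma n := measurable_phase_coord c (@euler_measurable (t / n%:R) n (divr_ge0 (ltW t0) (ler0n _ _))).
  rewrite /Y /qof /pof /zof /=; split; under eq_fun do rewrite mxE.
  - by apply: mlim => n; have [] := ma n.
  - by apply: mlim => n; have [] := ma n.
  - by apply: mlim => n; have [] := ma n.
have conv := euler_converges t0.
apply: filterS conv => w conv.
have coord (g : phase R d -> 'rV[R]_d) : (forall x y, g (x - y) = g x - g y) ->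
   (forall x, sqnorm (g x) <= phase_sqnorm x) -> forall c,
   g (X t w) 0 c = lim (fun n => g (a n w) 0 c).
  move=> gB gle c; apply/esym/limP/cvgrPdist_le => e e0.
  have [n0 Hn] := conv (e ^+ 2) (exprn_gt0 _ e0).
  exists n0 => // n /= n0n; have := Hn n n0n.
  move/(le_trans (gle _)); rewrite gB => /(le_trans (sqnorm_coord _ c)).
  by rewrite !mxE -(real_normK (num_real _)) ler_sqr ?nnegrE// ltW.
rewrite (surjective_pairing (X t w)) (surjective_pairing (X t w).1) /Y.
congr (_, _, _); apply/rowP => c; rewrite mxE.
- apply: (coord (@qof R d)) => //; exact: sqnorm_phase.
- apply: (coord (@pof R d)) => //; exact: sqnorm_pof.
- apply: (coord (@zof R d)) => //; exact: sqnorm_zof.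
Qed.

End adapted.
End nonlinear_process.

(** * The coupled systems *)

Lemma sigma_var_pi (R : realType) (dO dT : measure_display) (Omega : measurableType dO)
    (T : measurableType dT) (P : probability Omega R) (I : eqType) (Y : I -> {RV P >-> T}) :
  [/\ forall i, sigma_var (Y i) `<=` measurable, forall i, setI_closed (sigma_var (Y i))
    & forall i, sigma_var (Y i) setT].
Proof.
split=> i; first exact: (sigma_var_sub (@measurable_funPT _ _ _ _ (Y i))).
- exact: sigma_var_setI.
- exact: sigma_var_setT.
Qed.

Section mean_field.
Context (R : realType) (d N : nat) (B : 'rV[R]_d -> 'rV[R]_d).

Definition mean_field (q : 'I_N -> 'rV[R]_d) (i : 'I_N) : 'rV[R]_d :=
  N%:R^-1 *: \sum_(j < N) B (q i - q j).

Definition average (f : 'I_N -> R) : R := N%:R^-1 * \sum_(j < N) f j.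

Lemma average_le f g : (forall j, f j <= g j) -> average f <= average g.
Proof. by move=> fg; apply: ler_wpM2l; rewrite ?invr_ge0//; exact: ler_sum. Qed.

Lemma average_cst (i : 'I_N) a : average (fun=> a) = a.
Proof.
have N0 : 0 < N%:R :> R by rewrite ltr0n (leq_ltn_trans _ (ltn_ord i)).
by rewrite /average sumr_const card_ord -mulr_natl; field; rewrite gt_eqF.
Qed.

Lemma averageD f g : average (fun j => f j + g j) = average f + average g.
Proof. by rewrite /average big_split mulrDr. Qed.

Lemma averageZ a f : average (fun j => a * f j) = a * average f.
Proof. by rewrite /average -mulr_sumr mulrCA. Qed.

Lemma average_ge0 f : (forall j, 0 <= f j) -> 0 <= average f.
Proof. by move=> f0; rewrite mulr_ge0 ?invr_ge0// sumr_ge0. Qed.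

Lemma average_sqnorm (i : 'I_N) (v : 'I_N -> 'rV[R]_d) :
  sqnorm (N%:R^-1 *: \sum_(j < N) v j) <= average (fun j => sqnorm (v j)).
Proof.
have N0 : 0 < N%:R :> R by rewrite ltr0n (leq_ltn_trans _ (ltn_ord i)).
rewrite sqnormZ; apply: le_trans (ler_wpM2l (sqr_ge0 _) (sqnorm_sum_le v)) _.
rewrite mulrA; apply: eqW; congr (_ * _).
by field; rewrite gt_eqF.
Qed.

Lemma mean_field_lipschitz (CB : R) (q q' : 'I_N -> 'rV[R]_d) i :
  0 <= CB -> lipschitz_map CB B ->
  sqnorm (mean_field q i - mean_field q' i) <=
  2 * CB ^+ 2 * (sqnorm (q i - q' i) + average (fun j => sqnorm (q j - q' j))).
Proof.
move=> CB0 LB; rewrite /mean_field -scalerBr -sumrB.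
apply: le_trans (average_sqnorm i _) _.
rewrite -[X in X + _](average_cst i) -averageD -averageZ; apply: average_le => j.
apply: le_trans (lipschitz_sqnorm CB0 LB _ _) _.
rewrite subrBB; have := sqnormD (q i - q' i) (- (q j - q' j)); rewrite sqnormN.
by move=> /(ler_wpM2l (sqr_ge0 CB)); lra.
Qed.

End mean_field.

Section coupling.
Context (R : realType) (d : nat) (al be la b m M k C1 C h0 : R).
Local Notation V := (@phase_lyap R d be la b).
Hypotheses (al0 : 0 < al) (be0 : 0 < be) (la0 : 0 < la)
  (HV1 : lyapunov_bounds (d := 1) al be la (phase_lyap be la b) m M k C1 h0)
  (HV : lyapunov_bounds al be la V m M k C h0).
Context (A B : 'rV[R]_d -> 'rV[R]_d) (CA CB : R).
Hypotheses (CA0 : 0 <= CA) (CB0 : 0 <= CB) (LA : lipschitz_map CA A)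
  (LB : lipschitz_map CB B) (oB : odd_map B)
  (small : 256 * C * (CA ^+ 2 + CB ^+ 2) <= k * m).
Context (rho0 : probability (phase R d) R) (mu : R -> probability (phase R d) R)
  (N : nat) (S : coupled_systems al be la A B rho0 mu N).
Hypotheses (fin0 : finite_second_moment rho0)
  (finmu : forall t, 0 <= t -> finite_second_moment (mu t)).

Local Notation P := (prob S).
Local Notation M0 := (moment_bound al la m M k C A CA CB rho0).
Local Notation kappa := (CA ^+ 2 + CB ^+ 2).

Let kappa0 : 0 <= kappa. Proof. by rewrite addr_ge0 ?sqr_ge0. Qed.

Let small128 : 128 * C * kappa <= k * m.
Proof.
have [_ _ _ C0 _ _ _ _ _] := HV.
by have := mulr_ge0 (ltW C0) kappa0; have := small; lra.
Qed.

(** Up to a null set, [Xt S i t] is measurable with respect to the initial datum and noise of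
    particle i alone, and grouping these by particle gives independent sigma-algebras. *)
Lemma coupled_independent t : 0 <= t -> independent P (fun i => sigma_var (Xt S i t)).
Proof.
move=> t0.
pose F (k : 'I_N + 'I_N) : set (set (Defs.space S)) := match k with
  | inl i => sigma_var (X0 S i) | inr i => sigma_process (W S i) end.
have Fm l : F l `<=` measurable.
  case: l => i /=; first exact: (sigma_var_sub (@measurable_funPT _ _ _ _ (X0 S i))).
  apply: smallest_sub; first exact: sigma_algebra_measurable.
  by move=> U [s /= s0]; exact: (sigma_var_sub (@measurable_funPT _ _ _ _ (W S i s))).
have FI l : setI_closed (F l).
  case: l => i /=; first exact: sigma_var_setI.
  move=> U U'; rewrite /sigma_process.
  exact: (@measurableI _ (g_sigma_algebraType
    (\bigcup_(s in [set s : R | 0 <= s]) sigma_var (W S i s)))).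
have FT l : F l setT.
  case: l => i /=; first exact: sigma_var_setT.
  exact: (@measurableT _ (g_sigma_algebraType
    (\bigcup_(s in [set s : R | 0 <= s]) sigma_var (W S i s)))).
pose g (l : 'I_N + 'I_N) := match l with inl i => i | inr i => i end.
have ind := independent_group (g := g) Fm FI FT (@X0_W_independent _ _ _ _ _ _ _ _ _ _ S).
pose G i := \bigcup_(l in [set l | g l = i]) F l.
have Gm i : <<s G i >> `<=` measurable.
  apply: smallest_sub; first exact: sigma_algebra_measurable.
  by move=> U [l _]; exact: Fm.
have /choice[Y HY] : forall i, exists Yi : Defs.space S -> phase R d,
    sigma_var Yi `<=` <<s G i >> /\ {ae P, forall w, Xt S i t w = Yi w}.
  move=> i; apply: (solution_adapted al0 be0 la0 HV1 HV CA0 CB0 LA LB oB small128 fin0 finmu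
    (X0_law S i) (W_brownian S i) (Xt_solution S i) (Xt_law S i)) => //.
    by move=> U XU; apply: sub_gen_smallest; exists (inl i).
  move=> s s0 U WU; apply: sub_gen_smallest; exists (inr i) => //=.
  by apply: sub_gen_smallest; exists s.
apply: (@independent_ae _ _ _ _ _ P _ (fun i => Xt S i t) Y).
- by move=> i; exact: measurable_funPT.
- by move=> i _ U mU; apply: Gm; have [YG _] := HY i; apply: YG; exists U.
- by move=> i; have [] := HY i.
- by apply: sub_independent ind => i; have [] := HY i.
Qed.

Lemma coupled_moment i t : 0 <= t -> mean_le P (fun w => phase_sqnorm (Xt S i t w)) M0.
Proof.
exact: (uniform_moment al0 be0 la0 HV1 HV CA0 CB0 LA LB oB small128 fin0 finmu
    (X0_law S i) (W_brownian S i) (Xt_solution S i) (Xt_law S i)).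
Qed.

(** * Mean-square size of the fluctuation *)

Definition pair_fluctuation (s : R) (x y : phase R d) : 'rV[R]_d :=
  B (qof x - qof y) - convol B (mu s) (qof x).

Definition fluctuation (i : 'I_N) (s : R) (w : Defs.space S) : 'rV[R]_d :=
  N%:R^-1 *: \sum_(j < N) pair_fluctuation s (Xt S i s w) (Xt S j s w).

Lemma convol_measurable s (c : 'I_d) (i : 'I_N) : 0 <= s ->
  measurable_fun setT (fun q => convol B (mu s) q 0 c).
Proof.
move=> s0; apply: (@lipschitz_measurable _ _ (Num.sqrt (CB ^+ 2))).
  exact: sqrtr_ge0.
apply: sqnorm_lipschitz => [|u v]; first exact: sqr_ge0.
exact: (convol_lipschitz CB0 LB oB finmu (Xt_law S i)).
Qed.

Lemma pair_fluctuation_measurable (dT : measure_display) (T : measurableType dT)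
    (i : 'I_N) s (c : 'I_d) (x y : T -> phase R d) : 0 <= s ->
  measurable_fun setT x -> measurable_fun setT y ->
  measurable_fun setT (fun w => pair_fluctuation s (x w) (y w) 0 c).
Proof.
move=> s0 mx my.
have -> : (fun w => pair_fluctuation s (x w) (y w) 0 c) = (fun w =>
    B (qof (x w) - qof (y w)) 0 c - convol B (mu s) (qof (x w)) 0 c).
  apply/funext => w; rewrite /pair_fluctuation; move: (B _) (convol _ _ _) => u v.
  by rewrite !mxE.
apply: measurable_funB; first exact: (measurable_interaction CB0 LB).
apply: (measurableT_comp (convol_measurable c i s0)).
by apply: measurable_rVP => c'; have [] := measurable_phase_coord c' mx.
Qed.

Lemma pair_fluctuation_mean s i j : 0 <= s ->
  mean_le P (fun w => sqnorm (pair_fluctuation s (Xt S i s w) (Xt S j s w)))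
    (16 * CB ^+ 2 * M0).
Proof.
move=> s0; have MM0 := mean_le_ge0 (coupled_moment i s0).
have c2 : 0 <= CB ^+ 2 by exact: sqr_ge0.
(* 8 and 4 are the coefficients of |x|^2 and |y|^2 once both terms of the fluctuation are expanded;
   the last 4 comes from the moment in [convol_bound]. *)
have -> : 16 * CB ^+ 2 * M0 =
   8 * CB ^+ 2 * M0 + 4 * CB ^+ 2 * M0 + 4 * CB ^+ 2 * M0 by ring.
have c8 : 0 <= 8 * CB ^+ 2 by rewrite mulr_ge0.
have c4 : 0 <= 4 * CB ^+ 2 by rewrite mulr_ge0.
have c4M : 0 <= 4 * CB ^+ 2 * M0 by rewrite mulr_ge0.
apply: mean_le_dom (mean_leD (mean_leD (mean_leZ c8 (coupled_moment i s0))
  (mean_leZ c4 (coupled_moment j s0))) (mean_le_cst P c4M)) _ _ _.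
- apply: measurable_sum => c; apply: measurable_funX.
  by apply: (pair_fluctuation_measurable i c s0); exact: measurable_funPT.
- by move=> w; exact: sqnorm_ge0.
apply: aeW => w; rewrite /pair_fluctuation.
set x := Xt S i s w; set y := Xt S j s w.
have h1 := sqnormD (B (qof x - qof y)) (- convol B (mu s) (qof x)).
have h2 := odd_lipschitz_sqnorm CB0 LB oB (qof x - qof y).
have h3 := sqnormD (qof x) (- qof y).
have h4 := convol_bound CB0 LB oB (coupled_moment i s0) (Xt_law S i s0) (qof x).
have h5 := sqnorm_phase x; have h6 := sqnorm_phase y.
rewrite !sqnormN in h1 h3.
have h7 : CB ^+ 2 * sqnorm (qof x - qof y) <=
    CB ^+ 2 * (2 * phase_sqnorm x + 2 * phase_sqnorm y).
  by apply: ler_wpM2l => //; lra.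
have h8 := ler_wpM2l c2 h5.
by rewrite mulrDr in h7; lra.
Qed.

(** With the particles i and l frozen, the second factor is constant and the first is centred,
    because convolution with mu_s is the mean of the interaction with [Xt S j s]. Particle j is
    independent of the pair (i, l); l may equal i. *)
Lemma pair_fluctuation_orthogonal s i j l c : 0 <= s -> j != i -> j != l ->
  (\int[P]_w (pair_fluctuation s (Xt S i s w) (Xt S j s w) 0 c *
     pair_fluctuation s (Xt S i s w) (Xt S l s w) 0 c)%:E = 0)%E.
Proof.
move=> s0 ji jl.
pose U w := (Xt S i s w, Xt S l s w).
have mU : measurable_fun setT U by apply: measurable_fun_pair; exact: measurable_funPT.
pose Urv : {RV P >-> (phase R d * phase R d)%type} := mfun_Sub (mem_set mU).
have mxy j' : measurable_fun setT (fun w => pair_fluctuation s (Xt S i s w) (Xt S j' s w) 0 c).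
  by apply: (pair_fluctuation_measurable i c s0); exact: measurable_funPT.
have sqxy j' : mean_le P (fun w => pair_fluctuation s (Xt S i s w) (Xt S j' s w) 0 c ^+ 2)
    (16 * CB ^+ 2 * M0).
  apply: mean_le_dom (pair_fluctuation_mean i j' s0) _ _ _.
  - exact: measurable_funX.
  - by move=> w; exact: sqr_ge0.
  - by apply: aeW => w; exact: sqnorm_coord.
pose h (x : phase R d * phase R d * phase R d) : R :=
  pair_fluctuation s x.1.1 x.2 0 c * pair_fluctuation s x.1.1 x.1.2 0 c.
have mom := coupled_moment j s0.
have iB q : P.-integrable setT (EFin \o (fun w => B (q - qof (Xt S j s w)) 0 c)).
  exact: (interaction_integrable CB0 LB oB mom).
have iF u1 : P.-integrable setT (EFin \o (fun w => pair_fluctuation s u1 (Xt S j s w) 0 c)).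
  have := integrableB measurableT (iB (qof u1))
    (integrable_cstP P (convol B (mu s) (qof u1) 0 c)).
  congr (_.-integrable _ _); apply/funext => w /=; rewrite -EFinB; congr EFin.
  by rewrite /pair_fluctuation; move: (B _) (convol _ _ _) => u v; rewrite !mxE.
have F0 u1 : (\int[P]_w (pair_fluctuation s u1 (Xt S j s w) 0 c)%:E = 0)%E.
  rewrite -[LHS]fineK; last exact: (integrable_fin_num measurableT (iF u1)).
  congr EFin; rewrite -/(Rintegral _ _ _).
  transitivity (\int[P]_w (B (qof u1 - qof (Xt S j s w)) 0 c
     - cst (convol B (mu s) (qof u1) 0 c) w)).
    apply: eq_Rintegral => w _; rewrite /pair_fluctuation.
    by move: (B _) (convol _ _ _) => u v; rewrite !mxE.
  rewrite RintegralB//; last exact: integrable_cstP.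
  by rewrite Rintegral_cstP (convolE CB0 LB oB mom (Xt_law S j s0)) mxE subrr.
apply: (@independent_mean0 _ _ _ _ _ _ _ P Urv (Xt S j s) _ h).
- move=> D E mD mE.
  have [Xm XI XT] := sigma_var_pi (fun i => Xt S i s).
  have ind := independent_group (g := fun l => l == j) Xm XI XT (coupled_independent s0).
  apply: (independent2 ind (_ : false != true)) => //.
    suff : sigma_var U `<=` <<s \bigcup_(l in [set l | (l == j) = false]) sigma_var (Xt S l s) >>.
      by apply; exists D => //; rewrite setTI.
    apply: sigma_var_g_sigma.
    apply: measurable_fun_pair; apply: g_sigma_measurable_fun => Z XZ.
      by apply: sub_gen_smallest; exists i => //=; rewrite eq_sym (negbTE ji).
    by apply: sub_gen_smallest; exists l => //=; rewrite eq_sym (negbTE jl).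
  by apply: sub_gen_smallest; exists j => //=; [rewrite eqxx|exists E => //; rewrite setTI].
- apply: measurable_funM.
    apply: (pair_fluctuation_measurable i c s0); last exact: measurable_snd.
    exact: measurableT_comp measurable_fst measurable_fst.
  apply: (pair_fluctuation_measurable i c s0).
    exact: measurableT_comp measurable_fst measurable_fst.
  exact: measurableT_comp measurable_snd measurable_fst.
- exact: mean_le_mul_integrable (mxy j) (mxy l) (sqxy j) (sqxy l).
- move=> u; rewrite /h /=.
  have := integrableZr measurableT (pair_fluctuation s u.1 u.2 0 c) (iF u.1).
  by congr (_.-integrable _ _); apply/funext => w /=; rewrite EFinM.
- move=> u; rewrite /h /=; under eq_integral do rewrite EFinM.
  by rewrite integralZr//= ?F0 ?mul0e//; exact: iF.
Qed.

Lemma fluctuation_mean s i : 0 <= s ->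
  mean_le P (fun w => sqnorm (fluctuation i s w)) (d%:R * (16 * CB ^+ 2 * M0) / N%:R).
Proof.
move=> s0; have N0 : 0 < N%:R :> R by rewrite ltr0n (leq_ltn_trans _ (ltn_ord i)).
have -> : d%:R * (16 * CB ^+ 2 * M0) / N%:R =
   \sum_(c < d) (N%:R^-1 ^+ 2 * \sum_(j < N) (16 * CB ^+ 2 * M0)).
  move: (16 * _ * _) => K; rewrite !sumr_const !card_ord -[RHS]mulr_natl -[K *+ N]mulr_natl.
  by field; rewrite gt_eqF.
apply: (mean_le_sum (index_enum 'I_d)) => c.
have E w : fluctuation i s w 0 c ^+ 2 = N%:R^-1 ^+ 2 *
   (\sum_(j < N) pair_fluctuation s (Xt S i s w) (Xt S j s w) 0 c) ^+ 2.
  by rewrite /fluctuation mxE exprMn summxE.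
under [X in mean_le _ X]eq_fun do rewrite E.
apply: mean_leZ; first exact: sqr_ge0.
have mxy j : measurable_fun setT (fun w => pair_fluctuation s (Xt S i s w) (Xt S j s w) 0 c).
  by apply: (pair_fluctuation_measurable i c s0); exact: measurable_funPT.
apply: mean_le_orthogonal_sum => //.
  move=> j; apply: mean_le_dom (pair_fluctuation_mean i j s0) _ _ _.
  - exact: measurable_funX.
  - by move=> w; exact: sqr_ge0.
  - by apply: aeW => w; exact: sqnorm_coord.
(* Of two distinct indices at least one differs from i, and that one is averaged out. *)
move=> j l jl; have [ji|ji] := eqVneq j i; last exact: pair_fluctuation_orthogonal.
under eq_integral do rewrite mulrC.
by apply: pair_fluctuation_orthogonal => //; rewrite eq_sym// -ji.
Qed.

(** * Recursion and bounds for the gap *)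

Let gap i t (w : Defs.space S) := X S i t w - Xt S i t w.
Let gap_avg t w := average (fun i => phase_sqnorm (gap i t w)).

Lemma fluctuationE i s w :
  fluctuation i s w = mean_field B (fun j => qof (Xt S j s w)) i - convol B (mu s) (qof (Xt S i s w)).
Proof.
have N0 : 0 < N%:R :> R by rewrite ltr0n (leq_ltn_trans _ (ltn_ord i)).
rewrite /fluctuation /pair_fluctuation /mean_field sumrB scalerBr; congr (_ - _).
by rewrite sumr_const card_ord -[X in _ *: X]scaler_nat scalerA mulVf ?scale1r// gt_eqF.
Qed.

Let gap_force i s w : 'rV[R]_d :=
  (- A (qof (X S i s w)) - mean_field B (fun j => qof (X S j s w)) i)
    - force A B mu s (qof (Xt S i s w)).

Lemma gap_path : {ae P, forall w, forall i,
  [/\ gap i 0 w = 0,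
   langevin_path al be la (fun t => gap i t w) (fun s => gap_force i s w)
     (fun t => W S i t w - W S i t w)
   & {within [set t : R | 0 <= t], continuous (fun t => Xt S i t w)}]}.
Proof.
apply: filter_forall => i.
have [W0 _ _ _] := W_brownian S i.
have h1 := langevin_solution_path W0 (X_solution S i).
have h2 := langevin_solution_path W0 (Xt_solution S i).
apply: filterS2 h1 h2 => w [x0 _ xP] [y0 _ yP]; split.
- by rewrite /gap x0 y0 subrr.
- exact: langevin_pathB xP yP.
- by case: yP.
Qed.

Lemma gap_force_bound i s w : 0 <= s ->
  sqnorm (gap_force i s w) <=
  8 * kappa * (sqnorm (qof (gap i s w)) + average (fun j => sqnorm (qof (gap j s w))))
  + 2 * sqnorm (fluctuation i s w).
Proof.
move=> s0.
pose q j := qof (X S j s w); pose q' j := qof (Xt S j s w).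
have -> : gap_force i s w = - (A (q i) - A (q' i))
    - (mean_field B q i - mean_field B q' i) - fluctuation i s w.
  rewrite fluctuationE /gap_force /force -/(q i) -/(q' i) -/q -/q'.
  move: (A _) (A _) (mean_field _ _ _) (mean_field _ _ _) (convol _ _ _) => a1 a2 a3 a4 a5.
  by apply/rowP => c; rewrite !mxE; ring.
apply: le_trans (sqnormD _ _) _; rewrite sqnormN lerD2r.
have -> : 8 * kappa = 2 * (4 * kappa) by ring.
rewrite -mulrA; apply: ler_wpM2l => //.
apply: le_trans (sqnormD _ _) _; rewrite !sqnormN.
have a1 := lipschitz_sqnorm CA0 LA (q i) (q' i).
have a2 := mean_field_lipschitz q q' i CB0 LB.
have a3 : 0 <= average (fun j => sqnorm (q j - q' j)).
  by apply: average_ge0 => j; exact: sqnorm_ge0.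
have -> : qof (gap i s w) = q i - q' i by [].
have -> : (fun j => sqnorm (qof (gap j s w))) = (fun j => sqnorm (q j - q' j)) by [].
have a4 := sqnorm_ge0 (q i - q' i).
have a5 := mulr_ge0 (sqr_ge0 CA) a3; have a6 := mulr_ge0 (sqr_ge0 CA) a4.
lra.
Qed.

(** It lets the recursion involve the fluctuation at grid times only, where its mean square is
    known. *)
Lemma fluctuation_time i w s u r : 0 <= s -> s <= u -> 0 <= r ->
  (forall j, ball (Xt S j s w) r (Xt S j u w)) ->
  sqnorm (fluctuation i u w - fluctuation i s w) <=
  12 * CB ^+ 2 * (d%:R * r ^+ 2) + 8 * CB ^+ 2 * M0 * (u - s) ^+ 2.
Proof.
move=> s0 su r0 osc; have u0 := le_trans s0 su.
pose q j := qof (Xt S j u w); pose q' j := qof (Xt S j s w).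
have -> : fluctuation i u w - fluctuation i s w = (mean_field B q i - mean_field B q' i)
   - ((convol B (mu u) (q i) - convol B (mu u) (q' i))
      + (convol B (mu u) (q' i) - convol B (mu s) (q' i))).
  rewrite !fluctuationE -/(q i) -/(q' i) -/q -/q'.
  move: (mean_field _ _ _) (mean_field _ _ _) (convol _ _ _) (convol _ _ _) (convol _ _ _).
  by move=> a1 a2 a3 a4 a5; apply/rowP => c; rewrite !mxE; ring.
have a0 j : sqnorm (q j - q' j) <= d%:R * r ^+ 2 by exact: sqnorm_ball (osc j).
have a1 := mean_field_lipschitz q q' i CB0 LB.
have a2 := convol_lipschitz CB0 LB oB finmu (Xt_law S i) (q i) (q' i) u0.
have a3 := convol_time al0 be0 la0 HV1 HV CA0 CB0 LA LB oB small128 fin0 finmu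
    (X0_law S i) (W_brownian S i) (Xt_solution S i) (Xt_law S i) (q' i) s0 su.
have a4 : average (fun j => sqnorm (q j - q' j)) <= d%:R * r ^+ 2.
  by rewrite -[leRHS](average_cst i); exact: average_le.
apply: le_trans (sqnormD _ _) _; rewrite sqnormN.
have a5 := sqnormD (convol B (mu u) (q i) - convol B (mu u) (q' i))
  (convol B (mu u) (q' i) - convol B (mu s) (q' i)).
have cb := sqr_ge0 CB.
have a6 := ler_wpM2l cb (a0 i); have a7 := ler_wpM2l cb a4.
lra.
Qed.

(** The gap has zero net noise, so it is tracked by the scheme that stays at 0. One mesh must serve
    all N particles at once, since the force on each involves every other gap. *)
Lemma gap_recursion (i0 : 'I_N) t : 0 < t -> {ae P, forall w, forall e, 0 < e ->
  exists n0, forall n, (n0 <= n)%N -> let h := t / n%:R in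
  forall i, gap i 0 w = 0 /\ forall j, (j < n)%N ->
    V (gap i (j.+1%:R * h) w) <= (1 - k * h) * V (gap i (j%:R * h) w)
     + h * (64 * C * kappa * (phase_sqnorm (gap i (j%:R * h) w) + gap_avg (j%:R * h) w)
            + 16 * C * sqnorm (fluctuation i (j%:R * h) w) + e)}.
Proof.
move=> t0; have [m0 M00 k0 C0 h00 kh0 Vge Vle Vst] := HV.
apply: filterS gap_path => w H e e0.
suff : \forall n \near \oo, forall i : 'I_N, let h := t / n%:R in
  forall j, (j < n)%N ->
    V (gap i (j.+1%:R * h) w) <= (1 - k * h) * V (gap i (j%:R * h) w)
     + h * (64 * C * kappa * (phase_sqnorm (gap i (j%:R * h) w) + gap_avg (j%:R * h) w)
            + 16 * C * sqnorm (fluctuation i (j%:R * h) w) + e).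
  move=> [n0 _ Hn]; exists n0 => n n0n /= i; split; first by have [] := H i.
  by move=> j jn; apply: Hn.
apply: filter_forall => i; have [_ xP _] := H i.
have e20 : 0 < e / 2 by rewrite divr_gt0.
have [n1 tr] := tracking al0 be0 la0 HV xP t0 e20.
have MM0 : 0 <= M0 := mean_le_ge0 (coupled_moment i (lexx 0)).
pose K := 4 * C * (32 * kappa * d%:R + 48 * CB ^+ 2 * d%:R).
pose K' := 4 * C * (32 * CB ^+ 2 * M0).
have e40 : 0 < e / 4 by rewrite divr_gt0.
have C40 : 0 <= 4 * C by rewrite mulr_ge0// ltW.
have K0 : 0 <= K.
  apply: mulr_ge0 => //; apply: addr_ge0; first by rewrite mulr_ge0// mulr_ge0.
  by rewrite mulr_ge0// mulr_ge0// sqr_ge0.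
have K'0 : 0 <= K' by rewrite mulr_ge0// mulr_ge0// mulr_ge0// sqr_ge0.
have [r r0 rP] := sqr_small K0 e40; have [r' r'0 r'P] := sqr_small K'0 e40.
have osc1 : \forall n \near \oo, forall l, oscillation_le (fun s => gap l s w) t r n.
  apply: filter_forall => l; have [_ [cx _] _] := H l.
  by have [n2 Hn2] := partition_oscillation cx t0 r0; exists n2 => // n /= /Hn2.
have osc2 : \forall n \near \oo, forall l, oscillation_le (fun s => Xt S l s w) t r n.
  apply: filter_forall => l; have [_ _ cx] := H l.
  by have [n2 Hn2] := partition_oscillation cx t0 r0; exists n2 => // n /= /Hn2.
near=> n; move=> h j jn.
have o1 : forall l, oscillation_le (fun s => gap l s w) t r n by near: n.
have o2 : forall l, oscillation_le (fun s => Xt S l s w) t r n by near: n.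
have [n0 _] := o1 i0.
have nn1 : (n1 <= n)%N by near: n; exact: nbhs_infty_ge.
have nR : 0 < n%:R :> R by rewrite ltr0n.
have h_gt0 : 0 < h by rewrite divr_gt0.
have hr' : h <= r'.
  rewrite /h ler_pdivrMr// mulrC -ler_pdivrMr//.
  by near: n; exact: nbhs_infty_ger.
have [_ hh0] := tr n nn1; rewrite -/h => {}tr.
pose x := gap i (j%:R * h) w; pose xbar := gap_avg (j%:R * h) w.
pose F := fluctuation i (j%:R * h) w.
(* The factor 4 C of [tracking] turns 16 kappa and 4 into the 64 C kappa and 16 C of the statement;
   the terms in r and h are absorbed into e. *)
pose phi := 16 * kappa * (phase_sqnorm x + xbar) + 4 * sqnorm F
   + 32 * kappa * d%:R * r ^+ 2 + (48 * CB ^+ 2 * d%:R * r ^+ 2 + 32 * CB ^+ 2 * M0 * h ^+ 2).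
have j0 : 0 <= j%:R * h by rewrite mulr_ge0// ltW.
have r20 := sqr_ge0 r; have h20 := sqr_ge0 h; have cb := sqr_ge0 CB.
have xbar0 : 0 <= xbar by apply: average_ge0 => l; exact: phase_sqnorm_ge0.
have jS : j.+1%:R * h = j%:R * h + h by rewrite -natr1 mulrDl mul1r.
have fbound s : j%:R * h <= s <= j.+1%:R * h -> sqnorm (gap_force i s w) <= phi.
  move=> js; have /andP[j_s s_j] := js; have s0 := le_trans j0 j_s.
  have Fs := fluctuation_time i j0 j_s (ltW r0) (fun l => (o2 l).2 j s jn js).
  have sh : (s - j%:R * h) ^+ 2 <= h ^+ 2.
    by rewrite ler_sqr ?nnegrE ?subr_ge0 ?(ltW h_gt0)// lerBlDl -jS.
  have gs l : sqnorm (qof (gap l s w)) <=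
      2 * phase_sqnorm (gap l (j%:R * h) w) + 2 * (d%:R * r ^+ 2).
    have h1 := sqnorm_ball ((o1 l).2 j s jn js).
    have h2 := sqnormD (qof (gap l (j%:R * h) w)) (qof (gap l s w) - qof (gap l (j%:R * h) w)).
    rewrite addrC subrK in h2; apply: le_trans h2 _.
    by apply: lerD; apply: ler_wpM2l => //; exact: sqnorm_phase.
  have ga : average (fun l => sqnorm (qof (gap l s w))) <= 2 * xbar + 2 * (d%:R * r ^+ 2).
    apply: le_trans (average_le gs) _.
    by rewrite averageD averageZ (average_cst i).
  apply: le_trans (gap_force_bound i w s0) _.
  have h1 := sqnormD F (fluctuation i s w - F); rewrite addrC subrK in h1.
  have h2 := ler_wpM2l kappa0 (lerD (gs i) ga); rewrite -/x in h2.
  have cM : 0 <= CB ^+ 2 * M0 by exact: mulr_ge0.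
  have h3 := ler_wpM2l cM sh.
  rewrite /phi -/F in Fs *.
  move: (sqnorm (fluctuation i s w)) (sqnorm (fluctuation i s w - F)) (sqnorm F) (average _)
    (sqnorm (qof _)) h1 h2 h3 Fs => f1 f2 f3 f4 f5.
  move: (phase_sqnorm x) => f6; lra.
have st0 : step al be la h 0 0 0 0 (W S i (j.+1%:R * h) w - W S i (j.+1%:R * h) w
    - (W S i (j%:R * h) w - W S i (j%:R * h) w)).
  move=> c; rewrite !subrr /qof /pof /zof /= !mxE !mulr0 !normr_le0.
  by split; apply/eqP; ring.
have phi0 : 0 <= phi.
  apply: le_trans (sqnorm_ge0 _) (fbound (j%:R * h) _).
  by rewrite lexx jS lerDl ltW.
have := tr j 0 0 0 0 phi jn (lexx 0) phi0 st0.
rewrite expr0n/= addr0 !subr0 => /(_ _)/le_trans; apply.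
  by move=> s js; rewrite subr0; exact: fbound.
rewrite lerD2l; apply: ler_wpM2l; first exact: ltW.
have h1 := rP r (ltW r0) (lexx _); have h2 := r'P h (ltW h_gt0) hr'.
rewrite -/x -/xbar -/F /phi; rewrite /K in h1; rewrite /K' in h2.
move: h1 h2; lra.
Unshelve. all: by end_near. Qed.

Local Notation KF := (d%:R * (16 * CB ^+ 2 * M0) / N%:R).

Lemma measurable_gap i t : measurable_fun setT (fun w => phase_sqnorm (gap i t w)).
Proof.
apply: measurable_phase_sqnorm; apply: measurable_phaseP => c; rewrite /gap.
have [q p z] := measurable_phase_coord c (@measurable_funPT _ _ _ _ (X S i t)).
have [q' p' z'] := measurable_phase_coord c (@measurable_funPT _ _ _ _ (Xt S i t)).
by split; under eq_fun do rewrite phaseDE !mxE; exact: measurable_funB.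
Qed.

Let phase_lyap0 : V 0 = 0.
Proof.
have [_ _ _ _ _ _ Vge Vle _] := HV; apply/eqP; rewrite eq_le.
by have := Vge 0; have := Vle 0; rewrite phase_sqnorm0 !mulr0 => -> ->.
Qed.

(** Averaging closes the system: the gap of particle i and the average gap both become the average.
    Their total cost 128 C kappa is at most half of the dissipation, so only the fluctuation remains
    as a source. *)
Lemma average_gap_mean (i0 : 'I_N) t : 0 < t -> mean_le P (fun w => m * gap_avg t w) (32 * C * KF / k).
Proof.
have [m0 M00 k0 C0 h00 kh0 Vge Vle Vst] := HV.
move=> t0.
have mg : measurable_fun setT (fun w => m * gap_avg t w).
  apply: measurable_funM => //; apply: measurable_funM => //.
  by apply: measurable_sum => i; exact: measurable_gap.
have pos w : 0 <= m * gap_avg t w.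
  by rewrite mulr_ge0 ?(ltW m0)// average_ge0// => i; exact: phase_sqnorm_ge0.
pose Sn n j w := average (fun i => V (gap i (j%:R * (t / n%:R)) w)).
pose G n j w := 16 * C * average (fun i => sqnorm (fluctuation i (j%:R * (t / n%:R)) w)).
have k20 : 0 < k / 2 by rewrite divr_gt0.
have KFm n j : (1 <= n)%N -> (j < n)%N -> mean_le P (G n j) (16 * C * KF).
  move=> n0 _; have jh : 0 <= j%:R * (t / n%:R) by rewrite mulr_ge0// divr_ge0// ltW.
  apply: mean_leZ; first by rewrite mulr_ge0// ltW.
  rewrite -[X in mean_le _ _ X](average_cst i0).
  apply: mean_leZ; first by rewrite invr_ge0.
  apply: (mean_le_sum (index_enum 'I_N)) => i.
  exact: fluctuation_mean.
have -> : 32 * C * KF / k = 0 + 16 * C * KF / (k / 2) + 0.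
  by move: KF => X; field; rewrite gt_eqF.
apply: (@mean_le_gronwall _ _ _ P (k / 2) t 0 (16 * C * KF) 0 1%N Sn (fun=> 0)
  (fun w => m * gap_avg t w) G (fun _ _ => 0)) => //.
- exact: ltW.
- exact: mean_le_cst.
- by move=> n _; exact: mean_le_cst.
apply: filterS (gap_recursion i0 t0) => w H e e0; have [n0 Hn] := H e e0.
exists (maxn n0 1) => n; rewrite geq_max => /andP[/Hn{}Hn n1].
have nR : 0 < n%:R :> R by rewrite ltr0n.
have h0' : 0 < t / n%:R by rewrite divr_gt0.
split.
- by rewrite /Sn /average big1 ?mulr0// => i _; rewrite mul0r (Hn i).1 phase_lyap0.
- move=> j jn.
  have := average_le (fun i => (Hn i).2 j jn).
  rewrite averageD !averageZ 2!averageD !averageZ averageD !(average_cst i0).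
  rewrite -/(Sn n j.+1 w) -/(Sn n j w) -/(G n j w) -/(gap_avg (j%:R * (t / n%:R)) w).
  move=> /le_trans; apply; rewrite -subr_ge0.
  set g := gap_avg _ _; set h := t / n%:R.
  have -> : (1 - k / 2 * h) * Sn n j w + h * (G n j w + e)
     - ((1 - k * h) * Sn n j w + h * (64 * C * kappa * (g + g) + G n j w + e))
     = h * (k / 2 * Sn n j w - 128 * C * kappa * g) by field.
  apply: mulr_ge0; first exact: ltW.
  rewrite subr_ge0; apply: (@le_trans _ _ (k / 2 * (m * g))).
    have g0 : 0 <= g by apply: average_ge0 => i; exact: phase_sqnorm_ge0.
    by have := ler_wpM2r g0 small; lra.
  apply: ler_wpM2l; first exact: ltW.
  by rewrite -averageZ; apply: average_le => i; exact: Vge.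
- rewrite addr0; apply: le_trans (_ : Sn n n w <= _); last by rewrite lerDl ltW.
  rewrite /Sn [n%:R * _]mulrC divfK ?gt_eqF// -averageZ; apply: average_le => i; exact: Vge.
Qed.

(** The average gap, already bounded at all times, is now a source of order 1 / N like the
    fluctuation, and a second Gronwall argument treats the fixed particle. *)
Lemma gap_mean i t : 0 <= t ->
  mean_le P (fun w => phase_sqnorm (gap i t w))
    (2 / (k * m) * (64 * C * kappa * (32 * C / (k * m)) + 16 * C) * KF).
Proof.
have [m0 M00 k0 C0 h00 kh0 Vge Vle Vst] := HV.
have fl s : 0 <= s -> forall j, mean_le P (fun w => sqnorm (fluctuation j s w)) KF.
  move=> s0 j.
  exact: fluctuation_mean.
have KF0 : 0 <= KF := mean_le_ge0 (fl 0 (lexx 0) i).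
set K1 := 32 * C / (k * m).
have km0 : 0 < k * m by rewrite mulr_gt0.
have Ck : 0 <= 64 * C * kappa by rewrite mulr_ge0// mulr_ge0// ltW.
have C16 : 0 <= 16 * C by rewrite mulr_ge0// ltW.
have K10 : 0 <= K1 by rewrite divr_ge0 ?mulr_ge0// ltW.
have K20 : 0 <= 2 / (k * m) * (64 * C * kappa * K1 + 16 * C) * KF.
  apply: mulr_ge0 => //; apply: mulr_ge0; first by rewrite divr_ge0// ltW.
  by apply: addr_ge0 => //; exact: mulr_ge0.
rewrite le_eqVlt => /predU1P[<-|t0].
  apply: mean_le_dom (mean_le_cst P K20) (measurable_gap i 0) _ _.
    by move=> w; exact: phase_sqnorm_ge0.
  apply: filterS gap_path => w H; have [-> _ _] := H i.
  have := lyap_ge HV 0; rewrite phase_lyap0.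
  by rewrite pmulr_rle0// => /le_trans; apply.
pose Sn n j w := V (gap i (j%:R * (t / n%:R)) w).
pose G n j w := 64 * C * kappa * gap_avg (j%:R * (t / n%:R)) w
  + 16 * C * sqnorm (fluctuation i (j%:R * (t / n%:R)) w).
have k20 : 0 < k / 2 by rewrite divr_gt0.
pose K := 64 * C * kappa * (K1 * KF) + 16 * C * KF.
have Gm n j : (1 <= n)%N -> (j < n)%N -> mean_le P (G n j) K.
  move=> n0 _; have nR : 0 < n%:R :> R by rewrite ltr0n.
  have jh : 0 <= j%:R * (t / n%:R) by rewrite mulr_ge0// divr_ge0// ltW.
  apply: mean_leD; last by apply: mean_leZ => //; exact: fl.
  apply: mean_leZ => //.
  (* The bound on the average is stated for positive times; at time 0 the gaps vanish almost
     surely. *)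
  have [j0|j0] := posnP j.
    rewrite j0 mul0r.
    have K1F : 0 <= K1 * KF by exact: mulr_ge0.
    apply: mean_le_dom (mean_le_cst P K1F) _ _ _.
    - apply: measurable_funM => //; apply: measurable_sum => l; exact: measurable_gap.
    - by move=> w; apply: average_ge0 => l; exact: phase_sqnorm_ge0.
    - apply: filterS gap_path => w H; rewrite /gap_avg /average big1 ?mulr0// => l _.
      have [-> _ _] := H l; apply/eqP; rewrite eq_le phase_sqnorm_ge0 andbT.
      by have := lyap_ge HV 0; rewrite phase_lyap0 pmulr_rle0.
  have jt : 0 < j%:R * (t / n%:R) by rewrite mulr_gt0 ?divr_gt0 ?ltr0n.
  have m10 : 0 <= m^-1 by rewrite invr_ge0 ltW.
  have := mean_leZ m10 (average_gap_mean i jt).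
  under [X in mean_le P X]eq_fun do rewrite mulKf ?gt_eqF//.
  by congr (mean_le _ _ _); rewrite /K1; move: KF => z; field; rewrite !gt_eqF.
have gr : mean_le P (fun w => m * phase_sqnorm (gap i t w)) (0 + K / (k / 2) + 0).
  apply: (@mean_le_gronwall _ _ _ P (k / 2) t 0 K 0 1%N Sn (fun=> 0) _ G (fun _ _ => 0)) => //.
  - exact: ltW.
  - by apply: measurable_funM => //; exact: measurable_gap.
  - by move=> w; rewrite mulr_ge0 ?phase_sqnorm_ge0// ltW.
  - exact: mean_le_cst.
  - by move=> n _; exact: mean_le_cst.
  apply: filterS (gap_recursion i t0) => w H e e0; have [n0 Hn] := H e e0.
  exists (maxn n0 1) => n; rewrite geq_max => /andP[/Hn{}Hn n1].
  have nR : 0 < n%:R :> R by rewrite ltr0n.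
  have h0' : 0 < t / n%:R by rewrite divr_gt0.
  have [x0 rec] := Hn i; split.
  - by rewrite /Sn mul0r x0 phase_lyap0.
  - move=> j jn; apply: le_trans (rec j jn) _.
    rewrite -/(Sn n j w) /G.
    set g := gap_avg _ _; set h := t / n%:R; set x := phase_sqnorm _; set f := sqnorm _.
    rewrite -subr_ge0.
    have -> : (1 - k / 2 * h) * Sn n j w + h * (64 * C * kappa * g + 16 * C * f + e)
       - ((1 - k * h) * Sn n j w + h * (64 * C * kappa * (x + g) + 16 * C * f + e))
       = h * (k / 2 * Sn n j w - 64 * C * kappa * x) by field.
    apply: mulr_ge0; first exact: ltW.
    rewrite subr_ge0; apply: (@le_trans _ _ (k / 2 * (m * x))).
      have x_ge0 : 0 <= x by exact: phase_sqnorm_ge0.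
      have := ler_wpM2r x_ge0 small; have := mulr_ge0 Ck x_ge0; lra.
    by apply: ler_wpM2l; [exact: ltW|exact: Vge].
  - rewrite addr0; apply: le_trans (_ : Sn n n w <= _); last by rewrite lerDl ltW.
    by rewrite /Sn [n%:R * _]mulrC divfK ?gt_eqF//; exact: Vge.
have m10 : 0 <= m^-1 by rewrite invr_ge0 ltW.
have := mean_leZ m10 gr.
under [X in mean_le P X]eq_fun do rewrite mulKf ?gt_eqF//.
congr (mean_le _ _ _); rewrite /K; move: KF => z; field.
by rewrite !gt_eqF.
Qed.

End coupling.

(** * Propagation of chaos *)

Lemma tuple_ball_measurable (R : realType) (d k : nat) (U : set (k.-tuple (phase R d))) :
  (forall x, U x -> exists2 e : R, 0 < e & forall y,
    (forall i, ball (tnth x i) e (tnth y i)) -> U y) -> measurable U.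
Proof.
move=> HU; pose J := ('I_k * ('I_d + ('I_d + 'I_d)))%type.
pose x (j : J) (w : k.-tuple (phase R d)) : R :=
  match j.2 with
  | inl c => qof (tnth w j.1) 0 c
  | inr (inl c) => pof (tnth w j.1) 0 c
  | inr (inr c) => zof (tnth w j.1) 0 c
  end.
apply: (@measurable_of_coordinates R _ _ J x) => [[i j]|w Uw].
  have mi : measurable_fun setT (fun w : k.-tuple (phase R d) => tnth w i).
    exact: measurable_tnth.
  case: j => [c|[c|c]]; rewrite /x /=; by have [] := measurable_phase_coord c mi.
have [e e0 He] := HU w Uw; exists e => // w' ww'; apply: He => i.
split; first split; split=> // i1 c; rewrite (ord1 i1).
- exact: (ww' (i, inl c)).
- exact: (ww' (i, inr (inl c))).
- exact: (ww' (i, inr (inr c))).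
Qed.

Lemma continuous_tnth_measurable (R : realType) (d k : nat)
    (f : {ptws 'I_k -> phase R d} -> R) :
  continuous f -> measurable_fun setT (fun x : k.-tuple (phase R d) => f (tnth x)).
Proof.
move=> cf; apply: (measurability _ (RGenOInfty.measurableE R)) => //.
move=> _ [_ [a ->] <-]; rewrite setTI; apply: tuple_ball_measurable => w /=.
rewrite in_itv/= andbT => aw.
have Ha : nbhs (f (tnth w)) [set y | a < y].
  by apply: open_nbhs_nbhs; split => //; exact: open_gt.
have [e e0 He] := ptws_nbhs_ball (cf _ _ Ha).
by exists e => // w' ww'; rewrite in_itv/= andbT; apply: He.
Qed.

Lemma independent_inj (R : realType) (dO : measure_display) (Omega : measurableType dO)
    (P : probability Omega R) (I J : finType) (f : J -> I) (F : I -> set (set Omega)) :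
  injective f -> independent P F -> independent P (F \o f).
Proof.
move=> fI /independentP ind; apply/independentP => s E us sE.
pose E' i := if [pick j | f j == i] is Some j then E j else setT.
have E'f j : E' (f j) = E j.
  rewrite /E'; case: pickP => [j' /eqP/fI ->//|/(_ j)]; by rewrite eqxx.
have := ind [seq f j | j <- s] E'; rewrite !big_map map_inj_uniq// => /(_ us).
under eq_bigr do rewrite E'f; under [in RHS]eq_bigr do rewrite E'f.
apply=> _ /mapP[j js ->]; rewrite E'f; exact: sE.
Qed.

(** Induction on k: the first variable is independent of the sigma-algebra of the others, so the law
    of (head, tail) has product form on rectangles and is therefore the product measure. *)
Lemma joint_law_power (R : realType) (dO dT : measure_display) (Omega : measurableType dO)
    (T : measurableType dT) (P : probability Omega R) (m : probability T R) (k : nat)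
    (Y : 'I_k -> {RV P >-> T}) :
  independent P (fun j => sigma_var (Y j)) -> (forall j, has_law (Y j) m) ->
  forall U, measurable U -> joint_law Y U = power_measure m k U.
Proof.
elim: k Y => [|k IH] Y ind law U mU.
  have E w : joint_variable Y w = [tuple] by apply: val_inj; case: (joint_variable Y w) => [[]].
  transitivity (P (joint_variable Y @^-1` U)) => //; rewrite /= diracE.
  have [Un|Un] := boolP ([tuple] \in U).
    have -> : joint_variable Y @^-1` U = setT.
      by apply/seteqP; split=> // w _ /=; rewrite E; exact: set_mem.
    by rewrite probability_setT.
  have -> : joint_variable Y @^-1` U = set0.
    by apply/seteqP; split=> // w /=; rewrite E => /mem_set; rewrite (negbTE Un).
  by rewrite measure0.
pose Z j := Y (lift ord0 j).
have indZ : independent P (fun j => sigma_var (Z j)).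
  exact: (independent_inj (@lift_inj _ ord0) ind).
have lawZ := IH Z indZ (fun j => law _).
pose UV w := (Y ord0 w, joint_variable Z w).
have mUV : measurable_fun setT UV by exact: measurable_fun_pair.
pose UVrv : {RV P >-> (T * k.-tuple T)%type} := mfun_Sub (mem_set mUV).
have mV : measurable (@cons_pair _ T k @^-1` U).
  by rewrite -[X in measurable X]setTI; exact: measurable_funPT.
transitivity (distribution P UVrv (@cons_pair _ T k @^-1` U)).
  rewrite /joint_law /distribution /pushforward /=; congr (P _).
  apply/funext => w /=; congr (U _); apply: eq_from_tnth => j.
  rewrite tnth_mktuple; case: (unliftP ord0 j) => [j'|] ->.
    transitivity (tnth (joint_variable Z w) j'); first by rewrite tnth_mktuple.
    by rewrite !(tnth_nth (Y ord0 w)).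
  by rewrite (tnth_nth (Y ord0 w)).
transitivity ((m \x power_measure m k)%E (@cons_pair _ T k @^-1` U)) => //.
apply/esym/product_measure_unique => // D E mD mE.
have [Xm XI XT] := sigma_var_pi Y.
have indg := independent_group (g := fun l => l == ord0) Xm XI XT ind.
transitivity (P (Y ord0 @^-1` D) * P (joint_variable Z @^-1` E))%E; last first.
  by congr (_ * _)%E; [exact: law|exact: lawZ].
apply: (independent2 indg (_ : true != false)) => //.
  by apply: sub_gen_smallest; exists ord0 => //=; exists D => //; rewrite setTI.
suff : sigma_var (joint_variable Z) `<=`
    <<s \bigcup_(l in [set l | (l == ord0) = false]) sigma_var (Y l) >>.
  by apply; exists E => //; rewrite setTI.
apply: sigma_var_g_sigma; apply/measurable_fun_tnthP => j.
rewrite (_ : _ \o _ = Z j); last by apply/funext => w /=; rewrite tnth_mktuple.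
apply: g_sigma_measurable_fun => A XA; apply: sub_gen_smallest.
by exists (lift ord0 j).
Qed.

Section steady.
Context (R : realType) (d k : nat) (f : {ptws 'I_k -> phase R d} -> R).
Hypothesis cf : continuous f.

(* The strict inequality [r < r'] makes this set open. *)
Definition steady (e r : R) : set (k.-tuple (phase R d)) :=
  [set x | exists2 r', r < r' & forall y y' : k.-tuple (phase R d),
    (forall i, ball (tnth x i) r' (tnth y i)) ->
    (forall i, ball (tnth x i) r' (tnth y' i)) -> `|f (tnth y) - f (tnth y')| <= e].

Lemma steady_measurable e r : measurable (steady e r).
Proof.
apply: tuple_ball_measurable => x [r' rr' H].
exists ((r' - r) / 2); first by rewrite divr_gt0// subr_gt0.
move=> x' xx'; exists (r' - (r' - r) / 2); first by lra.
have tri z : (forall i, ball (tnth x' i) (r' - (r' - r) / 2) (tnth z i)) ->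
    forall i, ball (tnth x i) r' (tnth z i).
  by move=> zx i; have := ball_triangle (xx' i) (zx i); rewrite addrC subrK.
by move=> y y' yx yx'; exact: H (tri _ yx) (tri _ yx').
Qed.

(** Continuity of f at each point makes the complements decrease to the empty set, and the measure
    is continuous from above. This replaces uniform continuity of f. *)
Lemma steady_eventually (m : probability (k.-tuple (phase R d)) R) (e p : R) :
  0 < e -> 0 < p -> exists n, (m (~` steady e n.+1%:R^-1) <= p%:E)%E.
Proof.
move=> e0 p0; pose F n := ~` steady e n.+1%:R^-1.
have mF n : measurable (F n) by apply: measurableC; exact: steady_measurable.
have F0 : \bigcap_n F n = set0.
  apply/seteqP; split=> // x Fx.
  have [r r0 H] := ptws_nbhs_ball (cf (nbhsx_ballx (f (tnth x)) _ (divr_gt0 e0 (ltr0n R 2)))).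
  apply: (Fx (Num.truncn r^-1)) => //.
  exists r.
    by rewrite invf_plt ?posrE//; apply: truncnS_gt.
  move=> y y' /H /= yx /H /= yx'; rewrite /ball/= in yx yx'.
  rewrite (_ : f (tnth y) - f (tnth y') =
    (f (tnth x) - f (tnth y')) - (f (tnth x) - f (tnth y))); last by ring.
  by apply: le_trans (ler_normB _ _) _; lra.
have := @nonincreasing_cvg_mu _ _ _ m F; rewrite F0 measure0.
have fin : (m (F 0%N) < +oo)%E by rewrite ltey_eq fin_num_measure.
have dec : nonincreasing_seq F.
  move=> i j ij; apply/subsetPset/subsetC => x [r' rr' H]; exists r' => //.
  by apply: le_lt_trans rr'; rewrite lef_pV2 ?posrE ?ltr0n// ler_nat ltnS.
move=> /(_ fin mF measurable0 dec) mF0.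
have /fine_cvgP[_ /cvgrPdist_le/(_ p p0)[n _ Hn]] := mF0.
exists n; have := Hn n (leqnn n); rewrite sub0r normrN => h.
rewrite -/(F n) -[m (F n)]fineK ?fin_num_measure// lee_fin.
by apply: le_trans h; exact: ler_norm.
Qed.

Context (M : R).
Hypotheses (M0 : 0 <= M) (fM : forall x, `|f x| <= M).

Lemma joint_law_integral (dO : measure_display) (Omega : measurableType dO)
    (P : probability Omega R) (X : 'I_k -> {RV P >-> phase R d}) :
  P.-integrable setT (EFin \o (fun w => f (tnth (joint_variable X w)))) /\
  \int[joint_law X]_x f (tnth x) = \int[P]_w f (tnth (joint_variable X w)).
Proof.
have mf := continuous_tnth_measurable cf.
have mfX : measurable_fun setT (fun w => f (tnth (joint_variable X w))).
  by apply: (measurableT_comp mf); exact: measurable_funPT.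
have iX : P.-integrable setT (EFin \o (fun w => f (tnth (joint_variable X w)))).
  apply: (sqr_integrable_integrable (K := M ^+ 2)) => //.
  apply: mean_le_dom (mean_le_cst P (sqr_ge0 M)) _ _ _; first exact: measurable_funX.
  - by move=> w; exact: sqr_ge0.
  - by apply: aeW => w; rewrite -(real_normK (num_real _)) ler_sqr ?nnegrE.
split=> //; congr fine; apply: integral_distribution => //.
exact/measurable_EFinP.
Qed.

(** Three cases. Where Y is steady and X lies within r of it, the values of f differ by at most e.
    Where Y is not steady, the difference is at most 2 M, with probability at most p. Where some
    component is r away, 2 M is paid through Chebyshev's inequality. *)
Lemma chaos_estimate (dO : measure_display) (Omega : measurableType dO)
    (P : probability Omega R) (X Y : 'I_k -> {RV P >-> phase R d}) (e r K p : R) :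
  0 <= e -> 0 < r -> (forall j, mean_le P (fun w => phase_sqnorm (X j w - Y j w)) K) ->
  (joint_law Y (~` steady e r) <= p%:E)%E ->
  `| \int[joint_law X]_x f (tnth x) - \int[joint_law Y]_x f (tnth x) |
    <= e + 2 * M * p + 2 * M / r ^+ 2 * (k%:R * K).
Proof.
move=> e0 r0 XY Yp.
have [iX ->] := joint_law_integral X; have [iY ->] := joint_law_integral Y.
have mf := continuous_tnth_measurable cf.
pose D w := f (tnth (joint_variable X w)) - f (tnth (joint_variable Y w)).
have mD : measurable_fun setT D.
  by apply: measurable_funB; apply: (measurableT_comp mf); exact: measurable_funPT.
pose A := joint_variable Y @^-1` (~` steady e r).
have mA : measurable A.
  rewrite -[X in measurable X]setTI; apply: measurable_funPT => //.
  by apply: measurableC; exact: steady_measurable.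
have p_ind : mean_le P (\1_A : Omega -> R) p.
  split; first exact: measurable_indic.
    by move=> w; rewrite indicE.
  by have := integral_indic P measurableT mA; rewrite setIT => ->; exact: Yp.
have r20 : 0 < r ^+ 2 by exact: exprn_gt0.
have DK : mean_le P (fun w => `|D w|) (e + 2 * M * p + 2 * M / r ^+ 2 * (k%:R * K)).
  have -> : k%:R * K = \sum_(j < k) K by rewrite sumr_const card_ord mulr_natl.
  have M20 : 0 <= 2 * M by rewrite mulr_ge0.
  have M2r : 0 <= 2 * M / r ^+ 2 by rewrite divr_ge0// ltW.
  apply: mean_le_dom (mean_leD (mean_leD (mean_le_cst P e0) (mean_leZ M20 p_ind))
    (mean_leZ M2r (mean_le_sum (index_enum 'I_k) XY))) _ _ _ => //.
    exact: measurableT_comp.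
  apply: aeW => w.
  have D2M : `|D w| <= 2 * M.
    apply: le_trans (ler_normB _ _) _.
    have := fM (tnth (joint_variable X w)); have := fM (tnth (joint_variable Y w)).
    lra.
  have sum0 : 0 <= \sum_(j < k) phase_sqnorm (X j w - Y j w).
    by apply: sumr_ge0 => j _; exact: phase_sqnorm_ge0.
  have sum0' : 0 <= 2 * M / r ^+ 2 * \sum_(j < k) phase_sqnorm (X j w - Y j w).
    exact: mulr_ge0.
  rewrite indicE; have [wA|wA] := boolP (w \in A).
    by rewrite mulr1; lra.
  rewrite mulr0 addr0.
  have {wA}[r' rr' H] : steady e r (joint_variable Y w).
    by apply: contrapT => h; move/negP: wA; apply; apply/mem_set.
  have [/existsP[j rj]|] := boolP [exists j, r ^+ 2 <= phase_sqnorm (X j w - Y j w)].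
    apply: le_trans D2M _; rewrite -[leLHS]add0r; apply: lerD => //.
    rewrite -[_ / _ * _]mulrA (mulrC (r ^- 2)) ler_peMr// ler_pdivlMr// mul1r.
    apply: le_trans rj _; rewrite (bigD1 j)//= lerDl sumr_ge0// => l _.
    exact: phase_sqnorm_ge0.
  rewrite negb_exists => /forallP near.
  rewrite -[leLHS]addr0; apply: lerD => //; apply: H => i.
    rewrite !tnth_mktuple; have := near i; rewrite -ltNge => lt.
    have coord (g : phase R d -> 'rV[R]_d) : (forall x y, g (x - y) = g x - g y) ->
        (forall x, sqnorm (g x) <= phase_sqnorm x) -> forall c,
        `|g (Y i w) 0 c - g (X i w) 0 c| < r'.
      move=> gB gle c; apply: lt_trans rr'; rewrite distrC.
      rewrite -(@ltr_pXn2r _ 2)// ?nnegrE ?(ltW r0)//.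
      apply: le_lt_trans lt; apply: le_trans (gle _).
      by rewrite gB real_normK ?num_real//; have := sqnorm_coord (g (X i w) - g (Y i w)) c; rewrite !mxE.
    have r'0 := lt_trans r0 rr'.
    split; first split; split=> // i1 c; rewrite (ord1 i1).
    - by apply: (coord (@qof R d)) => //; exact: sqnorm_phase.
    - by apply: (coord (@pof R d)) => //; exact: sqnorm_pof.
    - by apply: (coord (@zof R d)) => //; exact: sqnorm_zof.
  by apply: ballxx; exact: lt_trans rr'.
rewrite -RintegralB//; have [_ _ DE] := DK.
apply: le_trans (le_normr_Rintegral _ _) _ => //.
  have := integrableB measurableT iX iY.
  by congr (_.-integrable _ _); apply/funext => w /=; rewrite -EFinB.
have [L DL LK] := mean_le_fine DK; rewrite /Rintegral DL; exact: LK.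
Qed.

End steady.

(** * Conclusion *)

(** The given pair is one admissible coupling. Exhibiting the real number under the square root
    serves the bounds on both the distance and its square. *)
Lemma W2_le (R : realType) (d : nat) (m n : probability (phase R d) R)
    (dO : measure_display) (Omega : measurableType dO) (P : probability Omega R)
    (X Y : {RV P >-> phase R d}) (K : R) : has_law X m -> has_law Y n ->
  mean_le P (fun w => phase_sqnorm (X w - Y w)) K ->
  exists2 a : R, 0 <= a <= K & W2 m n = (Num.sqrt a)%:E.
Proof.
move=> Xm Yn XY; rewrite /W2; set I := ereal_inf _.
have I0 : (0 <= I)%E.
  apply: le_ereal_inf_tmp => _ [? [? [P' [X' [Y' [_ _ ->]]]]]].
  by apply: expectation_ge0 => w; exact: phase_sqnorm_ge0.
have IK : (I <= K%:E)%E.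
  have [_ _ XYK] := XY; apply: le_trans XYK; apply: ereal_inf_lbound.
  by exists dO, Omega, P, X, Y; split=> //; rewrite unlock.
have Ifin : I \is a fin_num by rewrite ge0_fin_numE//; apply: le_lt_trans IK _; exact: ltry.
exists (fine I); first by rewrite fine_ge0//= -lee_fin fineK.
by rewrite -{1}(fineK Ifin) poweR_EFin powR12_sqrt// fine_ge0.
Qed.

Theorem theorem2 (R : realType) (d : nat) (hd : (0 < d)%N)
    (alpha beta lambda : R)
    (halpha : 0 < alpha) (hbeta : 0 < beta) (hlambda : 0 < lambda) :
  exists eta0 : R, 0 < eta0 /\
  forall (A B : 'rV[R]_d -> 'rV[R]_d) (CA CB : R),
    0 <= CA -> 0 <= CB ->
    lipschitz_map CA A -> lipschitz_map CB B -> odd_map B ->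
    CA + CB < eta0 ->
  forall rho0 : probability (phase R d) R, finite_second_moment rho0 ->
  exists C : R, 0 < C /\
  forall mu : R -> probability (phase R d) R,
    (forall t : R, 0 <= t -> finite_second_moment (mu t)) ->
    (forall N : nat, (1 <= N)%N ->
     forall (S : coupled_systems alpha beta lambda A B rho0 mu N) (i : 'I_N),
       (ereal_sup [set 'E_(prob S)[fun w =>
                          phase_sqnorm (X S i t w - Xt S i t w)%R]
                   | t in [set t : R | (0 <= t)%R]]
          <= (C / N%:R)%:E)%E
       /\
       (ereal_sup [set (W2 (distribution (prob S) (X S i t)) (mu t) ^+ 2)%E
                   | t in [set t : R | (0 <= t)%R]]
          <= (C / N%:R)%:E)%E)
    /\
    (forall S : forall N, coupled_systems alpha beta lambda A B rho0 mu N,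
       propagation_of_chaos (fun N => X (S N)) mu
       /\
       (forall e : R, 0 < e ->
        \forall N \near \oo, forall i : 'I_N,
          (ereal_sup [set W2 (distribution (prob (S N)) (X (S N) i t)) (mu t)
                      | t in [set t : R | (0 <= t)%R]] < e%:E)%E)).
Proof.
have [b [m [M [k [h0 bounds]]]]] := lyapunov_exists halpha hbeta hlambda.
have [C1 HV1] := bounds 1%N; have [C HV] := bounds d.
have [m0 M0 k0 C0 _ _ _ _ _] := HV.
have km0 : 0 < k * m by exact: mulr_gt0.
have C256 : 0 < 256 * C by rewrite pmulr_rgt0 ?ltr0n.
(* The bound by 1 gives (CA + CB)^2 <= CA + CB, which turns a linear threshold into the quadratic
   condition [small]. *)
exists (Num.min 1 (k * m / (256 * C))); split; first by rewrite lt_min ltr01 divr_gt0.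
move=> A B CA CB CA0 CB0 LA LB oB; rewrite lt_min => /andP[eta1 eta2] rho0 fin0.
have small : 256 * C * (CA ^+ 2 + CB ^+ 2) <= k * m.
  rewrite mulrC -ler_pdivlMr//; apply: le_trans (ltW eta2).
  apply: (@le_trans _ _ ((CA + CB) ^+ 2)).
    by rewrite sqrrD -addrA lerD2l lerDr mulrn_wge0// mulr_ge0.
  by rewrite expr2 ler_piMl ?addr_ge0// ltW.
(* N times the bound of [gap_mean]. Through [moment_bound] it involves [rho0] but not mu, as it
   must, being chosen before mu. *)
pose K := 2 / (k * m) * (64 * C * (CA ^+ 2 + CB ^+ 2) * (32 * C / (k * m)) + 16 * C) *
  (d%:R * (16 * CB ^+ 2 * moment_bound alpha lambda m M k C A CA CB rho0)).
exists (`|K| + 1); split; first by rewrite ltr_wpDl.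
move=> mu finmu; set D := `|K| + 1.
have D0 : 0 < D by rewrite ltr_wpDl.
have gap N (S : coupled_systems alpha beta lambda A B rho0 mu N) i t : 0 <= t ->
    mean_le (prob S) (fun w => phase_sqnorm (X S i t w - Xt S i t w)) (D / N%:R).
  move=> t0; have N0 : 0 < N%:R :> R by rewrite ltr0n (leq_ltn_trans _ (ltn_ord i)).
  apply: mean_leW (gap_mean halpha hbeta hlambda HV1 HV CA0 CB0 LA LB oB small S fin0 finmu i t0).
  rewrite [leLHS]mulrA ler_pM2r ?invr_gt0// -/K.
  by apply: le_trans (ler_norm _) _; rewrite lerDl.
have W2gap N (S : coupled_systems alpha beta lambda A B rho0 mu N) i t : 0 <= t ->
    exists2 a : R, 0 <= a <= D / N%:R &
      W2 (distribution (prob S) (X S i t)) (mu t) = (Num.sqrt a)%:E.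
  by move=> t0; apply: W2_le (gap N S i t t0) => //; exact: Xt_law.
split.
  move=> N N1 S i; split; apply: ge_ereal_sup => _ [t /= t0 <-].
    by rewrite unlock; have [] := gap N S i t t0.
  have [a /andP[a0 aD] ->] := W2gap N S i t t0.
  by rewrite -EFinM -expr2 sqr_sqrtr// lee_fin.
move=> S; split.
  move=> t l t0 l0 f cf [Mf fM] e e0.
  have Mf0 : 0 <= Mf := le_trans (normr_ge0 _) (fM (fun=> 0)).
  have e40 : 0 < e / 4 by rewrite divr_gt0.
  have M1 : 0 < 2 * Mf + 1 by rewrite ltr_wpDl// mulr_ge0.
  (* Steadiness is tested under the limit law, so the scale r does not depend on N. The probability
     e / 4 / (2 Mf + 1) costs at most e / 4 once multiplied by 2 Mf. *)
  have [n Hn] := steady_eventually cf (power_measure (mu t) l) e40 (divr_gt0 e40 M1).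
  set r : R := n.+1%:R^-1 in Hn; have r0 : 0 < r by rewrite invr_gt0.
  pose L := 2 * Mf / r ^+ 2 * (l%:R * D).
  near=> N => i inj.
  have N0 : 0 < N%:R :> R.
    by rewrite ltr0n (leq_ltn_trans _ (ltn_ord (i (Ordinal l0)))).
  have ind : independent (prob (S N)) (fun j => sigma_var (Xt (S N) (i j) t)).
    have indN := coupled_independent halpha hbeta hlambda HV1 HV CA0 CB0 LA LB oB small
      (S := S N) fin0 finmu t0.
    exact: (independent_inj (f := i) inj indN).
  have lawE := joint_law_power ind (fun j => @Xt_law _ _ _ _ _ _ _ _ _ _ (S N) (i j) t t0).
  have -> : \int[power_measure (mu t) l]_x f (tnth x) =
      \int[joint_law (fun j => Xt (S N) (i j) t)]_x f (tnth x).
    by congr fine; apply: eq_measure_integral => U mU _; exact/esym/lawE.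
  have LN : L / N%:R <= e / 4.
    rewrite ler_pdivrMr// mulrC -ler_pdivrMr//.
    by near: N; exact: nbhs_infty_ger.
  have stY : (joint_law (fun j => Xt (S N) (i j) t) (~` steady f (e / 4) r)
      <= (e / 4 / (2 * Mf + 1))%:E)%E.
    by rewrite lawE//; apply: measurableC; exact: steady_measurable.
  have := chaos_estimate cf Mf0 fM (ltW e40) r0 (fun j => gap N (S N) (i j) t t0) stY.
  move=> /le_lt_trans; apply.
  have -> : 2 * Mf / r ^+ 2 * (l%:R * (D / N%:R)) = L / N%:R by rewrite /L !mulrA.
  have h1 : 2 * Mf * (e / 4 / (2 * Mf + 1)) <= e / 4.
    by rewrite mulrCA ger_pMr// ler_pdivrMr// mul1r lerDl.
  apply: (@le_lt_trans _ _ (e / 4 + e / 4 + e / 4)); last by lra.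
  by apply: lerD => //; rewrite lerD2l.
move=> e e0; near=> N => i.
have N0 : 0 < N%:R :> R by rewrite ltr0n (leq_ltn_trans _ (ltn_ord i)).
have e20 : 0 < e / 2 by rewrite divr_gt0.
apply: (@le_lt_trans _ _ (e / 2)%:E); last by rewrite lte_fin; lra.
apply: ge_ereal_sup => _ [t /= t0 <-].
have [a /andP[a0 aD] ->] := W2gap N (S N) i t t0.
rewrite lee_fin -[leRHS]ger0_norm ?(ltW e20)// -sqrtr_sqr ler_sqrt ?sqr_ge0//.
apply: le_trans aD _; rewrite ler_pdivrMr// mulrC -ler_pdivrMr ?exprn_gt0//.
by near: N; exact: nbhs_infty_ger.
Unshelve. all: by end_near.
Qed.
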